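(* Let $N\ge 1$, let $\Omega\subset\mathbb{R}^N$ be a bounded open domain with $C^1$ boundary and outward unit normal $\nu$, and let $g^\pm\in C^1(\overline\Omega)$ with $g^-(x)<g^+(x)$ for $x\in\overline\Omega$. Let $F\in C(\mathcal{S}(N+1)\times\mathbb{R}^{N+1}\times\mathbb{R}\times\overline\Omega\times[-1,1],\mathbb{R})$ and suppose there is a constant $\alpha>0$ such that, for every $(p,x,y)\in\mathbb{R}^{N+1}\times\overline\Omega\times[-1,1]$, $F(X,p,r,x,y)-\alpha r\le F(Y,p,s,x,y)-\alpha s$ whenever $X,Y\in\mathcal{S}(N+1)$, $r,s\in\mathbb{R}$, $X\ge Y$ and $r\le s$. Let $\gamma_1^\pm\in C(\overline\Omega\times[-1,1],\mathbb{R}^N)$, $\beta^\pm\in C(\overline\Omega\times[-1,1],\mathbb{R})$ and put $\gamma^+=(\gamma_1^+,1)$, $\gamma^-=(\gamma_1^-,-1)$. Assume that there are $\gamma_o\in C^1(\overline\Omega,\mathbb{R}^N)$, $\beta_o\in C^1(\overline\Omega,\mathbb{R})$ with $$\gamma_1^+(x,0)=-\gamma_1^-(x,0)=\gamma_o(x),\qquad \beta^+(x,0)=-\beta^-(x,0)=\beta_o(x)\qquad (x\in\overline\Omega),$$ and $k^\pm\in C(\overline\Omega,\mathbb{R}^N)$, $l^\pm\in C(\overline\Omega,\mathbb{R})$ such that, as $y\to0$, uniformly in $x\in\overline\Omega$, $$\gamma_1^\pm(x,y)=\pm\gamma_o(x)+k^\pm(x)y+o(|y|),\qquad \beta^\pm(x,y)=\pm\beta_o(x)+l^\pm(x)y+o(|y|).$$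 Let $\beta\in C(\partial\Omega\times[-1,1],\mathbb{R})$ and consider, on the lateral boundary $\partial_{\mathrm L}\Omega_\varepsilon$, either (O) the oblique condition $\gamma\cdot Du=\beta$, where $\gamma=(\gamma_1,\gamma_2)\in C(\partial\Omega\times[-1,1],\mathbb{R}^{N+1})$ satisfies $\gamma_1(x,y)\cdot\nu(x)>0$ for $(x,y)\in\partial\Omega\times[-1,1]$ and $\gamma_2(x,0)=0$ for $x\in\partial\Omega$; or (D) the Dirichlet condition $u=\beta$. In each of the two cases there exist positive constants $\varepsilon_1<\varepsilon_0$ and $C_0$ such that for each $0<\varepsilon<\varepsilon_1$ there is a viscosity solution $u^\varepsilon$ of $$F(D^2u,Du,u,x,y)=0\ \text{in }\Omega_\varepsilon,\quad \gamma^+\cdot Du=\beta^+\ \text{on }\partial_{\mathrm T}\Omega_\varepsilon,\quad \gamma^-\cdot Du=\beta^-\ \text{on }\partial_{\mathrm B}\Omega_\varepsilon$$ together with the chosen lateral condition on $\partial_{\mathrm L}\Omega_\varepsilon$; furthermore, for each $0<\varepsilon<\varepsilon_1$, any viscosity solution $u^\varepsilon$ of this problem satisfies $\sup_{\overline{\Omega_\varepsilon}}|u^\varepsilon|\le C_0$.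
   Context: $\mathcal{S}(k)$ is the space of real symmetric $k\times k$ matrices with the semidefinite order. For compact $K\subset\mathbb{R}^j$, $C^i(K,\mathbb{R}^k)$ denotes restrictions to $K$ of $C^i$ functions on $\mathbb{R}^j$. For $\varepsilon>0$: $\Omega_\varepsilon=\{(x,y)\in\Omega\times\mathbb{R}: \varepsilon g^-(x)<y<\varepsilon g^+(x)\}$, $\partial_{\mathrm T}\Omega_\varepsilon=\{(x,y): x\in\overline\Omega,\ y=\varepsilon g^+(x)\}$, $\partial_{\mathrm B}\Omega_\varepsilon=\{(x,y): x\in\overline\Omega,\ y=\varepsilon g^-(x)\}$, $\partial_{\mathrm L}\Omega_\varepsilon=\{(x,y): x\in\partial\Omega,\ \varepsilon g^-(x)\le y\le\varepsilon g^+(x)\}$. The constant $\varepsilon_0>0$ is fixed so small that for all $0<\varepsilon<\varepsilon_0$: $\overline{\Omega_\varepsilon}\subset\overline\Omega\times[-1,1]$, $1-\varepsilon Dg^+\cdot\gamma_1^+>0$ on $\partial_{\mathrm T}\Omega_\varepsilon$, and $1+\varepsilon Dg^-\cdot\gamma_1^->0$ on $\partial_{\mathrm B}\Omega_\varepsilon$ (obliqueness of $\gamma^\pm$). Viscosity solutions. A bounded function $u$ on $\overline{\Omega_\varepsilon}$ is a viscosity subsolution if, with $v$ its upper semicontinuous envelope on $\overline{\Omega_\varepsilon}$, whenever $\phi\in C^2(\overline{\Omega_\varepsilon})$ and $v-\phi$ attains its maximum over $\overline{\Omega_\varepsilon}$ at $\hat z$, at least one of the following holds: (a) $F(D^2\phi(\hat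 z),D\phi(\hat z),v(\hat z),\hat z)\le0$; (b) $\hat z\in\partial_{\mathrm L}\Omega_\varepsilon$ and $\gamma(\hat z)\cdot D\phi(\hat z)\le\beta(\hat z)$ in case (O), respectively $v(\hat z)\le\beta(\hat z)$ in case (D); (c) $\hat z\in\partial_{\mathrm T}\Omega_\varepsilon$ and $\gamma^+(\hat z)\cdot D\phi(\hat z)\le\beta^+(\hat z)$; (d) $\hat z\in\partial_{\mathrm B}\Omega_\varepsilon$ and $\gamma^-(\hat z)\cdot D\phi(\hat z)\le\beta^-(\hat z)$. Viscosity supersolutions are defined by replacing maximum by minimum, $\le$ by $\ge$, and the upper by the lower semicontinuous envelope. A viscosity solution is a bounded function that is both a viscosity subsolution and supersolution (continuity is not required). *)

(* Defs.v *)
(* R^k is 'rV[R]_k; a point z of R^(N+1)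
   is read as (x, y) with x its first N coordinates and y its last one. *)
From HB Require Import structures.
From mathcomp Require Import all_boot all_order all_algebra.
From mathcomp Require Import all_classical all_reals all_analysis.
Set Implicit Arguments.
Unset Strict Implicit.
Unset Printing Implicit Defensive.
Import Order.TTheory GRing.Theory Num.Theory.
Import numFieldNormedType.Exports.
Local Open Scope classical_set_scope.
Local Open Scope ring_scope.

Definition dot (R : realType) (k : nat) (u v : 'rV[R]_k) : R :=
  \sum_(i < k) u 0 i * v 0 i.

(* The library norm on 'rV[R]_k is the sup norm, hence this one. *)
Definition enorm (R : realType) (k : nat) (u : 'rV[R]_k) : R :=
  Num.sqrt (dot u u).

Definition grad (R : realType) (k : nat) (f : 'rV[R]_k -> R) (x : 'rV[R]_k) :
    'rV[R]_k :=
  \row_(i < k) 'D_(delta_mx 0 i) f x.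

Definition hess (R : realType) (k : nat) (f : 'rV[R]_k -> R) (x : 'rV[R]_k) :
    'M[R]_k :=
  \matrix_(i < k, j < k)
    'D_(delta_mx 0 j) (fun w => 'D_(delta_mx 0 i) f w) x.

Definition symmetric_mx (R : realType) (k : nat) (X : 'M[R]_k) : Prop :=
  X^T = X.

Definition semidef_ge (R : realType) (k : nat) (X Y : 'M[R]_k) : Prop :=
  forall xi : 'rV[R]_k, 0 <= (xi *m (X - Y) *m xi^T) 0 0.

(* In finite dimension, continuity of x |-> 'd f x is continuity of each
   x |-> 'D_v f x. *)
Definition C1 (R : realType) (V W : normedModType R) (f : V -> W) : Prop :=
  (forall x, differentiable f x) /\
  (forall v, continuous (fun x => 'D_v f x)).

Definition C2 (R : realType) (V W : normedModType R) (f : V -> W) : Prop :=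
  C1 f /\ (forall v, C1 (fun x => 'D_v f x)).

(* C^0(K) and C^1(K) for compact K: restrictions to K of functions that are C^0,
   resp. C^1, on the whole space. *)
Definition C0_on (T U : topologicalType) (K : set T) (f : T -> U) : Prop :=
  exists2 G : T -> U, continuous G & forall x, K x -> f x = G x.

Definition C1_on (R : realType) (V W : normedModType R) (K : set V)
    (f : V -> W) : Prop :=
  exists2 G : V -> W, C1 G & forall x, K x -> f x = G x.

Definition bdry (T : topologicalType) (A : set T) : set T :=
  closure A `\` A°.

Definition cylinder (R : realType) (N : nat) (K : set 'rV[R]_N) :
    set ('rV[R]_N * R) :=
  [set t | K t.1 /\ -1 <= t.2 <= 1].

Definition bounded_domain (R : realType) (N : nat) (Om : set 'rV[R]_N) : Prop :=
  [/\ Om !=set0, open Om, connected Om & bounded_set Om].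

(* Near x0, Om is the sublevel set {rho < 0}; since grad rho x0 != 0, near x0 the
   boundary is then {rho = 0} and grad rho points out of Om. *)
Definition C1_defining (R : realType) (N : nat) (Om : set 'rV[R]_N)
    (x0 : 'rV[R]_N) (rho : 'rV[R]_N -> R) : Prop :=
  [/\ C1 rho, grad rho x0 != 0 & \forall x \near x0, Om x <-> rho x < 0].

Definition C1_boundary (R : realType) (N : nat) (Om : set 'rV[R]_N) : Prop :=
  forall x0, bdry Om x0 -> exists rho, C1_defining Om x0 rho.

Definition outward_unit_normal (R : realType) (N : nat) (Om : set 'rV[R]_N)
    (nu : 'rV[R]_N -> 'rV[R]_N) : Prop :=
  forall x0, bdry Om x0 ->
    exists2 rho, C1_defining Om x0 rho &
                 nu x0 = (enorm (grad rho x0))^-1 *: grad rho x0.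

Definition uniform_expansion0 (R : realType) (N : nat) (V : normedModType R)
    (K : set 'rV[R]_N) (f : 'rV[R]_N * R -> V) (a b : 'rV[R]_N -> V) : Prop :=
  forall e : R, 0 < e ->
    \forall y \near (0 : R), forall x, K x ->
      `|f (x, y) - (a x + y *: b x)| <= e * `|y|.

Definition xpart (R : realType) (N : nat) (z : 'rV[R]_(N + 1)) : 'rV[R]_N :=
  lsubmx z.

Definition ypart (R : realType) (N : nat) (z : 'rV[R]_(N + 1)) : R :=
  rsubmx z 0 0.

Definition xy (R : realType) (N : nat) (z : 'rV[R]_(N + 1)) : 'rV[R]_N * R :=
  (xpart z, ypart z).

Definition mkvec (R : realType) (N : nat) (a : 'rV[R]_N) (b : R) :
    'rV[R]_(N + 1) :=
  row_mx a b%:M.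

Definition Omega_eps (R : realType) (N : nat) (Om : set 'rV[R]_N)
    (gm gp : 'rV[R]_N -> R) (eps : R) : set 'rV[R]_(N + 1) :=
  [set z | Om (xpart z) /\ eps * gm (xpart z) < ypart z < eps * gp (xpart z)].

Definition top_bdry (R : realType) (N : nat) (Om : set 'rV[R]_N)
    (gp : 'rV[R]_N -> R) (eps : R) : set 'rV[R]_(N + 1) :=
  [set z | closure Om (xpart z) /\ ypart z = eps * gp (xpart z)].

Definition bot_bdry (R : realType) (N : nat) (Om : set 'rV[R]_N)
    (gm : 'rV[R]_N -> R) (eps : R) : set 'rV[R]_(N + 1) :=
  [set z | closure Om (xpart z) /\ ypart z = eps * gm (xpart z)].

Definition lat_bdry (R : realType) (N : nat) (Om : set 'rV[R]_N)
    (gm gp : 'rV[R]_N -> R) (eps : R) : set 'rV[R]_(N + 1) :=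
  [set z | bdry Om (xpart z) /\
           eps * gm (xpart z) <= ypart z <= eps * gp (xpart z)].

Definition eps0_admissible (R : realType) (N : nat) (Om : set 'rV[R]_N)
    (gm gp : 'rV[R]_N -> R) (gamma1m gamma1p : 'rV[R]_N * R -> 'rV[R]_N)
    (eps0 : R) : Prop :=
  forall eps : R, 0 < eps < eps0 ->
  [/\ forall z, closure (Omega_eps Om gm gp eps) z ->
        closure Om (xpart z) /\ -1 <= ypart z <= 1,
      forall z, top_bdry Om gp eps z ->
        0 < 1 - eps * dot (grad gp (xpart z)) (gamma1p (xy z)) &
      forall z, bot_bdry Om gm eps z ->
        0 < 1 + eps * dot (grad gm (xpart z)) (gamma1m (xy z))].

Inductive lateral_condition (R : realType) (N : nat) : Type :=
| Oblique of ('rV[R]_N * R -> 'rV[R]_(N + 1))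
| Dirichlet.
Arguments Dirichlet {R N}.

Definition lateral_admissible (R : realType) (N : nat) (Om : set 'rV[R]_N)
    (nu : 'rV[R]_N -> 'rV[R]_N) (c : lateral_condition R N) : Prop :=
  match c with
  | Oblique gamma =>
    [/\ C0_on (cylinder (bdry Om)) gamma,
        forall x y, bdry Om x -> -1 <= y <= 1 ->
          0 < dot (xpart (gamma (x, y))) (nu x) &
        forall x, bdry Om x -> ypart (gamma (x, 0)) = 0]
  | Dirichlet => True
  end.

(* Left-hand side of the lateral condition "... = beta", as a function of the
   point z, the value r of u and the gradient p of u. *)
Definition lateral_lhs (R : realType) (N : nat) (c : lateral_condition R N)
    (z : 'rV[R]_(N + 1)) (r : R) (p : 'rV[R]_(N + 1)) : R :=
  match c with
  | Oblique gamma => dot (gamma (xy z)) p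
  | Dirichlet => r
  end.

(* Semicontinuous envelopes on K, at points of K: upper and lower limits along K,
   the point itself included; [fine] is harmless when u is bounded on K. *)
Definition usc_env (R : realType) (k : nat) (K : set 'rV[R]_k)
    (u : 'rV[R]_k -> R) (z : 'rV[R]_k) : R :=
  fine (limf_esup (fun w => (u w)%:E) (within K (nbhs z))).

Definition lsc_env (R : realType) (k : nat) (K : set 'rV[R]_k)
    (u : 'rV[R]_k -> R) (z : 'rV[R]_k) : R :=
  fine (limf_einf (fun w => (u w)%:E) (within K (nbhs z))).

(* Data of the boundary value problem; [F] takes (X, p, r, (x, y)). *)
Record thin_bvp (R : realType) (N : nat) := ThinBVP {
  bvp_Om : set 'rV[R]_N;
  bvp_gm : 'rV[R]_N -> R;
  bvp_gp : 'rV[R]_N -> R;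
  bvp_F : 'M[R]_(N + 1) * 'rV[R]_(N + 1) * R * ('rV[R]_N * R) -> R;
  bvp_gamma1m : 'rV[R]_N * R -> 'rV[R]_N;
  bvp_gamma1p : 'rV[R]_N * R -> 'rV[R]_N;
  bvp_betam : 'rV[R]_N * R -> R;
  bvp_betap : 'rV[R]_N * R -> R;
  bvp_lat : lateral_condition R N;
  bvp_beta : 'rV[R]_N * R -> R
}.

Definition bvp_closure (R : realType) (N : nat) (P : thin_bvp R N) (eps : R) :
    set 'rV[R]_(N + 1) :=
  closure (Omega_eps (bvp_Om P) (bvp_gm P) (bvp_gp P) eps).

(* Test functions in C^2(K) are represented by C^2 functions on R^(N+1). *)
Definition visc_subsol (R : realType) (N : nat) (P : thin_bvp R N) (eps : R)
    (u : 'rV[R]_(N + 1) -> R) : Prop :=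
  let K := bvp_closure P eps in
  let v := usc_env K u in
  [bounded u z | z in K] /\
  forall (phi : 'rV[R]_(N + 1) -> R) (zh : 'rV[R]_(N + 1)),
    C2 phi -> K zh -> (forall z, K z -> v z - phi z <= v zh - phi zh) ->
  [\/ bvp_F P (hess phi zh, grad phi zh, v zh, xy zh) <= 0,
      lat_bdry (bvp_Om P) (bvp_gm P) (bvp_gp P) eps zh /\
        lateral_lhs (bvp_lat P) zh (v zh) (grad phi zh) <= bvp_beta P (xy zh),
      top_bdry (bvp_Om P) (bvp_gp P) eps zh /\
        dot (mkvec (bvp_gamma1p P (xy zh)) 1) (grad phi zh)
          <= bvp_betap P (xy zh) |
      bot_bdry (bvp_Om P) (bvp_gm P) eps zh /\
        dot (mkvec (bvp_gamma1m P (xy zh)) (-1)) (grad phi zh)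
          <= bvp_betam P (xy zh)].

Definition visc_supersol (R : realType) (N : nat) (P : thin_bvp R N) (eps : R)
    (u : 'rV[R]_(N + 1) -> R) : Prop :=
  let K := bvp_closure P eps in
  let v := lsc_env K u in
  [bounded u z | z in K] /\
  forall (phi : 'rV[R]_(N + 1) -> R) (zh : 'rV[R]_(N + 1)),
    C2 phi -> K zh -> (forall z, K z -> v zh - phi zh <= v z - phi z) ->
  [\/ 0 <= bvp_F P (hess phi zh, grad phi zh, v zh, xy zh),
      lat_bdry (bvp_Om P) (bvp_gm P) (bvp_gp P) eps zh /\
        bvp_beta P (xy zh) <= lateral_lhs (bvp_lat P) zh (v zh) (grad phi zh),
      top_bdry (bvp_Om P) (bvp_gp P) eps zh /\
        bvp_betap P (xy zh)
          <= dot (mkvec (bvp_gamma1p P (xy zh)) 1) (grad phi zh) |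
      bot_bdry (bvp_Om P) (bvp_gm P) eps zh /\
        bvp_betam P (xy zh)
          <= dot (mkvec (bvp_gamma1m P (xy zh)) (-1)) (grad phi zh)].

Definition visc_sol (R : realType) (N : nat) (P : thin_bvp R N) (eps : R)
    (u : 'rV[R]_(N + 1) -> R) : Prop :=
  visc_subsol P eps u /\ visc_supersol P eps u.

(* Main.v *)
Require Import Defs.
From HB Require Import structures.
From mathcomp Require Import all_boot all_order all_algebra.
From mathcomp Require Import all_classical all_reals all_analysis.
From mathcomp Require Import ring lra.
Set Implicit Arguments.
Unset Strict Implicit.
Unset Printing Implicit Defensive.
Import Order.TTheory GRing.Theory Num.Theory.
Import numFieldNormedType.Exports.
Local Open Scope classical_set_scope.
Local Open Scope ring_scope.

(** The proof combines Perron's method with barriers that are uniform in [eps].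

Existence. The candidate is the supremum [perron] of all subsolutions. Its upper
envelope is a subsolution by the usual stability argument [perron_subsol]. Its lower
envelope is a supersolution by the bump argument [perron_supersol]: otherwise a test
function touching from below could be raised slightly and the maximum with the
supremum would be a larger subsolution. The bump has to be a subsolution in the
viscosity sense also at boundary points, and this is [strict_touch]: two [C2]
functions that satisfy all the relevant inequalities strictly, with opposite signs,
cannot touch from the wrong side, because one can move into the domain along the
direction opposite to the oblique field. Where the lateral boundary meets the top or
the bottom this requires one direction oblique to both, which exists for small [eps]
since the lateral field is horizontal at y = 0 ([corner_near]).

Bounds. A barrier is a continuous function with, at each point, a [C2] majorant that
touches it there and satisfies all the supersolution inequalities strictly for every
larger value of u. At a maximum of a subsolution minus the barrier, the majorant is a
test function, so the subsolution lies below the barrier ([barrier_above]). The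
reflection u -> -u turns supersolutions into subsolutions of a problem of the same
kind; a barrier for it gives the lower bound, and its opposite is a subsolution, so
the supremum is over a nonempty family ([refl_barrier_subsol]). Hence both existence
and the bound follow once barriers exist with a bound independent of [eps].

The barrier ([barrier_exists]). Formally it is A + psi(x) + y b(x) + C y^2 / 2 with
psi of large oblique derivative on the lateral boundary and
b = betao - gammao . D psi, which cancels the leading terms of the conditions on the
top and the bottom; the quadratic term, centred at the mid-surface, beats the
remaining errors of order [eps], and a large A takes care of the equation. The domain
and the data are only [C1], so psi and b are not smooth enough. Minima of finite
families of smooth functions are barriers all the same: psi becomes a minimum of
quadratics centred at boundary points ([oblique_family]), and b is frozen at the
points of an [eps]-net with a penalty of the distance. *)

(** * Inner products *)

Section Dot.
Context {R : realType} {k : nat}.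
Implicit Types u v w : 'rV[R]_k.

Lemma dotC u v : dot u v = dot v u.
Proof. by apply: eq_bigr => i _; rewrite mulrC. Qed.

Lemma dotDl u v w : dot (u + v) w = dot u w + dot v w.
Proof. by rewrite /dot -big_split; apply: eq_bigr => i _; rewrite mxE mulrDl. Qed.

Lemma dotZl a u w : dot (a *: u) w = a * dot u w.
Proof. by rewrite /dot mulr_sumr; apply: eq_bigr => i _; rewrite mxE mulrA. Qed.

Lemma dotNl u w : dot (- u) w = - dot u w.
Proof. by rewrite -scaleN1r dotZl mulN1r. Qed.

Lemma dotBl u v w : dot (u - v) w = dot u w - dot v w.
Proof. by rewrite dotDl dotNl. Qed.

Lemma dotDr u v w : dot u (v + w) = dot u v + dot u w.
Proof. by rewrite dotC dotDl !(dotC u). Qed.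

Lemma dotZr a u w : dot u (a *: w) = a * dot u w.
Proof. by rewrite dotC dotZl dotC. Qed.

Lemma dotNr u w : dot u (- w) = - dot u w.
Proof. by rewrite dotC dotNl dotC. Qed.

Lemma dotBr u v w : dot u (v - w) = dot u v - dot u w.
Proof. by rewrite dotDr dotNr. Qed.

Lemma normr_coord u i : `|u 0 i| <= `|u|.
Proof.
by rewrite [leRHS]/Num.Def.normr /= mx_normrE; apply/bigmax_geP; right => /=; exists (0, i).
Qed.

Lemma rV_norm_le u (b : R) : 0 <= b -> (forall i, `|u 0 i| <= b) -> `|u| <= b.
Proof.
move=> b0 ub; rewrite [leLHS]/Num.Def.normr /= mx_normrE; apply/bigmax_leP; split => //.
by move=> [i j] _ /=; rewrite ord1.
Qed.

Lemma dot_norm_le u v : `|dot u v| <= k%:R * `|u| * `|v|.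
Proof.
apply: (le_trans (ler_norm_sum _ _ _)).
apply: (@le_trans _ _ (\sum_(i < k) `|u| * `|v|)).
  by apply: ler_sum => i _; rewrite normrM ler_pM // normr_coord.
by rewrite sumr_const card_ord -[leLHS]mulr_natl mulrA.
Qed.

Lemma dot_ge0 u : 0 <= dot u u.
Proof. by apply: sumr_ge0 => i _; rewrite -expr2 sqr_ge0. Qed.

Lemma sqr_norm_le_dot u : `|u| ^+ 2 <= dot u u.
Proof.
rewrite -[leRHS]sqr_sqrtr ?dot_ge0// lerXn2r ?nnegrE ?sqrtr_ge0//.
apply: rV_norm_le => [|i]; first exact: sqrtr_ge0.
rewrite -sqrtr_sqr ler_sqrt ?dot_ge0// /dot (bigD1 i)//= -expr2 lerDl.
by apply: sumr_ge0 => j _; rewrite -expr2 sqr_ge0.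
Qed.

Lemma dot_delta i u : dot (delta_mx 0 i) u = u 0 i.
Proof.
rewrite /dot (bigD1 i)//= big1 => [|j ji]; rewrite !mxE eqxx /=.
  by rewrite eqxx mul1r addr0.
by rewrite (negbTE ji) mul0r.
Qed.

Lemma cvg_dot {T : Type} {G : set_system T} {FG : Filter G} (f g : T -> 'rV[R]_k) u v :
  f @ G --> u -> g @ G --> v -> (fun t => dot (f t) (g t)) @ G --> dot u v.
Proof.
move=> fu gv; rewrite /dot.
apply: cvg_big => [|i _]; first exact: add_continuous.
apply: cvgM.
  exact: (cvg_comp _ _ fu (@coord_continuous R 1 k 0 i u)).
exact: (cvg_comp _ _ gv (@coord_continuous R 1 k 0 i v)).
Qed.

Lemma cvg_rV {T : Type} {G : set_system T} {FG : Filter G} (f : T -> 'rV[R]_k) u :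
  (forall i, (fun t => f t 0 i) @ G --> u 0 i) -> f @ G --> u.
Proof.
move=> fu; apply/cvgrPdist_le => e e0.
have := @filter_forall _ 'I_k (fun i t => `|u 0 i - f t 0 i| <= e) G FG.
have H i : G [set t | `|u 0 i - f t 0 i| <= e].
  by have /cvgrPdist_le/(_ e e0) := fu i.
move=> /(_ H); apply: filterS => t Ht.
by apply: rV_norm_le => [|i]; [exact: ltW|rewrite !mxE].
Qed.

End Dot.

Lemma cvg_mx {R : realType} {m n : nat} {T : Type} {G : set_system T} {FG : Filter G}
    (f : T -> 'M[R]_(m, n)) (u : 'M[R]_(m, n)) :
  (forall i j, (fun t => f t i j) @ G --> u i j) -> f @ G --> u.
Proof.
move=> fu; apply/cvgrPdist_le => e e0.
have := @filter_forall _ ('I_m * 'I_n)%type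
  (fun i t => `|u i.1 i.2 - f t i.1 i.2| <= e) G FG.
have H i : G [set t | `|u i.1 i.2 - f t i.1 i.2| <= e].
  by have /cvgrPdist_le/(_ e e0) := fu i.1 i.2.
move=> /(_ H); apply: filterS => t Ht.
rewrite [leLHS]/Num.Def.normr /= mx_normrE; apply/bigmax_leP; split; first exact: ltW.
by move=> i _; rewrite !mxE.
Qed.

Lemma cvg_quad {T : Type} {A B C D : topologicalType} {F : set_system T} {FF : Filter F}
    (f : T -> A) (g : T -> B) (h : T -> C) (k : T -> D) (a : A) (b : B) (c : C) (d : D) :
  f @ F --> a -> g @ F --> b -> h @ F --> c -> k @ F --> d ->
  (f t, g t, h t, k t) @[t --> F] --> (a, b, c, d).
Proof. by move=> fa gb hc kd; exact: (cvg_pair (cvg_pair (cvg_pair fa gb) hc) kd). Qed.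

(** * Calculus of [C1] and [C2] functions *)

Section Calculus.
Context {R : realType}.

Lemma C1_differentiable {V W : normedModType R} (f : V -> W) x :
  C1 f -> differentiable f x.
Proof. by move=> []. Qed.

Lemma C1_derivable {V W : normedModType R} (f : V -> W) x v : C1 f -> derivable f x v.
Proof. by move=> [df _]; exact: diff_derivable. Qed.

Lemma C1_continuous {V W : normedModType R} (f : V -> W) : C1 f -> continuous f.
Proof. by move=> [df _] x; apply: differentiable_continuous. Qed.

Lemma C1_cvg {V W : normedModType R} (f : V -> W) (Cf : C1 f) (x : V) :
  f y @[y --> x] --> f x.
Proof. exact: (C1_continuous Cf). Qed.
Arguments C1_cvg {V W f} Cf x.

Lemma C1_add {V W : normedModType R} (f g : V -> W) : C1 f -> C1 g -> C1 (fun y => f y + g y).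
Proof.
move=> Cf Cg; split => [x|v].
  by apply: differentiableD; exact: C1_differentiable.
rewrite (_ : (fun x => _) = (fun x => 'D_v f x + 'D_v g x)); last first.
  by apply/funext => x; rewrite deriveD//; exact: C1_derivable.
by move=> x; apply: cvgD; [case: Cf => _; apply|case: Cg => _; apply].
Qed.

Lemma C1_opp {V W : normedModType R} (f : V -> W) : C1 f -> C1 (fun y => - f y).
Proof.
move=> Cf; split => [x|v].
  by apply: differentiableN; exact: C1_differentiable.
rewrite (_ : (fun x => _) = (fun x => - 'D_v f x)); last first.
  by apply/funext => x; rewrite deriveN//; exact: C1_derivable.
by move=> x; apply: cvgN; case: Cf => _; apply.
Qed.

Lemma C2_C1 {V W : normedModType R} (f : V -> W) : C2 f -> C1 f.
Proof. by case. Qed.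

Lemma derivable_line {V W : normedModType R} (f : V -> W) x v (t : R) :
  derivable f (x + t *: v) v ->
  is_derive t 1 (fun s => f (x + s *: v)) ('D_v f (x + t *: v)).
Proof.
move=> df.
have E : (fun h : R => h^-1 *: ((fun s => f (x + s *: v)) (h *: 1 + t) - f (x + t *: v)))
     = (fun h => h^-1 *: (f (h *: v + (x + t *: v)) - f (x + t *: v))).
  by apply/funext => h; rewrite [h *: 1]mulr1 scalerDl addrCA.
split; rewrite /derivable ?/derive E //.
Qed.

Lemma C1_line_cont {V W : normedModType R} (f : V -> W) x v :
  continuous f -> continuous (fun s : R => f (x + s *: v)).
Proof.
move=> cf t; apply: (@continuous_comp _ _ _ (fun s : R => x + s *: v) f).
  by apply: cvgD; [exact: cvg_cst|apply: cvgZr_tmp; exact: cvg_id].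
exact: cf.
Qed.

Lemma MVT_line {V : normedModType R} (f : V -> R) x v : C1 f ->
  exists2 t : R, 0 < t < 1 & f (x + v) - f x = 'D_v f (x + t *: v).
Proof.
move=> Cf.
have [t|t|t t01 /=] := @MVT R (fun s => f (x + s *: v))
    (fun t => 'D_v f (x + t *: v)) 0 1 ltr01.
- by move=> _; apply: derivable_line; exact: C1_derivable.
- apply: continuous_subspaceT; apply: C1_line_cont; exact: C1_continuous.
rewrite scale1r scale0r addr0 subr0 mulr1 => ->.
  by exists t => //; move: t01; rewrite in_itv.
Qed.

Lemma MVT_pos (f df : R -> R) (h : R) : 0 < h ->
  (forall x : R, is_derive x (1 : R) f (df x)) ->
  exists2 t, 0 < t < h & f h - f 0 = df t * h.
Proof.
move=> h0 df_; have [|t] := @MVT R f df 0 h h0 (fun x _ => df_ x).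
  apply: continuous_subspaceT => y; apply: differentiable_continuous.
  by apply/derivable1_diffP; have [] := df_ y.
by rewrite in_itv/= subr0 => t0 ->; exists t.
Qed.

Lemma derive_dot_grad {k : nat} (f : 'rV[R]_k -> R) x v :
  differentiable f x -> 'D_v f x = dot v (grad f x).
Proof.
move=> df; rewrite deriveE// {1}(row_sum_delta v) linear_sum /=.
by apply: eq_bigr => i _; rewrite linearZ /= mxE deriveE.
Qed.

Lemma gradE {k : nat} (f : 'rV[R]_k -> R) x i : grad f x 0 i = 'D_(delta_mx 0 i) f x.
Proof. by rewrite mxE. Qed.

Lemma hessE {k : nat} (f : 'rV[R]_k -> R) x i j :
  hess f x i j = 'D_(delta_mx 0 j) (fun w => 'D_(delta_mx 0 i) f w) x.
Proof. by rewrite mxE. Qed.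

Lemma derive_add {V W : normedModType R} (f g : V -> W) x v :
  derivable f x v -> derivable g x v ->
  'D_v (fun y => f y + g y) x = 'D_v f x + 'D_v g x.
Proof. exact: deriveD. Qed.

Lemma derive_opp {V W : normedModType R} (f : V -> W) x v :
  derivable f x v -> 'D_v (fun y => - f y) x = - 'D_v f x.
Proof. exact: deriveN. Qed.

Lemma derive_lincomb {V : normedModType R} {n : nat} (F : 'I_n -> V -> R)
    (a : 'I_n -> R) x v : (forall i, derivable (F i) x v) ->
  'D_v (fun y => \sum_(i < n) a i * F i y) x = \sum_(i < n) a i * 'D_v (F i) x.
Proof.
move=> dF; have H := is_derive_sum (fun i => is_deriveZ (a i) (derivableP (dF i))).
rewrite (_ : (fun y => _) = \sum_(i < n) (a i \*: F i)); last by rewrite fct_sumE.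
exact: derive_val.
Qed.

Lemma derive_addE {V W : normedModType R} (f g : V -> W) v : C1 f -> C1 g ->
  (fun x => 'D_v (fun y => f y + g y) x) = (fun x => 'D_v f x + 'D_v g x).
Proof. by move=> Cf Cg; apply/funext => x; rewrite derive_add//; exact: C1_derivable. Qed.

Lemma derive_oppE {V W : normedModType R} (f : V -> W) v : C1 f ->
  (fun x => 'D_v (fun y => - f y) x) = (fun x => - 'D_v f x).
Proof. by move=> Cf; apply/funext => x; rewrite derive_opp//; exact: C1_derivable. Qed.

Lemma C2_add {V W : normedModType R} (f g : V -> W) : C2 f -> C2 g -> C2 (fun y => f y + g y).
Proof.
move=> [Cf Cf'] [Cg Cg']; split; first exact: C1_add.
by move=> v; rewrite (derive_addE _ Cf Cg); exact: C1_add.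
Qed.

Lemma C2_opp {V W : normedModType R} (f : V -> W) : C2 f -> C2 (fun y => - f y).
Proof.
move=> [Cf Cf']; split; first exact: C1_opp.
by move=> v; rewrite (derive_oppE _ Cf); exact: C1_opp.
Qed.

Lemma grad_add {k : nat} (f g : 'rV[R]_k -> R) x : C1 f -> C1 g ->
  grad (fun y => f y + g y) x = grad f x + grad g x.
Proof.
move=> Cf Cg; apply/rowP => i; rewrite [RHS]mxE [LHS]gradE ![in RHS]gradE.
by rewrite derive_add//; exact: C1_derivable.
Qed.

Lemma grad_opp {k : nat} (f : 'rV[R]_k -> R) x : C1 f -> grad (fun y => - f y) x = - grad f x.
Proof.
move=> Cf; apply/rowP => i; rewrite [RHS]mxE [LHS]gradE ![in RHS]gradE.
by rewrite derive_opp//; exact: C1_derivable.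
Qed.

Lemma hess_add {k : nat} (f g : 'rV[R]_k -> R) x : C2 f -> C2 g ->
  hess (fun y => f y + g y) x = hess f x + hess g x.
Proof.
move=> [Cf Cf'] [Cg Cg']; apply/matrixP => i j; rewrite [RHS]mxE.
apply: (etrans (hessE _ x i j)).
apply: esym; apply: (etrans (congr2 +%R (hessE f x i j) (hessE g x i j))); apply: esym.
exact: (etrans (congr1 (fun F => 'D_(delta_mx 0 j) F x) (derive_addE _ Cf Cg))
  (derive_add (C1_derivable (Cf' _)) (C1_derivable (Cg' _)))).
Qed.

Lemma hess_opp {k : nat} (f : 'rV[R]_k -> R) x : C2 f -> hess (fun y => - f y) x = - hess f x.
Proof.
move=> [Cf Cf']; apply/matrixP => i j; rewrite [RHS]mxE.
apply: (etrans (hessE _ x i j)).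
apply: esym; apply: (etrans (congr1 -%R (hessE f x i j))); apply: esym.
exact: (etrans (congr1 (fun F => 'D_(delta_mx 0 j) F x) (derive_oppE _ Cf))
  (derive_opp (C1_derivable (Cf' _)))).
Qed.

(** This identity reduces the matrix inequality at an interior extremum to one
    real variable. *)
Lemma hess_quadratic {k : nat} (f : 'rV[R]_k -> R) x v : C2 f ->
  (v *m hess f x *m v^T) 0 0 = 'D_v (fun y => 'D_v f y) x.
Proof.
move=> [Cf Cf'].
rewrite derive_dot_grad; last by apply: C1_differentiable; exact: Cf'.
rewrite mxE [RHS]/dot; apply: eq_bigr => j _; rewrite mulrC [in RHS]mxE.
rewrite [v^T _ _]mxE; congr (_ * _); rewrite mxE.
have -> : (fun y => 'D_v f y) = (fun y => \sum_(i < k) v 0 i * 'D_(delta_mx 0 i) f y).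
  apply/funext => y; rewrite derive_dot_grad; last exact: C1_differentiable.
  by apply: eq_bigr => i _; rewrite gradE.
rewrite derive_lincomb => [|i]; last exact: C1_derivable (Cf' _).
by apply: eq_bigr => i _; rewrite hessE.
Qed.

(** Continuity lets the values at the approaching points, where the two functions
    agree, pass to the limit at [x]. *)
Lemma eq_of_approach {V : normedModType R} (G1 G2 : V -> R) x u v :
  continuous G1 -> continuous G2 ->
  (forall h : R, 0 < h -> exists s t s' t', [/\ [/\ 0 < s < h, 0 < t < h, 0 < s' < h & 0 < t' < h]
     & G1 (x + s *: u + t *: v) = G2 (x + s' *: v + t' *: u)]) ->
  G1 x = G2 x.
Proof.
move=> c1 c2 meet.
apply/eqP; rewrite -subr_eq0 -normr_le0; apply/ler_addgt0Pl => e e0; rewrite addr0.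
have e20 : 0 < e / 2 by rewrite divr_gt0.
have near_pt (G : V -> R) (a b : V) : continuous G ->
    exists2 d : R, 0 < d & forall s t, 0 < s < d -> 0 < t < d ->
    `|G x - G (x + s *: a + t *: b)| < e / 2.
  move=> cG; have /cvgrPdist_lt/(_ _ e20)/nbhs_ballP[d /= d0 Hd] := cG x.
  exists (d / (`|a| + `|b| + 1)) => [|s t /andP[s0 sd] /andP[t0 td]].
    by rewrite divr_gt0// ltr_wpDl.
  apply: Hd; rewrite -ball_normE /= -addrA opprD addNKr normrN.
  have n1 : 0 < `|a| + `|b| + 1 by rewrite ltr_wpDl.
  apply: (le_lt_trans (ler_normD _ _)); rewrite !normrZ !gtr0_norm//.
  move: sd td; rewrite !ltr_pdivlMr// => sd td.
  have : s * `|a| + t * `|b| <= Num.max s t * (`|a| + `|b|).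
    by rewrite mulrDr lerD// ler_wpM2r// le_max lexx ?orbT.
  move=> /le_lt_trans; apply; rewrite /Num.max; case: ifP => _.
    by apply: lt_trans td; rewrite ltr_pM2l// ltrDl.
  by apply: lt_trans sd; rewrite ltr_pM2l// ltrDl.
have [d1 d10 H1] := near_pt G1 u v c1; have [d2 d20 H2] := near_pt G2 v u c2.
have h0 : 0 < Num.min d1 d2 by rewrite lt_min d10.
have [s [t [s' [t' [[/andP[s0 sh] /andP[t0 th] /andP[s'0 s'h] /andP[t'0 t'h]] E]]]]] := meet _ h0.
move: sh th s'h t'h; rewrite !lt_min => /andP[sh _] /andP[th _] /andP[_ s'h] /andP[_ t'h].
have := H1 s t; rewrite s0 t0 sh th => /(_ isT isT) L1.
have := H2 s' t'; rewrite s'0 t'0 s'h t'h -E => /(_ isT isT) L2.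
rewrite distrC in L2; rewrite (splitr e) ltW//.
exact: (le_lt_trans (ler_distD _ _ _) (ltrD L1 L2)).
Qed.

(** Schwarz's theorem: the second difference of f over a small parallelogram,
    expanded in either order by the mean value theorem, is the side squared times
    either mixed derivative at a nearby point. *)
Lemma derive_comm {V : normedModType R} (f : V -> R) x u v : C2 f ->
  'D_v (fun y => 'D_u f y) x = 'D_u (fun y => 'D_v f y) x.
Proof.
move=> [Cf Cf'].
have key (a b : V) (h : R) : 0 < h -> exists s t : R, [/\ 0 < s < h, 0 < t < h &
    f (x + h *: a + h *: b) - f (x + h *: a) - f (x + h *: b) + f x
    = 'D_b (fun y => 'D_a f y) (x + s *: a + t *: b) * h * h].
  move=> h0.
  have [s s01] := @MVT_pos (fun s => f ((x + h *: b) + s *: a) - f (x + s *: a))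
     (fun s => 'D_a f ((x + h *: b) + s *: a) - 'D_a f (x + s *: a)) h h0
     (fun s => is_deriveB (derivable_line (C1_derivable Cf))
                           (derivable_line (C1_derivable Cf))).
  rewrite scale0r !addr0 => E1.
  have [t t01] := @MVT_pos (fun t => 'D_a f (x + s *: a + t *: b)) _ h h0
     (fun t => derivable_line (C1_derivable (Cf' a))).
  rewrite scale0r addr0 => E2.
  exists s, t; split => //.
  rewrite -E2 (addrAC x (s *: a)) -E1 opprB addrA [in RHS]addrAC.
  by rewrite (addrAC x (h *: b)); ring.
have cD (a b : V) : continuous (fun y => 'D_b (fun w => 'D_a f w) y).
  by have [_] := Cf' a; apply.
apply: (@eq_of_approach _ (fun y => 'D_v (fun w => 'D_u f w) y)
  (fun y => 'D_u (fun w => 'D_v f w) y) x u v) => // h h0.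
have [s [t [s01 t01 E1]]] := key u v h h0.
have [s' [t' [s'01 t'01 E2]]] := key v u h h0.
exists s, t, s', t'; split; first by split.
have EX : f (x + h *: u + h *: v) - f (x + h *: u) - f (x + h *: v) + f x
        = f (x + h *: v + h *: u) - f (x + h *: v) - f (x + h *: u) + f x.
  by rewrite (addrAC x (h *: v)); congr (_ + _); exact: addrAC.
rewrite EX in E1; have hh : h != 0 by rewrite gt_eqF.
by apply: (mulIf hh); apply: (mulIf hh); exact: etrans (esym E1) E2.
Qed.

Lemma hess_symmetric {k : nat} (f : 'rV[R]_k -> R) x : C2 f -> symmetric_mx (hess f x).
Proof. by move=> Cf; apply/matrixP => i j; rewrite !mxE; exact: derive_comm. Qed.

Lemma grad_cont {k : nat} (f : 'rV[R]_k -> R) : C1 f -> continuous (grad f).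
Proof.
move=> [_ cf] x; apply: (@cvg_rV _ _ _ (nbhs x) _ (grad f) (grad f x)) => i.
by rewrite gradE; under eq_fun do rewrite gradE; exact: cf.
Qed.

End Calculus.

Arguments C1_cvg {R V W f} Cf x.

Section Calculus2.
Context {R : realType}.

Lemma hess_cont {k : nat} (f : 'rV[R]_k -> R) : C2 f -> continuous (hess f).
Proof.
move=> [_ Cf] x; apply: (@cvg_mx _ _ _ _ (nbhs x) _ (hess f) (hess f x)) => i j.
have [_ /(_ (delta_mx 0 j) x)] := Cf (delta_mx 0 i).
have E y : hess f y i j = 'D_(delta_mx 0 j) (fun w => 'D_(delta_mx 0 i) f w) y.
  exact: hessE.
by rewrite (funext E) E.
Qed.

Lemma C2_sub {V W : normedModType R} (f g : V -> W) :
  C2 f -> C2 g -> C2 (fun y => f y - g y).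
Proof. by move=> Cf Cg; exact: (C2_add Cf (C2_opp Cg)). Qed.

Lemma grad_sub {k : nat} (f g : 'rV[R]_k -> R) x : C1 f -> C1 g ->
  grad (fun y => f y - g y) x = grad f x - grad g x.
Proof.
move=> Cf Cg; apply: (etrans (grad_add x Cf (C1_opp Cg))).
exact: (congr1 (fun w => grad f x + w) (grad_opp x Cg)).
Qed.

Lemma hess_sub {k : nat} (f g : 'rV[R]_k -> R) x : C2 f -> C2 g ->
  hess (fun y => f y - g y) x = hess f x - hess g x.
Proof.
move=> Cf Cg; apply: (etrans (hess_add x Cf (C2_opp Cg))).
exact: (congr1 (fun w => hess f x + w) (hess_opp x Cg)).
Qed.

(** ** Extrema along directions *)
Lemma derive_lt0_decr {V : normedModType R} (f : V -> R) z d : derivable f z d ->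
  'D_d f z < 0 -> \forall t \near (0 : R)^'+, f (z + t *: d) < f z.
Proof.
move=> df D0; have /cvg_dnbhs_at_right/cvgr_lt/(_ 0 D0) := df.
apply: filterS2 (nbhs_right_gt (0 : R)) => t t0 /=.
by rewrite [_ *: _]mulrC pmulr_llt0 ?invr_gt0// subr_lt0 addrC.
Qed.

Lemma derive_ge0_of_min {V : normedModType R} (f : V -> R) z d : derivable f z d ->
  (\forall t \near (0 : R)^'+, f z <= f (z + t *: d)) -> 0 <= 'D_d f z.
Proof.
move=> df fm; rewrite leNgt; apply/negP => /(derive_lt0_decr df) fd.
have [t /= []] := filter_ex (filterI fm fd).
by move=> /le_lt_trans/[apply]; rewrite ltxx.
Qed.

(** The first derivative vanishes at the minimum; were the second one negative, the
    first would be negative just after it and the function would decrease there. *)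
Lemma derive2_ge0_of_min {V : normedModType R} (f : V -> R) z d : C2 f ->
  (\forall t \near (0 : R), f z <= f (z + t *: d)) ->
  0 <= 'D_d (fun y => 'D_d f y) z.
Proof.
move=> [Cf Cf'] fm.
have D_ge0 : 0 <= 'D_d f z.
  apply: derive_ge0_of_min; first exact: C1_derivable.
  by apply: cvg_within.
have D_le0 : 'D_d f z <= 0.
  rewrite -oppr_ge0 deriveE; last exact: C1_differentiable.
  rewrite -linearN -deriveE; last exact: C1_differentiable.
  apply: derive_ge0_of_min; first exact: C1_derivable.
  have : \forall t \near (0 : R), f z <= f (z + (- t) *: d).
    have : (- t) @[t --> (0 : R)] --> (0 : R).
      by rewrite -[X in _ --> X]oppr0; apply: cvgN; exact: cvg_id.
    by move=> /(_ _ fm).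
  move=> fm'; apply: cvg_within; apply: filterS fm' => t.
  by rewrite scalerN -scaleNr.
have D0 : 'D_d f z = 0 by apply/eqP; rewrite eq_le D_le0.
rewrite leNgt; apply/negP => /(derive_lt0_decr (C1_derivable (Cf' d))) fd.
have /nbhs_ballP[e1 /= e10 H1] := fm.
have [e2 /= e20 H2] := fd.
pose h := Num.min e1 e2 / 2.
have h0 : 0 < h by rewrite divr_gt0// lt_min e10.
have [s /andP[s0 sh]] := @MVT_pos R (fun t => f (z + t *: d)) _ h h0
     (fun t => derivable_line (C1_derivable Cf)).
rewrite scale0r addr0 => E.
have : f z <= f (z + h *: d).
  apply: H1; rewrite -ball_normE /= sub0r normrN gtr0_norm//.
  by rewrite /h ltr_pdivrMr// gt_min ltr_pMr// ltr1n.
rewrite -subr_ge0 E; apply/negP; rewrite -ltNge pmulr_llt0//.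
rewrite -D0; apply: H2 => //=; rewrite sub0r normrN gtr0_norm// (lt_trans sh)//.
by rewrite /h ltr_pdivrMr// gt_min [X in _ || X]ltr_pMr// ltr1n orbT.
Qed.

(** ** Separable polynomials *)

(** Sums of polynomials in the single coordinates have explicit gradients and
    diagonal Hessians, and they contain all the test functions needed below. *)
Definition sep_poly {k : nat} (p : 'I_k -> {poly R}) (z : 'rV[R]_k) : R :=
  \sum_(i < k) (p i).[z 0 i].

Lemma sep_poly_diff {k : nat} (p : 'I_k -> {poly R}) z : differentiable (sep_poly p) z.
Proof.
have H i : differentiable (fun z : 'rV[R]_k => (p i).[z 0 i]) z.
  apply: (@differentiable_comp _ _ _ _ (fun z : 'rV_k => z 0 i) (horner (p i))).
    exact: differentiable_coord.
  by apply/derivable1_diffP; exact: derivable_horner.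
by have := differentiable_sum H; rewrite fct_sumE.
Qed.

Lemma derive_coord {V : normedModType R} {k : nat} (f : V -> 'rV[R]_k) x v i :
  derivable f x v -> 'D_v (fun z => f z 0 i) x = 'D_v f x 0 i.
Proof. by move=> /derive_mx ->; rewrite mxE. Qed.

Lemma derive_sep_poly {k : nat} (p : 'I_k -> {poly R}) z v :
  'D_v (sep_poly p) z = sep_poly (fun i => v 0 i *: (p i)^`()) z.
Proof.
have H i : is_derive z v (fun z => (p i).[z 0 i]) (v 0 i * (p i)^`().[z 0 i]).
  have dc : differentiable (fun z : 'rV[R]_k => z 0 i) z by exact: differentiable_coord.
  have dp : differentiable (horner (p i)) (z 0 i).
    by apply/derivable1_diffP; exact: derivable_horner.
  have dpc : differentiable (horner (p i) \o (fun z : 'rV[R]_k => z 0 i)) z.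
    exact: differentiable_comp.
  split; first exact: diff_derivable.
  rewrite deriveE// diff_comp//= diff1E// -derivE.
  rewrite -deriveE// (@derive_coord _ _ id z v i) ?derive_id//.
have := is_derive_sum H; rewrite fct_sumE => H'.
by rewrite (@derive_val _ _ _ _ _ _ _ H') /sep_poly; apply: eq_bigr => i _; rewrite hornerZ.
Qed.

Lemma C1_sep_poly {k : nat} (p : 'I_k -> {poly R}) : C1 (sep_poly p).
Proof.
split=> [|v]; first exact: sep_poly_diff.
rewrite (_ : (fun x => _) = sep_poly (fun i => v 0 i *: (p i)^`())).
  by move=> x; apply: differentiable_continuous; exact: sep_poly_diff.
by apply/funext => x; rewrite derive_sep_poly.
Qed.

Lemma C2_sep_poly {k : nat} (p : 'I_k -> {poly R}) : C2 (sep_poly p).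
Proof.
split=> [|v]; first exact: C1_sep_poly.
rewrite (_ : (fun x => _) = sep_poly (fun i => v 0 i *: (p i)^`())); first exact: C1_sep_poly.
by apply/funext => x; rewrite derive_sep_poly.
Qed.

Lemma grad_sep_poly {k : nat} (p : 'I_k -> {poly R}) z :
  grad (sep_poly p) z = \row_i (p i)^`().[z 0 i].
Proof.
apply/rowP => i; rewrite !mxE derive_sep_poly /sep_poly -[RHS]mul1r.
rewrite (bigD1 i)//= big1 => [|j ji].
  by rewrite hornerZ mxE !eqxx addr0.
by rewrite hornerZ mxE eqxx (negbTE ji) mul0r.
Qed.

Lemma hess_sep_poly {k : nat} (p : 'I_k -> {poly R}) z :
  hess (sep_poly p) z = diag_mx (\row_i (p i)^`()^`().[z 0 i]).
Proof.
apply/matrixP => i j; rewrite !mxE.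
rewrite (_ : (fun w => _) = sep_poly (fun l => (delta_mx 0 i : 'rV[R]_k) 0 l *: (p l)^`())).
  rewrite derive_sep_poly /sep_poly (bigD1 j)//= big1 => [|l lj].
    rewrite !mxE !eqxx addr0 derivZ !hornerZ/= mul1r eq_sym.
    by case: eqVneq => [->|_]; rewrite ?mulr1n ?mul1r// mulr0n mul0r.
  by rewrite hornerZ mxE eqxx (negbTE lj) mul0r.
by apply/funext => w; rewrite derive_sep_poly.
Qed.

(** ** Bounds on compact sets *)

Lemma compact_norm_bounded {T : topologicalType} {V : normedModType R}
    (K : set T) (f : T -> V) : compact K -> {within K, continuous f} ->
  exists2 M : R, 0 < M & forall x, K x -> `|f x| <= M.
Proof.
move=> cK cf; have /compact_bounded[M [Mr HM]] := continuous_compact cf cK.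
exists (`|M| + 1) => [|x Kx]; first by rewrite ltr_wpDl.
apply: (HM (`|M| + 1)); last by exists x.
by rewrite (le_lt_trans (ler_norm M))// ltrDl.
Qed.

Lemma compact_rV_ball {k : nat} (M : R) : compact [set x : 'rV[R]_k | `|x| <= M].
Proof.
apply: bounded_closed_compact.
  exists M; split; first exact: num_real.
  by move=> y My x /= /le_trans; apply; exact: ltW.
have -> : [set x : 'rV[R]_k | `|x| <= M] = (fun x => `|x|) @^-1` [set y | y <= M] by [].
by apply: closed_comp => [x _|]; [exact: norm_continuous|exact: closed_le].
Qed.

(** [C1] functions are Lipschitz on balls: the mean value theorem along the
    segment, which stays in the ball. *)
Lemma C1_lipschitz {k : nat} (f : 'rV[R]_k -> R) (M : R) : C1 f ->
  exists2 L : R, 0 < L &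
    forall x y, `|x| <= M -> `|y| <= M -> `|f x - f y| <= L * `|x - y|.
Proof.
move=> Cf.
have [B B0 HB] := compact_norm_bounded (@compact_rV_ball k M)
  (continuous_subspaceT (grad_cont Cf)).
exists (k%:R * B + 1) => [|x y xM yM]; first by rewrite ltr_wpDl// mulr_ge0// ltW.
have [t /andP[t0 t1]] := MVT_line y (x - y) Cf.
rewrite (addrC y (x - y)) subrK => ->; rewrite derive_dot_grad; last exact: C1_differentiable.
apply: (le_trans (dot_norm_le _ _)).
rewrite mulrDl mul1r -mulrA [_ * `|grad _ _|]mulrC mulrA.
rewrite ler_wpDr// ler_wpM2r// ler_wpM2l// HB//=.
have -> : y + t *: (x - y) = (1 - t) *: y + t *: x.
  by rewrite scalerBr scalerBl scale1r addrA addrAC.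
apply: (le_trans (ler_normD _ _)); rewrite !normrZ !ger0_norm ?subr_ge0 ?(ltW t0) ?(ltW t1)//.
by nra.
Qed.

Lemma C1_coord {k l : nat} (f : 'rV[R]_k -> 'rV[R]_l) i : C1 f -> C1 (fun x => f x 0 i).
Proof.
move=> Cf.
have dc x : differentiable (fun z : 'rV[R]_l => z 0 i) (f x) by exact: differentiable_coord.
split=> [x|v].
  by apply: (@differentiable_comp _ _ _ _ f (fun z : 'rV_l => z 0 i)) => //;
    exact: C1_differentiable.
rewrite (_ : (fun x => _) = (fun x => ('D_v f x) 0 i)).
  by move=> x; exact: (cvg_comp _ _ (proj2 Cf v x) (@coord_continuous R 1 l 0 i _)).
by apply/funext => x; rewrite derive_coord//; exact: C1_derivable.
Qed.

End Calculus2.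

(** * Semicontinuous envelopes *)

Section Envelope.
Context {R : realType} {k : nat} (K : set 'rV[R]_k).
Implicit Types (u v h : 'rV[R]_k -> R) (z : 'rV[R]_k).

Definition bdd_on u := exists B : R, forall z, K z -> `|u z| <= B.

Lemma bdd_onP u : [bounded u z | z in K] <-> bdd_on u.
Proof.
split=> [[M [Mr HM]]|[B HB]].
  by exists (M + 1) => z Kz; apply: (HM (M + 1)) => //; rewrite ltrDl.
exists B; split; first exact: num_real.
by move=> M BM z /HB /le_trans; apply; exact: ltW.
Qed.

Lemma usc_envE u z : bdd_on u -> K z ->
  limf_esup (fun w => (u w)%:E) (within K (nbhs z)) = (usc_env K u z)%:E.
Proof.
move=> [B HB] Kz; rewrite /usc_env fineK// fin_numElt; apply/andP; split.
  apply: (@lt_le_trans _ _ (u z)%:E); first exact: ltNyr.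
  apply: le_ereal_inf_tmp => _ [V VF <-]; apply: ereal_sup_ubound; exists z => //.
  by apply: (nbhs_singleton VF).
apply: (@le_lt_trans _ _ B%:E); last exact: ltry.
apply: (@le_trans _ _ (ereal_sup ((fun w => (u w)%:E) @` K))).
  by apply: ereal_inf_lbound; exists K => //; exact: withinT.
apply: ge_ereal_sup => _ [w Kw <-]; rewrite lee_fin.
by rewrite (le_trans (ler_norm _))// HB.
Qed.

Lemma usc_env_ge u z : bdd_on u -> K z -> u z <= usc_env K u z.
Proof.
move=> bu Kz; rewrite -lee_fin -usc_envE//.
apply: le_ereal_inf_tmp => _ [V VF <-]; apply: ereal_sup_ubound; exists z => //.
by apply: (nbhs_singleton VF).
Qed.

Lemma usc_env_lt_near u z c : bdd_on u -> K z -> usc_env K u z < c ->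
  \forall w \near z, K w -> u w < c.
Proof.
move=> bu Kz uc; have : ((usc_env K u z)%:E < c%:E)%E by rewrite lte_fin.
rewrite -usc_envE// => /ereal_inf_lt[_ [V VF <-] Vc].
have VF' : \forall w \near z, K w -> V w := VF.
apply: filterS VF' => w VKw /VKw Vw.
have : ((u w)%:E <= ereal_sup ((fun w => (u w)%:E) @` V))%E.
  by apply: ereal_sup_ubound; exists w.
by move=> /le_lt_trans/(_ Vc); rewrite lte_fin.
Qed.

Lemma usc_env_gt_ex u z c (U : set 'rV[R]_k) : bdd_on u -> K z -> c < usc_env K u z ->
  nbhs z U -> exists w, [/\ K w, U w & c < u w].
Proof.
move=> bu Kz + zU; rewrite -lte_fin -usc_envE// => cu.
have : (c%:E < ereal_sup ((fun w => (u w)%:E) @` (U `&` K)))%E.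
  apply: (lt_le_trans cu); apply: ereal_inf_lbound; exists (U `&` K) => //.
  by apply: filterS zU => w Uw Kw; split.
by move=> /ereal_sup_gt[_ [w [Uw Kw] <-]]; rewrite lte_fin => cw; exists w.
Qed.

Lemma usc_env_le_near u z c : bdd_on u -> K z ->
  (\forall w \near z, K w -> u w <= c) -> usc_env K u z <= c.
Proof.
move=> bu Kz uc; rewrite leNgt; apply/negP => /(usc_env_gt_ex bu Kz)/(_ uc).
by move=> [w [Kw /(_ Kw) wc]]; rewrite ltNge wc.
Qed.

Lemma usc_env_bound u B z : (forall w, K w -> `|u w| <= B) -> K z ->
  `|usc_env K u z| <= B.
Proof.
move=> HB Kz; have bu : bdd_on u by exists B.
rewrite ler_norml; apply/andP; split.
  apply: (le_trans _ (usc_env_ge bu Kz)).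
  by have := HB _ Kz; rewrite ler_norml => /andP[].
apply: usc_env_le_near => //.
apply: (filterS _ (@filterT _ (nbhs z) _)) => w _ /HB.
by apply: le_trans; exact: ler_norm.
Qed.

(** A bound on [u] in a neighbourhood is a bound on its envelope in the interior of
    that neighbourhood. *)
Lemma usc_env_usc u z c : bdd_on u -> K z -> usc_env K u z < c ->
  \forall w \near z, K w -> usc_env K u w < c.
Proof.
move=> bu Kz uc.
have /(usc_env_lt_near bu Kz) : usc_env K u z < (usc_env K u z + c) / 2 by lra.
move=> /nbhs_interior; apply: filterS => w Hw Kw.
apply: (@le_lt_trans _ _ ((usc_env K u z + c) / 2)); last by lra.
apply: usc_env_le_near => //; apply: filterS Hw => y /[apply]; exact: ltW.
Qed.

Lemma usc_env_mono u v z : bdd_on u -> bdd_on v -> K z ->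
  (forall w, K w -> u w <= v w) -> usc_env K u z <= usc_env K v z.
Proof.
move=> bu bv Kz uv; apply/ler_addgt0Pl => e e0.
have /(usc_env_lt_near bv Kz) : usc_env K v z < e + usc_env K v z by rewrite ltrDr.
move=> ve; apply: usc_env_le_near => //; apply: filterS ve => w /[swap] Kw /(_ Kw) H.
by rewrite ltW// (le_lt_trans (uv _ Kw)).
Qed.

Lemma usc_env_max_cont u h z : bdd_on u -> bdd_on (fun w => Num.max (u w) (h w)) ->
  continuous h -> K z ->
  usc_env K (fun w => Num.max (u w) (h w)) z = Num.max (usc_env K u z) (h z).
Proof.
move=> bu bm ch Kz; apply/eqP; rewrite eq_le; apply/andP; split; last first.
  rewrite ge_max; apply/andP; split.
    by apply: usc_env_mono => // w Kw; rewrite le_max lexx.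
  by apply: le_trans (usc_env_ge bm Kz); rewrite le_max lexx orbT.
apply/ler_addgt0Pl => e e0.
have /(usc_env_lt_near bu Kz) Hu : usc_env K u z < e + Num.max (usc_env K u z) (h z).
  by rewrite ltr_pwDl// le_max lexx.
have Hh : \forall w \near z, h w < e + Num.max (usc_env K u z) (h z).
  by apply: (cvgr_lt _ (ch z)); rewrite ltr_pwDl// le_max lexx orbT.
apply: usc_env_le_near => //; apply: filterS2 Hu Hh => w Hu Hh Kw.
by rewrite ge_max !ltW// Hu.
Qed.

Lemma usc_env_cont h z : bdd_on h -> continuous h -> K z -> usc_env K h z = h z.
Proof.
move=> bh ch Kz; apply/eqP; rewrite eq_le usc_env_ge// andbT.
apply/ler_addgt0Pl => e e0; apply: usc_env_le_near => //.
have : \forall w \near z, h w < e + h z by apply: (cvgr_lt _ (ch z)); rewrite ltrDr.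
by apply: filterS => w /ltW.
Qed.

Lemma lsc_envE u z : lsc_env K u z = - usc_env K (fun w => - u w) z.
Proof.
rewrite /lsc_env /usc_env /limf_einf fineN; congr (- fine (limf_esup _ _)).
Qed.

Lemma bdd_onN u : bdd_on u -> bdd_on (fun w => - u w).
Proof. by move=> [B HB]; exists B => z /HB; rewrite normrN. Qed.

End Envelope.

(** * Compactness *)

Section Compactness.
Context {R : realType}.

(** An upper semicontinuous function attains its supremum: otherwise every
    point has a neighbourhood on which the function stays below the supremum by
    a fixed margin, and compactness makes the margin uniform. *)
Lemma usc_max {T : topologicalType} (K : set T) (f : T -> R) (B : R) :
  compact K -> K !=set0 -> (forall z, K z -> f z <= B) ->
  (forall z c, K z -> f z < c -> \forall w \near z, K w -> f w < c) ->
  exists2 z, K z & forall w, K w -> f w <= f z.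
Proof.
move=> cK [z0 Kz0] fB fusc; apply: contrapT => nmax.
have {}nmax z : K z -> exists2 w, K w & f z < f w.
  move=> Kz; apply: contrapT => H; apply: nmax; exists z => // w Kw.
  by rewrite leNgt; apply/negP => fzw; apply: H; exists w.
pose s := sup (f @` K).
have hs : has_sup (f @` K).
  by split; [exists (f z0); exists z0|exists B => _ [w Kw <-]; exact: fB].
have fs z : K z -> f z < s.
  move=> /nmax[w Kw fzw]; apply: (lt_le_trans fzw).
  by apply: sup_upper_bound => //; exists w.
have sadh e : 0 < e -> exists2 x, (f @` K) x & s - e < x := fun e0 => sup_adherent e0 hs.
clearbody s.
have /compact_near_coveringP/near_covering_withinP cov := cK.
have H : \forall e \near (0 : R)^'+, forall z, K z -> f z < s - e.
  apply: cov => z Kz; have lt_z := fs _ Kz.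
  have H1 : \forall w \near z, K w -> f w < (f z + s) / 2 by apply: fusc => //; lra.
  have H2 : \forall e \near (0 : R)^'+, e < (s - f z) / 2 by apply: nbhs_right_lt; lra.
  near=> w e => Kw.
  have Hw : f w < (f z + s) / 2 by apply: (near H1 w).
  have He : e < (s - f z) / 2 by apply: (near H2 e).
  by rewrite /=; lra.
have [e /= [e0 He]] := filter_ex (filterI (nbhs_right_gt (0 : R)) H).
have [_ [w Kw <-]] := sadh _ e0.
by rewrite ltNge => /negP; apply; rewrite ltW// He.
Unshelve. all: by end_near. Qed.

Lemma compact_net {k : nat} (K : set 'rV[R]_k) (e : R) : compact K -> 0 < e ->
  exists s : seq 'rV[R]_k, {in s, forall x, K x} /\
    forall x, K x -> exists2 y, y \in s & `|x - y| < e.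
Proof.
move=> cK e0; move: cK; rewrite compact_cover.
move=> /(_ _ K (fun x => ball x e)) [x Kx|x Kx|D' D'K cov].
- exact: ball_open.
- by exists x => //; exact: ballxx.
exists (finmap.enum_fset D'); split => [x xD|x /cov[y yD]].
  by have := D'K _ xD; rewrite inE.
by rewrite -ball_normE /= distrC => xy; exists y.
Qed.

(** The minimum is carried together with the member that realises it at each
    point, since that member is the test function there. *)
Lemma min_family {I : eqType} {T : topologicalType} (s : seq I) (Phi : I -> T -> R) :
  s != [::] -> (forall i, continuous (Phi i)) ->
  exists W : T -> R, [/\ continuous W, forall i z, i \in s -> W z <= Phi i z &
    forall z, exists2 i, i \in s & W z = Phi i z].
Proof.
move=> + cPhi; elim: s => // i0 s IH _.
have [->|s0] := eqVneq s [::].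
  exists (Phi i0); split => // [i z|z]; first by rewrite inE => /eqP->.
  by exists i0; rewrite ?inE.
have [W [cW leW exW]] := IH s0.
exists (fun z => Num.min (Phi i0 z) (W z)); split.
- by move=> z; apply: continuous_min; [exact: cPhi|exact: cW].
- move=> i z; rewrite inE => /orP[/eqP->|is_]; first by rewrite ge_min lexx.
  by rewrite ge_min leW ?orbT.
move=> z; have [i is_ Wi] := exW z.
by case: (leP (Phi i0 z) (W z)) => H; [exists i0|exists i]; rewrite // inE ?eqxx ?is_ ?orbT.
Qed.

End Compactness.

(** * Horizontal and vertical coordinates *)

Section Coordinates.
Context {R : realType} {N : nat}.
Implicit Types (z w : 'rV[R]_(N + 1)).

Lemma xpartE z i : xpart z 0 i = z 0 (lshift 1 i).
Proof. by rewrite mxE. Qed.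

Lemma ypartE z : ypart z = z 0 (rshift N 0).
Proof. by rewrite /ypart mxE. Qed.

Lemma xpart_cont : continuous (@xpart R N).
Proof. exact: continuous_lsubmx. Qed.

Lemma ypart_cont : continuous (@ypart R N).
Proof.
rewrite (_ : @ypart R N = fun z => z 0 (rshift N 0)); last by apply/funext => z; exact: ypartE.
exact: coord_continuous.
Qed.

Lemma xy_cont : continuous (@xy R N).
Proof. by move=> z; exact: (cvg_pair (@xpart_cont z) (@ypart_cont z)). Qed.

Lemma cvg_scale {T : Type} {F : set_system T} {FF : Filter F} (a : R) (f : T -> R) (l : R) :
  f @ F --> l -> (fun t => a * f t) @ F --> a * l.
Proof. by move=> fl; apply: cvgM => //; exact: cvg_cst. Qed.

Arguments cvg_scale {T F FF} a {f l} _.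

Lemma cvg_graph (eps : R) (g : 'rV[R]_N -> R) (w : 'rV[R]_(N + 1)) : C1 g ->
  eps * g (xpart z) @[z --> w] --> eps * g (xpart w).
Proof.
move=> Cg; have H1 : xpart z @[z --> w] --> xpart w by exact: xpart_cont.
have H2 : g x @[x --> xpart w] --> g (xpart w) by exact: C1_continuous.
have H3 : g (xpart z) @[z --> w] --> g (xpart w) by exact: (cvg_comp _ _ H1 H2).
exact: (cvg_scale eps H3).
Qed.
Arguments cvg_graph eps {g} w _.

Lemma xpartD z w : xpart (z + w) = xpart z + xpart w.
Proof. by apply/rowP => i; rewrite !mxE. Qed.

Lemma xpartZ a z : xpart (a *: z) = a *: xpart z.
Proof. by apply/rowP => i; rewrite !mxE. Qed.

Lemma ypartD z w : ypart (z + w) = ypart z + ypart w.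
Proof. by rewrite !ypartE mxE. Qed.

Lemma ypartZ a z : ypart (a *: z) = a * ypart z.
Proof. by rewrite !ypartE mxE. Qed.

Lemma xpartN z : xpart (- z) = - xpart z.
Proof. by apply/rowP => i; rewrite !mxE. Qed.

Lemma ypartN z : ypart (- z) = - ypart z.
Proof. by rewrite !ypartE mxE. Qed.

Lemma xpart_mkvec (a : 'rV[R]_N) b : xpart (mkvec a b) = a.
Proof. exact: row_mxKl. Qed.

Lemma ypart_mkvec (a : 'rV[R]_N) b : ypart (mkvec a b) = b.
Proof. by rewrite /ypart row_mxKr mxE eqxx mulr1n. Qed.

Lemma dot_split z w : dot z w = dot (xpart z) (xpart w) + ypart z * ypart w.
Proof.
rewrite /dot big_split_ord /= big_ord1 !ypartE; congr (_ + _).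
by apply: eq_bigr => i _; rewrite !mxE.
Qed.

End Coordinates.

Arguments cvg_scale {R T F FF} a {f l} _.
Arguments cvg_graph {R N} eps {g} w _.

Section Slab.
Context {R : realType} {N : nat}.

Lemma slab_closure (Om : set 'rV[R]_N) (gm gp : 'rV[R]_N -> R) (eps : R) z :
  C1 gm -> C1 gp -> closure (Omega_eps Om gm gp eps) z ->
  closure Om (xpart z) /\ eps * gm (xpart z) <= ypart z <= eps * gp (xpart z).
Proof.
move=> Cgm Cgp cz; split.
  move=> V xV; have : \forall w \near z, V (xpart w) by exact: (@xpart_cont R N z).
  by move=> /cz[w [[Ow _] Vw]]; exists (xpart w).
have clo : closed [set w | eps * gm (xpart w) <= ypart w <= eps * gp (xpart w)].
  rewrite (_ : mkset _ = (fun w => ypart w - eps * gm (xpart w)) @^-1` [set x | 0 <= x] `&`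
     (fun w => eps * gp (xpart w) - ypart w) @^-1` [set x | 0 <= x]).
    apply: closedI; (apply: closed_comp; last exact: closed_ge) => w _.
      exact: (cvgB (@ypart_cont R N w) (cvg_graph eps w Cgm)).
    exact: (cvgB (cvg_graph eps w Cgp) (@ypart_cont R N w)).
  by apply/seteqP; split => w /=; rewrite !subr_ge0 => /andP.
suff : closure (Omega_eps Om gm gp eps) `<=`
    [set w | eps * gm (xpart w) <= ypart w <= eps * gp (xpart w)].
  exact.
rewrite [X in _ `<=` X](closure_id _).1//; apply: closure_subset.
by move=> w [_ /andP[/ltW a /ltW b]] /=; rewrite a b.
Qed.

Lemma norm_split (p : 'rV[R]_(N + 1)) : `|p| <= `|xpart p| + `|ypart p|.
Proof.
apply: rV_norm_le => [|i]; first exact: addr_ge0.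
case: (split_ordP i) => k ->.
  by rewrite -xpartE (le_trans (normr_coord _ _))// lerDl.
by rewrite (ord1 k) -ypartE lerDr.
Qed.

End Slab.

(** * The domain and its boundary *)

Section Domain.
Context {R : realType} {N : nat} (Om : set 'rV[R]_N).
Hypothesis oOm : open Om.
Hypothesis bOm : bounded_set Om.

Lemma closure_bounded : exists M : R, forall x, closure Om x -> `|x| <= M.
Proof.
have [M [_ HM]] := bOm; exists (M + 1).
suff : closure Om `<=` [set x | `|x| <= M + 1] by [].
rewrite [X in _ `<=` X](closure_id _).1.
  by apply: closure_subset => x Ox /=; apply: HM => //; rewrite ltrDl.
rewrite (_ : mkset _ = (fun x => `|x|) @^-1` [set y | y <= M + 1])//.
by apply: closed_comp => [x _|]; [exact: norm_continuous|exact: closed_le].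
Qed.

Lemma closure_compact : compact (closure Om).
Proof.
have [M HM] := closure_bounded.
exact: (subclosed_compact (@closed_closure _ Om) (@compact_rV_ball _ N M) HM).
Qed.

Lemma bdry_closed : closed (bdry Om).
Proof.
by rewrite /bdry setDE; apply: closedI; [exact: closed_closure|exact/open_closedC/open_interior].
Qed.

Lemma bdry_compact : compact (bdry Om).
Proof. by apply: (subclosed_compact bdry_closed closure_compact) => x []. Qed.

Lemma bdry_notin x : bdry Om x -> ~ Om x.
Proof. by move=> [_ nx] Ox; apply: nx; rewrite (interior_id _).1. Qed.

Lemma cyl_compact (K : set 'rV[R]_N) : compact K -> compact (cylinder K).
Proof.
move=> cK; have := compact_setX cK (@segment_compact R (-1) 1).
by congr compact; apply/seteqP; split => -[x y]; rewrite /= in_itv.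
Qed.

Lemma bdry_or x : closure Om x -> Om x \/ bdry Om x.
Proof.
move=> cx; have [Ox|nOx] := pselect (Om x); first by left.
by right; split => //; rewrite (interior_id _).1.
Qed.

(** The conditions on a defining function are open; this lets compactness of the
    boundary turn local constants into uniform ones. *)
Lemma C1_defining_near p rho : C1_defining Om p rho ->
  \forall x \near p, bdry Om x -> C1_defining Om x rho.
Proof.
move=> [Crho g0 Hrho].
have H1 : \forall x \near p, grad rho x != 0.
  have : 0 < `|grad rho p| by rewrite normr_gt0.
  move=> /(cvgr_gt _ (cvg_norm (@grad_cont _ _ rho Crho p))).
  by apply: filterS => x; rewrite normr_gt0.
have H2 := nbhs_interior Hrho.
by apply: filterS2 H1 H2 => x g0' H bx; split.
Qed.

(** A boundary point is a limit of points of [Om], where the defining function is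
    negative, without being in the open set [Om] itself. *)
Lemma defining_bdry0 x rho : bdry Om x -> C1_defining Om x rho -> rho x = 0.
Proof.
move=> bx [Crho _ Hrho]; have [cx _] := bx; have nOx := bdry_notin bx.
apply/eqP; rewrite eq_le; apply/andP; split; rewrite leNgt; apply/negP.
  move=> r0; have : \forall w \near x, 0 < rho w by exact: (cvgr_gt _ (C1_cvg Crho x)).
  move=> /(filterI Hrho)/cx[w [Ow [H]]].
  by move/H : Ow => /lt_trans/[apply]; rewrite ltxx.
by move=> r0; apply: nOx; apply/(nbhs_singleton Hrho).
Qed.

End Domain.

(** * Strict boundary value inequalities *)

Section Strict.
Context {R : realType} {N : nat}.
Implicit Types (P : thin_bvp R N) (z : 'rV[R]_(N + 1)).

(** [strict 1] is the negation of the disjunction in the definition of a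
    subsolution, for a test function with gradient [p] and Hessian [X] at [z] and
    an envelope equal to [r] there; [strict (-1)] is the same for supersolutions. *)
Definition strict (sg : R) P (eps r : R) (X : 'M[R]_(N + 1)) (p z : 'rV[R]_(N + 1)) :=
  [/\ 0 < sg * bvp_F P (X, p, r, xy z),
      lat_bdry (bvp_Om P) (bvp_gm P) (bvp_gp P) eps z ->
        0 < sg * (lateral_lhs (bvp_lat P) z r p - bvp_beta P (xy z)),
      top_bdry (bvp_Om P) (bvp_gp P) eps z ->
        0 < sg * (dot (mkvec (bvp_gamma1p P (xy z)) 1) p - bvp_betap P (xy z)) &
      bot_bdry (bvp_Om P) (bvp_gm P) eps z ->
        0 < sg * (dot (mkvec (bvp_gamma1m P (xy z)) (-1)) p - bvp_betam P (xy z))].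

Lemma visc_subsolP P eps u : visc_subsol P eps u <->
  bdd_on (bvp_closure P eps) u /\
  forall phi zh, C2 phi -> bvp_closure P eps zh ->
    (forall z, bvp_closure P eps z ->
       usc_env (bvp_closure P eps) u z - phi z <= usc_env (bvp_closure P eps) u zh - phi zh) ->
    ~ strict 1 P eps (usc_env (bvp_closure P eps) u zh) (hess phi zh) (grad phi zh) zh.
Proof.
rewrite /visc_subsol /= bdd_onP; split=> -[bu H]; split=> // phi zh Cphi Kzh mx.
  rewrite /strict !mul1r => -[F0 L0 T0 B0].
  case: (H phi zh Cphi Kzh mx) => [|[/L0 + +]|[/T0 + +]|[/B0 + +]]; rewrite ?subr_gt0.
  - by rewrite leNgt F0.
  - by move=> /lt_le_trans/[apply]; rewrite ltxx.
  - by move=> /lt_le_trans/[apply]; rewrite ltxx.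
  - by move=> /lt_le_trans/[apply]; rewrite ltxx.
apply: contrapT => nalt; apply: (H phi zh Cphi Kzh mx).
rewrite /strict !mul1r; split=> [|L|T|B]; rewrite ?subr_gt0 ltNge;
  apply/negP => le0; apply: nalt; [exact: Or41|exact: Or42|exact: Or43|exact: Or44].
Qed.

Lemma visc_supersolP P eps u : visc_supersol P eps u <->
  bdd_on (bvp_closure P eps) u /\
  forall phi zh, C2 phi -> bvp_closure P eps zh ->
    (forall z, bvp_closure P eps z ->
       lsc_env (bvp_closure P eps) u zh - phi zh <= lsc_env (bvp_closure P eps) u z - phi z) ->
    ~ strict (-1) P eps (lsc_env (bvp_closure P eps) u zh) (hess phi zh) (grad phi zh) zh.
Proof.
rewrite /visc_supersol /= bdd_onP; split=> -[bu H]; split=> // phi zh Cphi Kzh mx.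
  rewrite /strict !mulN1r !oppr_gt0 => -[F0 L0 T0 B0].
  case: (H phi zh Cphi Kzh mx) => [|[/L0 + +]|[/T0 + +]|[/B0 + +]];
    rewrite ?mulN1r ?oppr_gt0 ?subr_lt0.
  - by rewrite leNgt F0.
  - by move=> /lt_le_trans/[apply]; rewrite ltxx.
  - by move=> /lt_le_trans/[apply]; rewrite ltxx.
  - by move=> /lt_le_trans/[apply]; rewrite ltxx.
apply: contrapT => nalt; apply: (H phi zh Cphi Kzh mx).
rewrite /strict !mulN1r; split=> [|L|T|B]; rewrite ?mulN1r oppr_gt0 ?subr_lt0 ltNge;
  apply/negP => le0; apply: nalt; [exact: Or41|exact: Or42|exact: Or43|exact: Or44].
Qed.

(** ** The reflection u |-> -u *)

(** u solves the original problem exactly when -u solves this one, so that every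
    statement on subsolutions also serves for supersolutions. *)
Definition reflect_bvp P : thin_bvp R N :=
  ThinBVP (bvp_Om P) (bvp_gm P) (bvp_gp P)
    (fun t => - bvp_F P (- t.1.1.1, - t.1.1.2, - t.1.2, t.2))
    (bvp_gamma1m P) (bvp_gamma1p P)
    (fun t => - bvp_betam P t) (fun t => - bvp_betap P t)
    (bvp_lat P) (fun t => - bvp_beta P t).

Lemma strict_refl sg P eps r X p z :
  strict sg (reflect_bvp P) eps r X p z -> strict (- sg) P eps (- r) (- X) (- p) z.
Proof.
have E c : lateral_lhs c z (- r) (- p) = - lateral_lhs c z r p.
  by case: c => //= g; rewrite dotNr.
case=> /= F0 L T B; split => [|/L|/T|/B]; rewrite ?E ?dotNr.
- by rewrite mulNr -mulrN.
- by rewrite -opprD mulrNN opprK.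
- by rewrite -opprD mulrNN opprK.
- by rewrite -opprD mulrNN opprK.
Qed.

Lemma supersol_refl P eps u : visc_supersol P eps u ->
  visc_subsol (reflect_bvp P) eps (fun w => - u w).
Proof.
move=> /visc_supersolP[bu H]; apply/visc_subsolP; split; first exact: bdd_onN.
move=> phi zh Cphi Kzh mx /strict_refl.
have := H (fun w => - phi w) zh (C2_opp Cphi) Kzh.
rewrite hess_opp// grad_opp; last exact: C2_C1.
rewrite lsc_envE; apply => z Kz; rewrite lsc_envE.
by rewrite -!opprD lerN2; exact: mx.
Qed.

End Strict.

(** * The thin domain and its data *)

(** Degenerate ellipticity together with strict growth in the value of u. *)
Definition proper_op {R : realType} {N : nat} (Om : set 'rV[R]_N) (alpha : R)
    (F : 'M[R]_(N + 1) * 'rV[R]_(N + 1) * R * ('rV[R]_N * R) -> R) : Prop :=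
  forall (p : 'rV[R]_(N + 1)) (x : 'rV[R]_N) (y : R),
    closure Om x -> -1 <= y <= 1 ->
    forall (X Y : 'M[R]_(N + 1)) (r s : R),
      symmetric_mx X -> symmetric_mx Y -> semidef_ge X Y -> r <= s ->
      F (X, p, r, (x, y)) - alpha * r <= F (Y, p, s, (x, y)) - alpha * s.

Section SlopeArith.
Context {R : realType}.

Lemma gap_pos (a a' b : R) : 0 < - (a - b) -> 0 < a' - b -> 0 < a' - a.
Proof. by lra. Qed.

Lemma top_slope (e d : R) : 0 < 1 - e * d -> - 1 < e * - d.
Proof. by rewrite mulrN ltrN2 subr_gt0. Qed.

Lemma bot_slope (e d : R) : 0 < 1 + e * d -> e * - d < - (-1).
Proof. by rewrite mulrN ltrN2 -subr_gt0 opprK addrC. Qed.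

Lemma top_corner_slope (S e g d1 d2 : R) : 0 < S * (g - e * d1) + (1 - e * d2) ->
  - (S * g + 1) < e * - (S * d1 + d2).
Proof.
move=> H; rewrite -subr_gt0.
by have -> : e * - (S * d1 + d2) - - (S * g + 1) = S * (g - e * d1) + (1 - e * d2) by ring.
Qed.

Lemma bot_corner_slope (S e g d1 d2 : R) : 0 < - (S * (g - e * d1)) + (1 + e * d2) ->
  e * - (S * d1 + d2) < - (S * g + -1).
Proof.
move=> H; rewrite -subr_gt0.
by have -> : - (S * g + -1) - e * - (S * d1 + d2) = - (S * (g - e * d1)) + (1 + e * d2) by ring.
Qed.

End SlopeArith.

Section Thin.
Context {R : realType} {N : nat} (P : thin_bvp R N) (eps : R).
Let Om := bvp_Om P.
Let gm := bvp_gm P.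
Let gp := bvp_gp P.
Let K := bvp_closure P eps.
Implicit Types (z d : 'rV[R]_(N + 1)).

(** Where the lateral boundary meets a horizontal face, one direction has to be
    oblique to both. It is sought as [S] times the lateral field plus the field of
    that face; the last four inequalities say that it points strictly out through
    the lateral boundary and through the top, respectively the bottom. *)
Definition corner_cone (gamma : 'rV[R]_N * R -> 'rV[R]_(N + 1)) (x : 'rV[R]_N) :=
  exists rho S, [/\ C1_defining (bvp_Om P) x rho, 0 <= S &
    forall y, eps * bvp_gm P x <= y <= eps * bvp_gp P x ->
    [/\ 0 < dot (xpart (gamma (x, y))) (grad rho x),
        0 < S * dot (xpart (gamma (x, y))) (grad rho x)
            + dot (bvp_gamma1p P (x, y)) (grad rho x),
        0 < S * dot (xpart (gamma (x, y))) (grad rho x)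
            + dot (bvp_gamma1m P (x, y)) (grad rho x),
        0 < S * (ypart (gamma (x, y)) - eps * dot (grad (bvp_gp P) x) (xpart (gamma (x, y))))
            + (1 - eps * dot (grad (bvp_gp P) x) (bvp_gamma1p P (x, y))) &
        0 < - (S * (ypart (gamma (x, y)) - eps * dot (grad (bvp_gm P) x) (xpart (gamma (x, y)))))
            + (1 + eps * dot (grad (bvp_gm P) x) (bvp_gamma1m P (x, y)))]].

(** What Perron's method needs of the data at a fixed [eps]. *)
Record bvp_ok : Prop := BvpOk {
  ok_open : open (bvp_Om P);
  ok_bdd : bounded_set (bvp_Om P);
  ok_gm : C1 (bvp_gm P);
  ok_gp : C1 (bvp_gp P);
  ok_F : {within [set t | symmetric_mx t.1.1.1 /\ cylinder (closure (bvp_Om P)) t.2],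
           continuous (bvp_F P)};
  ok_ell : forall (p : 'rV[R]_(N + 1)) (x : 'rV[R]_N) (y : R),
     closure (bvp_Om P) x -> -1 <= y <= 1 ->
     forall (X Y : 'M[R]_(N + 1)) (r : R),
       symmetric_mx X -> symmetric_mx Y -> semidef_ge X Y ->
       bvp_F P (X, p, r, (x, y)) <= bvp_F P (Y, p, r, (x, y));
  ok_g1m : C0_on (cylinder (closure (bvp_Om P))) (bvp_gamma1m P);
  ok_g1p : C0_on (cylinder (closure (bvp_Om P))) (bvp_gamma1p P);
  ok_bm : C0_on (cylinder (closure (bvp_Om P))) (bvp_betam P);
  ok_bp : C0_on (cylinder (closure (bvp_Om P))) (bvp_betap P);
  ok_beta : C0_on (cylinder (bdry (bvp_Om P))) (bvp_beta P);
  ok_eps : 0 < eps;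
  ok_cyl : forall z, closure (Omega_eps (bvp_Om P) (bvp_gm P) (bvp_gp P) eps) z ->
     closure (bvp_Om P) (xpart z) /\ -1 <= ypart z <= 1;
  ok_g : forall x, closure (bvp_Om P) x -> bvp_gm P x < bvp_gp P x;
  ok_top : forall z, top_bdry (bvp_Om P) (bvp_gp P) eps z ->
     0 < 1 - eps * dot (grad (bvp_gp P) (xpart z)) (bvp_gamma1p P (xy z));
  ok_bot : forall z, bot_bdry (bvp_Om P) (bvp_gm P) eps z ->
     0 < 1 + eps * dot (grad (bvp_gm P) (xpart z)) (bvp_gamma1m P (xy z));
  ok_lat : match bvp_lat P with Dirichlet => True | Oblique gamma =>
     C0_on (cylinder (bdry (bvp_Om P))) gamma /\
     forall x, bdry (bvp_Om P) x -> corner_cone gamma x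
     end }.

Hypothesis ok : bvp_ok.

Lemma bvp_closure_slab z : K z ->
  closure Om (xpart z) /\ eps * gm (xpart z) <= ypart z <= eps * gp (xpart z).
Proof. exact: slab_closure (ok_gm ok) (ok_gp ok). Qed.

Lemma bvp_closure_compact : compact K.
Proof.
have [M HM] := closure_bounded (ok_bdd ok).
apply: (subclosed_compact _ (@compact_rV_ball _ (N + 1) (Num.max M 1))).
  exact: closed_closure.
move=> z Kz /=; have [cz yz] := ok_cyl ok Kz.
apply: rV_norm_le => [|i]; first by rewrite le_max ler01 orbT.
case: (split_ordP i) => j ->.
  by rewrite -xpartE (le_trans (normr_coord _ _))// (le_trans (HM _ cz))// le_max lexx.
by rewrite (ord1 j) -ypartE (@le_trans _ _ 1)// ?ler_norml// le_max lexx orbT.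
Qed.

(** ** Strict inequalities persist nearby *)

(** Off a closed set the implication is void nearby; on it, positivity persists by
    continuity. The function [f] is only controlled on the set, where it agrees with
    the continuous [h]. *)
Lemma pos_near_closed {T : topologicalType} (L : set T) (f h : T -> R) t0 :
  closed L -> (forall t, L t -> f t = h t) -> h @ t0 --> h t0 ->
  (L t0 -> 0 < f t0) -> \forall t \near t0, L t -> 0 < f t.
Proof.
move=> cL fh ch f0; have [Lt|nLt] := pselect (L t0).
  have : 0 < h t0 by rewrite -fh//; exact: f0.
  move=> /(cvgr_gt _ ch); apply: filterS => t ht Lt'; by rewrite fh.
have : nbhs t0 (~` L) by apply: open_nbhs_nbhs; split => //; exact: closed_openC.
by apply: filterS => t nL /nL.
Qed.

Lemma xy_slab z : K z -> cylinder (closure Om) (xy z).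
Proof. by move=> Kz; have [] := ok_cyl ok Kz. Qed.

Lemma lat_bdryE z : K z -> lat_bdry Om gm gp eps z <-> bdry Om (xpart z).
Proof. by move=> Kz; split=> [[]//|bz]; split => //; have [] := bvp_closure_slab Kz. Qed.

Lemma top_bdryE z : K z -> top_bdry Om gp eps z <-> ypart z = eps * gp (xpart z).
Proof. by move=> Kz; split=> [[]//|bz]; split => //; have [] := bvp_closure_slab Kz. Qed.

Lemma bot_bdryE z : K z -> bot_bdry Om gm eps z <-> ypart z = eps * gm (xpart z).
Proof. by move=> Kz; split=> [[]//|bz]; split => //; have [] := bvp_closure_slab Kz. Qed.

Lemma closed_graph (g : 'rV[R]_N -> R) : C1 g ->
  closed [set z | ypart z = eps * g (xpart z)].
Proof.
move=> Cg; rewrite (_ : mkset _ = (fun w => ypart w - eps * g (xpart w)) @^-1` [set x | x = 0]).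
  apply: closed_comp; last exact: closed_eq.
  by move=> w _; exact: (cvgB (@ypart_cont R N w) (cvg_graph eps w Cg)).
by apply/seteqP; split => w /=; [move=> ->; rewrite subrr|move/eqP; rewrite subr_eq0 => /eqP].
Qed.

Lemma closed_preim_fst (A : set 'rV[R]_(N + 1)) : closed A ->
  closed [set q : 'rV[R]_(N + 1) * R | K q.1 /\ A q.1].
Proof.
move=> cA; rewrite (_ : mkset _ = fst @^-1` (K `&` A)); last by apply/seteqP; split.
apply: closed_comp => [q _|]; first exact: cvg_fst.
by apply: closedI => //; exact: closed_closure.
Qed.

(** All the data are continuous, and Hessians of [C2] functions stay in the
    symmetric matrices, on which [F] is continuous. The boundary pieces are closed,
    so a point off a piece has no condition from it nearby. *)
Lemma strict_near sg phi z r : C2 phi -> K z ->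
  strict sg P eps r (hess phi z) (grad phi z) z ->
  \forall q \near (z, r), K q.1 ->
    strict sg P eps q.2 (hess phi q.1) (grad phi q.1) q.1.
Proof.
move=> Cphi Kz [F0 L0 T0 B0].
have cfst : fst q @[q --> (z, r)] --> z by exact: cvg_fst.
have csnd : snd q @[q --> (z, r)] --> r by exact: cvg_snd.
have cH : hess phi q.1 @[q --> (z, r)] --> hess phi z.
  exact: (cvg_comp _ _ cfst (@hess_cont _ _ phi Cphi z)).
have cG : grad phi q.1 @[q --> (z, r)] --> grad phi z.
  exact: (cvg_comp _ _ cfst (@grad_cont _ _ phi (C2_C1 Cphi) z)).
have cxy : xy q.1 @[q --> (z, r)] --> xy z := cvg_comp _ _ cfst (@xy_cont R N z).
have nF : \forall q \near (z, r), K q.1 ->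
    0 < sg * bvp_F P (hess phi q.1, grad phi q.1, q.2, xy q.1).
  have St0 : symmetric_mx (hess phi z) /\ cylinder (closure (bvp_Om P)) (xy z).
    by split; [exact: hess_symmetric|exact: xy_slab].
  have /subspace_continuousP/(_ (hess phi z, grad phi z, r, xy z) St0) cF := ok_F ok.
  have csF : sg * bvp_F P t @[t --> within [set t | symmetric_mx t.1.1.1 /\
      cylinder (closure (bvp_Om P)) t.2] (nbhs (hess phi z, grad phi z, r, xy z))] -->
      sg * bvp_F P (hess phi z, grad phi z, r, xy z).
    exact: cvg_scale.
  have nt : \forall t \near (hess phi z, grad phi z, r, xy z),
      symmetric_mx t.1.1.1 /\ cylinder (closure (bvp_Om P)) t.2 -> 0 < sg * bvp_F P t.
    exact: (cvgr_gt _ csF).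
  have cT : (hess phi q.1, grad phi q.1, q.2, xy q.1) @[q --> (z, r)] -->
      (hess phi z, grad phi z, r, xy z).
    exact: (cvg_quad cH cG csnd cxy).
  have nq : \forall q \near (z, r), symmetric_mx (hess phi q.1) /\
      cylinder (closure (bvp_Om P)) (xy q.1) ->
      0 < sg * bvp_F P (hess phi q.1, grad phi q.1, q.2, xy q.1) := cT _ nt.
  apply: filterS nq => q Hq Kq; apply: Hq.
  by split; [exact: hess_symmetric|exact: xy_slab].
have nL : \forall q \near (z, r), K q.1 /\ bdry Om (xpart q.1) ->
    0 < sg * (lateral_lhs (bvp_lat P) q.1 q.2 (grad phi q.1) - bvp_beta P (xy q.1)).
  have [Gb cGb Eb] := ok_beta ok.
  have bcyl w : K w -> bdry Om (xpart w) -> cylinder (bdry Om) (xy w).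
    by move=> Kw bw; have [] := ok_cyl ok Kw.
  have [h [ch Eh]] : exists h : 'rV[R]_(N + 1) * R -> R, h @ (z, r) --> h (z, r) /\
      forall q, K q.1 -> bdry Om (xpart q.1) ->
        lateral_lhs (bvp_lat P) q.1 q.2 (grad phi q.1) = h q.
    have := ok_lat ok; case: (bvp_lat P) => /= [gamma [[G cG' EG] _]|_].
      exists (fun q => dot (G (xy q.1)) (grad phi q.1)); split.
        by apply: cvg_dot => //; exact: (cvg_comp _ _ cxy (cG' _)).
      by move=> q Kq bq; rewrite EG//; exact: bcyl.
    by exists (fun q => q.2).
  apply: (@pos_near_closed _ [set q | K q.1 /\ bdry Om (xpart q.1)] _
    (fun q => sg * (h q - Gb (xy q.1)))).
  - have cA : closed [set w : 'rV[R]_(N + 1) | bdry Om (xpart w)].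
      by apply: closed_comp (@bdry_closed _ _ Om) => w _; exact: xpart_cont.
    exact: (closed_preim_fst cA).
  - by move=> q [Kq bq]; rewrite Eh// Eb//; exact: bcyl.
  - exact: (cvg_scale _ (cvgB ch (cvg_comp _ _ cxy (cGb _)))).
  - by move=> [_ bz]; apply: L0; apply/lat_bdryE.
have nH (g1 : 'rV[R]_N * R -> 'rV[R]_N) (b g : _ -> R) (a : R) :
    C1 g -> C0_on (cylinder (closure Om)) g1 -> C0_on (cylinder (closure Om)) b ->
    (ypart z = eps * g (xpart z) ->
      0 < sg * (dot (mkvec (g1 (xy z)) a) (grad phi z) - b (xy z))) ->
    \forall q \near (z, r), K q.1 /\ ypart q.1 = eps * g (xpart q.1) ->
      0 < sg * (dot (mkvec (g1 (xy q.1)) a) (grad phi q.1) - b (xy q.1)).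
  move=> Cg [G cG' EG] [Gb cGb Eb] H0.
  apply: (@pos_near_closed _ [set q | K q.1 /\ ypart q.1 = eps * g (xpart q.1)] _
    (fun q => sg * (dot (G (xy q.1)) (xpart (grad phi q.1)) + a * ypart (grad phi q.1)
       - Gb (xy q.1)))).
  - exact: closed_preim_fst (closed_graph Cg).
  - by move=> q [Kq bq]; rewrite dot_split xpart_mkvec ypart_mkvec EG ?Eb//; exact: xy_slab.
  - have c1 : G (xy q.1) @[q --> (z, r)] --> G (xy z) := cvg_comp _ _ cxy (cG' _).
    have c2 : xpart (grad phi q.1) @[q --> (z, r)] --> xpart (grad phi z).
      exact: (cvg_comp _ _ cG (@xpart_cont R N _)).
    have c3 : ypart (grad phi q.1) @[q --> (z, r)] --> ypart (grad phi z).
      exact: (cvg_comp _ _ cG (@ypart_cont R N _)).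
    have c4 : Gb (xy q.1) @[q --> (z, r)] --> Gb (xy z) := cvg_comp _ _ cxy (cGb _).
    exact: (cvg_scale sg (cvgB (cvgD (cvg_dot c1 c2) (cvg_scale a c3)) c4)).
  - by move=> [_ bz]; apply: H0.
have nT := nH _ _ _ 1 (ok_gp ok) (ok_g1p ok) (ok_bp ok)
  (fun e => T0 (proj2 (top_bdryE Kz) e)).
have nB := nH _ _ _ (-1) (ok_gm ok) (ok_g1m ok) (ok_bm ok)
  (fun e => B0 (proj2 (bot_bdryE Kz) e)).
apply: filterS2 (filterI nF nL) (filterI nT nB) => q [HF HL] [HT HB] Kq; split; first exact: HF.
- by move=> /(lat_bdryE Kq) bq; apply: HL.
- by move=> /(top_bdryE Kq) bq; apply: HT.
- by move=> /(bot_bdryE Kq) bq; apply: HB.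
Qed.

(** ** Entering directions *)

Lemma graph_cross (s : R) (g : 'rV[R]_N -> R) z d : C1 g -> ypart z = eps * g (xpart z) ->
  s * (ypart d - eps * dot (xpart d) (grad g (xpart z))) < 0 ->
  \forall t \near (0 : R)^'+, s * (ypart (z + t *: d) - eps * g (xpart (z + t *: d))) < 0.
Proof.
move=> Cg yz dz.
pose k := fun t : R => s * ((ypart z + t * ypart d) - eps * g (xpart z + t *: xpart d)).
have Dk : is_derive (0 : R) (1 : R) k
    (s * (ypart d - eps * 'D_(xpart d) g (xpart z + 0 *: xpart d))).
  have Dg := derivable_line (C1_derivable Cg) : is_derive (0 : R) (1 : R) _ _.
  apply: is_derive_eq.
  by rewrite scaler0 !add0r mul1r [_%:A]mulr1.
have k0 : k 0 = 0 by rewrite /k mul0r scale0r !addr0 yz subrr mulr0.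
have := @derive_lt0_decr R R k 0 1.
rewrite derive_val k0 scale0r addr0 derive_dot_grad; last exact: C1_differentiable.
move=> /(_ (@ex_derive _ _ _ _ _ _ _ Dk) dz); apply: filterS => t.
by rewrite add0r [_%:A]mulr1 /k xpartD xpartZ ypartD ypartZ.
Qed.

(** Each of the three constraints defining the thin domain is either slack at
    [z], or active and strictly decreasing along [d]. *)
Lemma entering_direction z d : K z ->
  Om (xpart z) \/ (exists2 rho, C1_defining Om (xpart z) rho &
                     dot (xpart d) (grad rho (xpart z)) < 0) ->
  ypart z < eps * gp (xpart z) \/ ypart d < eps * dot (xpart d) (grad gp (xpart z)) ->
  eps * gm (xpart z) < ypart z \/ eps * dot (xpart d) (grad gm (xpart z)) < ypart d ->
  \forall t \near (0 : R)^'+, K (z + t *: d).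
Proof.
move=> Kz hx hp hm; have [cx /andP[yl yu]] := bvp_closure_slab Kz.
have path0 : z + t *: d @[t --> (0 : R)] --> z + (0 : R) *: d.
  by apply: cvgD; [exact: cvg_cst|apply: cvgZr_tmp; exact: cvg_id].
have path : z + t *: d @[t --> (0 : R)^'+] --> z.
  by rewrite scale0r addr0 in path0; exact: cvg_at_right_filter path0.
have xpath : xpart (z + t *: d) @[t --> (0 : R)^'+] --> xpart z.
  exact: (cvg_comp _ _ path (@xpart_cont R N z)).
have ypath : ypart (z + t *: d) @[t --> (0 : R)^'+] --> ypart z.
  exact: (cvg_comp _ _ path (@ypart_cont R N z)).
have gpath g : C1 g -> ypart (z + t *: d) - eps * g (xpart (z + t *: d)) @[t --> (0 : R)^'+]
    --> ypart z - eps * g (xpart z).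
  by move=> Cg; exact: (cvgB ypath (cvg_comp _ _ path (cvg_graph eps z Cg))).
have nx : \forall t \near (0 : R)^'+, Om (xpart (z + t *: d)).
  have [Oz|nOz] := pselect (Om (xpart z)).
    by apply: xpath; apply: open_nbhs_nbhs; split => //; exact: ok_open ok.
  case: hx => [//|[rho Drho dr]]; have rho0 : rho (xpart z) = 0.
    by apply: (defining_bdry0 (ok_open ok) _ Drho); case: (bdry_or (ok_open ok) cx).
  case: Drho => Crho _ Hrho.
  have H1 : \forall t \near (0 : R)^'+, rho (xpart z + t *: xpart d) < rho (xpart z).
    apply: derive_lt0_decr; first exact: C1_derivable.
    by rewrite derive_dot_grad//; exact: C1_differentiable.
  have H0 : \forall t \near (0 : R)^'+,
      Om (xpart (z + t *: d)) <-> rho (xpart (z + t *: d)) < 0 := xpath _ Hrho.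
  apply: filterS2 H0 H1 => t E; rewrite rho0 -xpartZ -xpartD => rt.
  exact/E.
have np : \forall t \near (0 : R)^'+, ypart (z + t *: d) - eps * gp (xpart (z + t *: d)) < 0.
  have Hlt : ypart z < eps * gp (xpart z) ->
      \forall t \near (0 : R)^'+, ypart (z + t *: d) - eps * gp (xpart (z + t *: d)) < 0.
    by move=> lt; apply: (cvgr_lt _ (gpath _ (ok_gp ok))); rewrite subr_lt0.
  case: hp => [//|dp]; have [/Hlt//|ge] := ltP (ypart z) (eps * gp (xpart z)).
  have yz : ypart z = eps * gp (xpart z) by apply/eqP; rewrite eq_le yu.
  have := @graph_cross 1 gp z d (ok_gp ok) yz; rewrite mul1r subr_lt0 => /(_ dp).
  by apply: filterS => t; rewrite mul1r.
have nm : \forall t \near (0 : R)^'+, 0 < ypart (z + t *: d) - eps * gm (xpart (z + t *: d)).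
  have Hlt : eps * gm (xpart z) < ypart z ->
      \forall t \near (0 : R)^'+, 0 < ypart (z + t *: d) - eps * gm (xpart (z + t *: d)).
    by move=> lt; apply: (cvgr_gt _ (gpath _ (ok_gm ok))); rewrite subr_gt0.
  case: hm => [//|dp]; have [/Hlt//|ge] := ltP (eps * gm (xpart z)) (ypart z).
  have yz : ypart z = eps * gm (xpart z) by apply/eqP; rewrite eq_le ge.
  have := @graph_cross (-1) gm z d (ok_gm ok) yz.
  rewrite mulN1r oppr_lt0 subr_gt0 => /(_ dp).
  by apply: filterS => t; rewrite mulN1r oppr_lt0.
apply: filterS2 nx (filterI np nm) => t Ox [Hp Hm]; apply: subset_closure; split => //.
by apply/andP; split; [rewrite -subr_gt0|rewrite -subr_lt0].
Qed.

(** The difference [psi - phi] has a local minimum over [K] at [z], so its derivative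
    is nonnegative in every direction entering [K]. On each part of the boundary the strict oblique inequalities make it negative in the
    direction opposite to the oblique field, which enters [K] by obliqueness; at a
    corner the combination in [corner_cone] plays that role. In the open set the
    gradients agree and ellipticity compares the Hessians. *)
Lemma strict_touch (phi psi : 'rV[R]_(N + 1) -> R) z r : C2 phi -> C2 psi -> K z ->
  (\forall w \near z, K w -> phi w - psi w <= phi z - psi z) ->
  strict (-1) P eps r (hess phi z) (grad phi z) z ->
  ~ strict 1 P eps r (hess psi z) (grad psi z) z.
Proof.
move=> Cphi Cpsi Kz mx; rewrite /strict !mulN1r => -[F1 L1 T1 B1].
rewrite !mul1r => -[F2 L2 T2 B2].
have [f [Cf gf hf fmin]] : exists f : 'rV[R]_(N + 1) -> R,
    [/\ C2 f, grad f z = grad psi z - grad phi z, hess f z = hess psi z - hess phi z &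
      \forall w \near z, K w -> f z <= f w].
  exists (fun w => psi w - phi w); split.
  - exact: C2_sub.
  - by apply: grad_sub; exact: C2_C1.
  - exact: hess_sub.
  - by apply: filterS mx => w H /H {}H; lra.
have dir_ge0 d : (\forall t \near (0 : R)^'+, K (z + t *: d)) -> 0 <= dot d (grad f z).
  move=> Kd; rewrite -derive_dot_grad; last by apply: C1_differentiable; exact: C2_C1.
  apply: derive_ge0_of_min; first by apply: C1_derivable; exact: C2_C1.
  have path0 : z + t *: d @[t --> (0 : R)] --> z + (0 : R) *: d.
    by apply: cvgD; [exact: cvg_cst|apply: cvgZr_tmp; exact: cvg_id].
  rewrite scale0r addr0 in path0.
  have path : z + t *: d @[t --> (0 : R)^'+] --> z by exact: cvg_at_right_filter path0.
  have H : \forall t \near (0 : R)^'+, K (z + t *: d) -> f z <= f (z + t *: d) := path _ fmin.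
  by apply: filterS2 Kd H => t Kt /(_ Kt).
have [cx /andP[yl yu]] := bvp_closure_slab Kz.
have g_gt : ypart z = eps * gm (xpart z) -> ypart z < eps * gp (xpart z).
  by move=> ->; rewrite ltr_pM2l ?(ok_eps ok)//; exact: ok_g.
have g_lt : ypart z = eps * gp (xpart z) -> eps * gm (xpart z) < ypart z.
  by move=> ->; rewrite ltr_pM2l ?(ok_eps ok)//; exact: ok_g.
have top_or : ypart z < eps * gp (xpart z) \/ ypart z = eps * gp (xpart z).
  by move: yu; rewrite le_eqVlt => /orP[/eqP|]; [right|left].
have bot_or : eps * gm (xpart z) < ypart z \/ ypart z = eps * gm (xpart z).
  by move: yl; rewrite le_eqVlt => /orP[/eqP|]; [right|left].
have topI : ypart z = eps * gp (xpart z) ->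
    0 < dot (mkvec (bvp_gamma1p P (xy z)) 1) (grad f z).
  by move=> /(top_bdryE Kz) tz; rewrite gf dotBr; exact: gap_pos (T1 tz) (T2 tz).
have botI : ypart z = eps * gm (xpart z) ->
    0 < dot (mkvec (bvp_gamma1m P (xy z)) (-1)) (grad f z).
  by move=> /(bot_bdryE Kz) tz; rewrite gf dotBr; exact: gap_pos (B1 tz) (B2 tz).
have topO : ypart z = eps * gp (xpart z) ->
    0 < 1 - eps * dot (grad gp (xpart z)) (bvp_gamma1p P (xy z)).
  by move=> /(top_bdryE Kz); exact: ok_top.
have botO : ypart z = eps * gm (xpart z) ->
    0 < 1 + eps * dot (grad gm (xpart z)) (bvp_gamma1m P (xy z)).
  by move=> /(bot_bdryE Kz); exact: ok_bot.
have [Ox|bx] := bdry_or (ok_open ok) cx.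
  case: top_or => [ltp|eqp]; last first.
    have := @dir_ge0 (- mkvec (bvp_gamma1p P (xy z)) 1).
    rewrite dotNl oppr_ge0 leNgt (topI eqp) => /(_ _)/notF; apply.
    apply: entering_direction => //; [by left|right|by left; exact: g_lt].
    rewrite ypartN xpartN ypart_mkvec xpart_mkvec dotNl dotC.
    exact: top_slope (topO eqp).
  case: bot_or => [ltm|eqm]; last first.
    have := @dir_ge0 (- mkvec (bvp_gamma1m P (xy z)) (-1)).
    rewrite dotNl oppr_ge0 leNgt (botI eqm) => /(_ _)/notF; apply.
    apply: entering_direction => //; [by left|by left|right].
    rewrite ypartN xpartN ypart_mkvec xpart_mkvec dotNl dotC.
    exact: bot_slope (botO eqm).
  have Kall d : \forall t \near (0 : R), K (z + t *: d).
    have O : \forall w \near z, Omega_eps Om gm gp eps w.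
      have h1 : \forall w \near z, Om (xpart w).
        by apply: (@xpart_cont R N z); apply: open_nbhs_nbhs; split => //; exact: ok_open ok.
      have h2 : \forall w \near z, 0 < ypart w - eps * gm (xpart w).
        apply: (cvgr_gt _ (cvgB (@ypart_cont R N z) (cvg_graph eps z (ok_gm ok)))).
        by rewrite subr_gt0.
      have h3 : \forall w \near z, 0 < eps * gp (xpart w) - ypart w.
        apply: (cvgr_gt _ (cvgB (cvg_graph eps z (ok_gp ok)) (@ypart_cont R N z))).
        by rewrite subr_gt0.
      apply: filterS2 h1 (filterI h2 h3) => w Ow [mw pw]; split => //.
      by rewrite -subr_gt0 mw -subr_gt0.
    have path0 : z + t *: d @[t --> (0 : R)] --> z + (0 : R) *: d.
      by apply: cvgD; [exact: cvg_cst|apply: cvgZr_tmp; exact: cvg_id].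
    rewrite scale0r addr0 in path0.
    have H : \forall t \near (0 : R), Omega_eps Om gm gp eps (z + t *: d) := path0 _ O.
    by apply: filterS H => t; exact: subset_closure.
  have g0 : grad f z = 0.
    apply/eqP; rewrite -normr_le0; apply: rV_norm_le => // i.
    have H d : 0 <= dot d (grad f z) by apply: dir_ge0; apply: cvg_within; exact: Kall.
    have := H (- delta_mx 0 i); have := H (delta_mx 0 i).
    by rewrite dotNl dot_delta normr_le0 oppr_ge0 => ? ?; rewrite eq_le; apply/andP.
  have gE : grad psi z = grad phi z by apply/eqP; rewrite -subr_eq0 -gf g0.
  have hge : semidef_ge (hess psi z) (hess phi z).
    move=> xi.
    rewrite -hf hess_quadratic//; apply: derive2_ge0_of_min => //.
    have path0 : z + t *: xi @[t --> (0 : R)] --> z + (0 : R) *: xi.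
      by apply: cvgD; [exact: cvg_cst|apply: cvgZr_tmp; exact: cvg_id].
    rewrite scale0r addr0 in path0.
    have H : \forall t \near (0 : R), K (z + t *: xi) -> f z <= f (z + t *: xi) := path0 _ fmin.
    by apply: filterS2 (Kall xi) H => t Kt /(_ Kt).
  have [_ yz] := ok_cyl ok Kz.
  have := ok_ell ok (grad phi z) cx yz r (hess_symmetric z Cpsi) (hess_symmetric z Cphi) hge.
  rewrite gE in F2; move=> /(lt_le_trans F2)/lt_trans Flt.
  by rewrite oppr_gt0 in F1; have := Flt _ F1; rewrite ltxx.
(* Under a Dirichlet condition the two strict inequalities bear on the same [r]. *)
have := L2 (proj2 (lat_bdryE Kz) bx); have := L1 (proj2 (lat_bdryE Kz) bx).
have := ok_lat ok; case: (bvp_lat P) => [gamma|_ /=]; last first.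
  by rewrite oppr_gt0 => /lt_trans H /H; rewrite ltxx.
move=> [_ /(_ _ bx)[rho [S [Drho S0 Hy]]]] /= L1' L2'.
have latI : 0 < dot (gamma (xy z)) (grad f z) by rewrite gf dotBr; exact: gap_pos L1' L2'.
have [|H1 H2 H3 H4 H5] := Hy (ypart z); first by rewrite yl.
rewrite -[(xpart z, ypart z)]/(xy z) in H1 H2 H3 H4 H5.
case: top_or => [ltp|eqp]; last first.
  have := @dir_ge0 (- (S *: gamma (xy z) + mkvec (bvp_gamma1p P (xy z)) 1)).
  rewrite dotNl dotDl dotZl oppr_ge0 leNgt ltr_wpDl ?topI//; last by rewrite mulr_ge0// ltW.
  move=> /(_ _)/notF; apply; apply: entering_direction => //; [right|right|by left; exact: g_lt].
    exists rho => //; rewrite xpartN xpartD xpartZ xpart_mkvec dotNl dotDl dotZl.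
    by rewrite oppr_lt0.
  rewrite ypartN xpartN ypartD xpartD xpartZ ypartZ ypart_mkvec xpart_mkvec.
  rewrite dotNl dotDl dotZl (dotC (xpart _)) (dotC (bvp_gamma1p _ _)).
  exact: top_corner_slope H4.
case: bot_or => [ltm|eqm]; last first.
  have := @dir_ge0 (- (S *: gamma (xy z) + mkvec (bvp_gamma1m P (xy z)) (-1))).
  rewrite dotNl dotDl dotZl oppr_ge0 leNgt ltr_wpDl ?botI//; last by rewrite mulr_ge0// ltW.
  move=> /(_ _)/notF; apply; apply: entering_direction => //; [right|by left|right].
    exists rho => //; rewrite xpartN xpartD xpartZ xpart_mkvec dotNl dotDl dotZl.
    by rewrite oppr_lt0.
  rewrite ypartN xpartN ypartD xpartD xpartZ ypartZ ypart_mkvec xpart_mkvec.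
  rewrite dotNl dotDl dotZl (dotC (xpart _)) (dotC (bvp_gamma1m _ _)).
  exact: bot_corner_slope H5.
have := @dir_ge0 (- gamma (xy z)); rewrite dotNl oppr_ge0 leNgt latI => /(_ _)/notF; apply.
apply: entering_direction => //; [right|by left|by left].
by exists rho => //; rewrite xpartN dotNl oppr_lt0.
Qed.

End Thin.

(** * Perron's method *)

Section Quartic.
Context {R : realType} {k : nat}.

(** Adding or subtracting this function makes an extremum at [zh] strict without
    changing the gradient or the Hessian there. *)
Definition quartic (zh : 'rV[R]_k) : 'rV[R]_k -> R :=
  sep_poly (fun i => ('X - (zh 0 i)%:P) ^+ 4).

Lemma quartic_C2 zh : C2 (quartic zh).
Proof. exact: C2_sep_poly. Qed.

Lemma quarticE zh z : quartic zh z = \sum_(i < k) (z 0 i - zh 0 i) ^+ 4.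
Proof. by apply: eq_bigr => i _; rewrite !hornerE. Qed.

Lemma quartic0 zh : quartic zh zh = 0.
Proof. by rewrite quarticE big1// => i _; rewrite subrr expr0n. Qed.

Lemma quartic_grad0 zh : grad (quartic zh) zh = 0.
Proof.
rewrite grad_sep_poly; apply/rowP => i; rewrite !mxE deriv_exp derivXsubC mul1r.
by rewrite hornerMn horner_exp hornerXsubC subrr expr0n mul0rn.
Qed.

Lemma quartic_hess0 zh : hess (quartic zh) zh = 0.
Proof.
rewrite hess_sep_poly; apply/matrixP => i j; rewrite !mxE deriv_exp derivXsubC mul1r.
rewrite derivMn deriv_exp derivXsubC mul1r !hornerMn horner_exp hornerXsubC.
by rewrite subrr expr0n !mul0rn.
Qed.

Lemma quartic_ge0 zh z : 0 <= quartic zh z.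
Proof. by rewrite quarticE sumr_ge0// => i _; rewrite exprn_even_ge0. Qed.

Lemma quartic_lt zh z (d : R) : 0 < d -> quartic zh z < d ^+ 4 -> `|zh - z| <= d.
Proof.
move=> d0 qd; apply: rV_norm_le => [|i]; first exact: ltW.
rewrite !mxE distrC leNgt; apply/negP => di; move: qd; apply/negP; rewrite -leNgt.
have : d ^+ 4 <= `|z 0 i - zh 0 i| ^+ 4.
  by apply: lerXn2r; rewrite ?nnegrE ?(ltW d0)// ltW.
rewrite -normrX ger0_norm ?exprn_even_ge0// => /le_trans; apply.
rewrite quarticE (bigD1 i)//= lerDl.
by apply: sumr_ge0 => j _; rewrite exprn_even_ge0.
Qed.

End Quartic.

Section PerronArith.
Context {R : realType}.

Lemma perron_gap (t e vx px vzh pzh wx p1x wz p1z q p1h w u : R) : 0 < t -> t <= e / 4 ->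
  vx - px <= vzh - pzh -> wx <= vx -> wz - p1z <= wx - p1x -> p1x = px + q -> p1h = pzh ->
  w <= wz -> u - t < w -> vzh - t < u -> p1z < p1h + t -> q < e.
Proof. by move=> *; lra. Qed.

End PerronArith.

Section Perron.
Context {R : realType} {N : nat} (P : thin_bvp R N) (eps : R).
Hypothesis ok : bvp_ok P eps.
Let K := bvp_closure P eps.
Implicit Types (z zh : 'rV[R]_(N + 1)) (phi psi : 'rV[R]_(N + 1) -> R).

Lemma C2_bdd_on phi : C2 phi -> bdd_on K phi.
Proof.
move=> Cphi; have [B _ HB] := compact_norm_bounded (bvp_closure_compact ok)
  (continuous_subspaceT (C1_continuous (C2_C1 Cphi))).
by exists B.
Qed.

(** The variation of [phi] on the ball is kept below a fraction of the tolerance [d]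
    on the value, so that a function touched near [zh] still has its value within
    [d] of [r]. *)
Lemma strict_ball sg phi zh r : C2 phi -> K zh ->
  strict sg P eps r (hess phi zh) (grad phi zh) zh ->
  exists d e : R, [/\ 0 < d, 0 < e & forall z r', K z -> `|zh - z| <= e -> `|r - r'| < d ->
    `|phi zh - phi z| < d / 4 /\ strict sg P eps r' (hess phi z) (grad phi z) z].
Proof.
move=> Cphi Kzh /(strict_near ok Cphi Kzh)/nbhs_ballP[d /= d0 Hd].
have d40 : 0 < d / 4 by rewrite divr_gt0.
have /cvgrPdist_lt/(_ _ d40)/nbhs_ballP[e /= e0 He] := C1_cvg (C2_C1 Cphi) zh.
exists d, (Num.min d e / 2); split => //; first by rewrite divr_gt0// lt_min d0.
move=> z r' Kz ze rd.
have lt2 : `|zh - z| < Num.min d e.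
  by apply: (le_lt_trans ze); rewrite ltr_pdivrMr// ltr_pMr ?ltr1n// lt_min d0.
move: lt2; rewrite lt_min => /andP[zd ze'].
split; first by apply: He; rewrite -ball_normE.
have Hq : ball (zh, r) d (z, r') by split; rewrite /= -ball_normE.
exact: (Hd _ Hq Kz).
Qed.

Variables (B : R) (lo : 'rV[R]_(N + 1) -> R).
Hypothesis subB : forall w, visc_subsol P eps w -> forall z, K z -> w z <= B.
Hypothesis lo_sub : visc_subsol P eps lo.

Definition perron (z : 'rV[R]_(N + 1)) : R := sup [set w z | w in visc_subsol P eps].

Lemma perron_has_sup z : K z -> has_sup [set w z | w in visc_subsol P eps].
Proof.
move=> Kz; split; first by exists (lo z); exists lo.
by exists B => _ [w Sw <-]; exact: subB.
Qed.

Lemma perron_ge w z : visc_subsol P eps w -> K z -> w z <= perron z.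
Proof.
by move=> Sw Kz; apply: sup_upper_bound; [exact: perron_has_sup|exists w].
Qed.

Lemma perron_bdd : bdd_on K perron.
Proof.
have /visc_subsolP[[M HM] _] := lo_sub.
exists (Num.max M `|B|) => z Kz; rewrite ler_norml; apply/andP; split.
  apply: (le_trans _ (perron_ge lo_sub Kz)).
  have := HM _ Kz; rewrite ler_norml => /andP[+ _]; apply: le_trans.
  by rewrite lerN2 le_max lexx.
apply: (@le_trans _ _ B); last by rewrite le_max ler_norm orbT.
by apply: ge_sup; [exists (lo z), lo|move=> _ [w Sw <-]; exact: subB].
Qed.

(** The classical stability argument. After the test function is made strict by the
    quartic, some subsolution [w] nearly realises the supremum near [zh]; the
    maximum of its envelope minus the test function is then close to [zh], where
    all the inequalities are still strictly violated, against [w] being a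
    subsolution. *)
Lemma perron_subsol : visc_subsol P eps perron.
Proof.
apply/visc_subsolP; split; first exact: perron_bdd.
move=> phi zh Cphi Kzh; rewrite -/K; set v := usc_env K perron => mx st.
pose phi1 : 'rV[R]_(N + 1) -> R := fun z => phi z + quartic zh z.
have Cphi1 : C2 phi1 := C2_add Cphi (quartic_C2 zh).
have E0 : phi1 zh = phi zh by rewrite /phi1 quartic0 addr0.
have st1 : strict 1 P eps (v zh) (hess phi1 zh) (grad phi1 zh) zh.
  have -> : hess phi1 zh = hess phi zh.
    by apply: (etrans (hess_add _ Cphi (quartic_C2 zh))); rewrite quartic_hess0 addr0.
  have -> // : grad phi1 zh = grad phi zh.
  apply: (etrans (grad_add _ (C2_C1 Cphi) (C2_C1 (quartic_C2 zh)))).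
  by rewrite quartic_grad0 addr0.
have Edef z : phi1 z = phi z + quartic zh z by [].
clearbody phi1.
have [d [e [d0 e0 near_st]]] := strict_ball Cphi1 Kzh st1.
(* Three errors of size [t] accumulate: from the envelope, from the supremum and
   from the variation of the test function. *)
pose t := Num.min (d / 16) (e ^+ 4 / 4).
have t0 : 0 < t by rewrite lt_min !divr_gt0// exprn_gt0.
have td : t <= d / 16 by rewrite ge_min lexx.
have te : t <= e ^+ 4 / 4 by rewrite ge_min lexx orbT.
have U : \forall z \near zh, phi1 z < phi1 zh + t.
  by apply: (cvgr_lt _ (C1_cvg (C2_C1 Cphi1) zh)); rewrite ltrDl.
have vt : v zh - t < v zh by rewrite gtrBl.
have [z [Kz Uz uz]] := usc_env_gt_ex perron_bdd Kzh vt U.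
have [_ [w Sw <-] wz] := sup_adherent t0 (perron_has_sup Kz).
rewrite -/(perron z) in wz.
have /visc_subsolP[bw Hw] := Sw.
pose ws := usc_env K w; have [Bw HBw] := bw; have [Bp HBp] := C2_bdd_on Cphi1.
have [|y Ky|y c Ky yc|x Kx xmax] :=
  @usc_max R _ K (fun y => ws y - phi1 y) (Bw + Bp) (bvp_closure_compact ok).
- by exists zh.
- apply: lerD; first by rewrite (le_trans (ler_norm _))// usc_env_bound.
  by rewrite (le_trans (ler_norm _))// normrN HBp.
- have lt1 : ws y < (ws y + c + phi1 y) / 2 by lra.
  have H1 := usc_env_usc bw Ky lt1.
  have H2 : \forall x \near y, (ws y - c + phi1 y) / 2 < phi1 x.
    by apply: (cvgr_gt _ (C1_cvg (C2_C1 Cphi1) y)); lra.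
  apply: filterS2 H1 H2 => x H1 H2 /H1 {}H1.
  by rewrite /ws; lra.
have wle y : K y -> ws y <= v y.
  by move=> Ky; apply: usc_env_mono => //; [exact: perron_bdd|move=> ? ?; exact: perron_ge].
have wge : w z <= ws z by exact: usc_env_ge.
have := xmax z Kz; have := wle x Kx; have := mx x Kx.
have := Edef x; have := quartic_ge0 zh x; move=> q0 Ex mxx wlex maxz.
have qt : quartic zh x < e ^+ 4 := perron_gap t0 te mxx wlex maxz Ex E0 wge wz uz Uz.
have xe := quartic_lt e0 qt.
have [px _] := near_st x (v zh) Kx xe ltac:(by rewrite subrr normr0).
move: px; rewrite ltr_norml => /andP[px1 px2].
have wd : `|v zh - ws x| < d.
  rewrite ltr_norml; move: maxz wge wz uz Uz wlex mxx Ex E0 q0 px1 px2 td d0.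
  move: (ws z) (phi1 z) (ws x) (phi1 x) (w z) (perron z) (t) (v zh) (phi1 zh) (v x) (phi x)
    (phi zh) (quartic zh x); clear => *; apply/andP; split; lra.
have [_ stx] := near_st x (ws x) Kx xe wd.
by apply: (Hw phi1 x Cphi1 Kx xmax).
Qed.

(** The bump argument. If a test function touching from below strictly violated
    every alternative, its translate [h] by [t] would exceed the supremum only near
    [zh]; the maximum of the two is again a subsolution, by [strict_touch] where [h]
    is the larger one, and it is larger than the supremum at some point. *)
Lemma perron_supersol : visc_supersol P eps perron.
Proof.
apply/visc_supersolP; split; first exact: perron_bdd.
move=> phi zh Cphi Kzh; rewrite -/K; set v := lsc_env K perron => mx st.
pose phi1 : 'rV[R]_(N + 1) -> R := fun z => phi z - quartic zh z.
have Cphi1 : C2 phi1 := C2_sub Cphi (quartic_C2 zh).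
have E0 : phi1 zh = phi zh by rewrite /phi1 quartic0 subr0.
have st1 : strict (-1) P eps (v zh) (hess phi1 zh) (grad phi1 zh) zh.
  have -> : hess phi1 zh = hess phi zh.
    by apply: (etrans (hess_sub _ Cphi (quartic_C2 zh))); rewrite quartic_hess0 subr0.
  have -> // : grad phi1 zh = grad phi zh.
  apply: (etrans (grad_sub _ (C2_C1 Cphi) (C2_C1 (quartic_C2 zh)))).
  by rewrite quartic_grad0 subr0.
have Edef z : phi1 z = phi z - quartic zh z by [].
clearbody phi1.
have [d [e [d0 e0 near_st]]] := strict_ball Cphi1 Kzh st1.
pose t := Num.min (d / 4) (e ^+ 4 / 2).
have t0 : 0 < t by rewrite lt_min !divr_gt0// exprn_gt0.
have td : t <= d / 4 by rewrite ge_min lexx.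
have te : t <= e ^+ 4 / 2 by rewrite ge_min lexx orbT.
have bN := bdd_onN perron_bdd.
have vle z : K z -> v z <= perron z.
  by move=> Kz; rewrite /v lsc_envE lerNl; exact: (usc_env_ge bN Kz).
pose h := fun z => phi1 z + (v zh - phi zh + t).
have ch : continuous h.
  by move=> z; exact: (cvgD (C1_cvg (C2_C1 Cphi1) z) (cvg_cst _)).
have hclose z : K z -> perron z < h z -> `|zh - z| <= e.
  move=> Kz; rewrite /h => hz; apply: quartic_lt => //.
  by have := vle _ Kz; have := mx _ Kz; have := Edef z; lra.
have [Bu HBu] := perron_bdd; have [Bp HBp] := C2_bdd_on Cphi1.
pose U := fun z => Num.max (perron z) (h z).
have bU : bdd_on K U.
  exists (Bu + (Bp + `|v zh - phi zh + t|)) => z Kz.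
  have H1 := HBu _ Kz; have H2 := HBp _ Kz.
  have H3 : `|h z| <= Bp + `|v zh - phi zh + t|.
    by apply: (le_trans (ler_normD _ _)); rewrite lerD2r.
  have [? ?] : 0 <= Bu /\ 0 <= Bp + `|v zh - phi zh + t|.
    by split; [exact: le_trans H1|exact: le_trans H3].
  by rewrite /U; case: (leP (perron z) (h z)) => _; lra.
have US : visc_subsol P eps U.
  apply/visc_subsolP; split => // psi x Cpsi Kx; rewrite -/K => mxU.
  have UE y : K y -> usc_env K U y = Num.max (usc_env K perron y) (h y).
    by move=> Ky; apply: usc_env_max_cont => //; exact: perron_bdd.
  have [hu|uh] := leP (h x) (usc_env K perron x).
    have EU : usc_env K U x = usc_env K perron x by rewrite UE// max_l.
    rewrite EU; have /visc_subsolP[_ Hp] := perron_subsol.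
    apply: Hp => // y Ky; rewrite -/K -EU; apply: le_trans (mxU _ Ky).
    by rewrite lerD2r UE// le_max lexx.
  have EU : usc_env K U x = h x by rewrite UE// max_r// ltW.
  have ux : perron x < h x by apply: le_lt_trans uh; apply: usc_env_ge => //; exact: perron_bdd.
  have xe := hclose _ Kx ux.
  have [px _] := near_st x (v zh) Kx xe ltac:(by rewrite subrr normr0).
  move: px; rewrite ltr_norml => /andP[px1 px2].
  have hd : `|v zh - h x| < d by rewrite ltr_norml /h; apply/andP; split; lra.
  have [_ stx] := near_st x (h x) Kx xe hd.
  rewrite EU; apply: (strict_touch ok Cphi1 Cpsi Kx _ stx).
  apply: filterE => y Ky.
  have := mxU _ Ky; rewrite EU UE// => H.
  have : h y - psi y <= h x - psi x by apply: le_trans H; rewrite lerD2r le_max lexx orbT.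
  by rewrite /h; lra.
have vt : - v zh - t / 2 < usc_env K (fun w => - perron w) zh.
  by rewrite /v lsc_envE opprK gtrBl divr_gt0.
have near1 : \forall z \near zh, phi1 zh - t / 2 < phi1 z.
  by apply: (cvgr_gt _ (C1_cvg (C2_C1 Cphi1) zh)); rewrite gtrBl divr_gt0.
have [z [Kz pz uz]] := usc_env_gt_ex bN Kzh vt near1.
have := perron_ge US Kz; rewrite /U ge_max => /andP[_].
by rewrite /h; lra.
Qed.

Lemma perron_sol : visc_sol P eps perron.
Proof. by split; [exact: perron_subsol|exact: perron_supersol]. Qed.

End Perron.

(** * Quadratic test functions *)

Section Quadratic.
Context {R : realType} {N : nat}.
Implicit Types (x n : 'rV[R]_N) (z : 'rV[R]_(N + 1)).

(** The index [j] is the pair (x0, n) of the centre and the slope at the centre. *)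
Definition qprof (B : R) (j : 'rV[R]_N * 'rV[R]_N) x : R :=
  dot j.2 (x - j.1) + B / 2 * dot (x - j.1) (x - j.1).

Definition qprof_grad (B : R) (j : 'rV[R]_N * 'rV[R]_N) x : 'rV[R]_N :=
  j.2 + B *: (x - j.1).

(** Written coordinate by coordinate, as [sep_poly] requires; [test_fnE] recovers the
    profile, the penalty of the distance to [x'] and the vertical part. *)
Definition test_poly (A B C bb : R) (j : 'rV[R]_N * 'rV[R]_N) x' (i : 'I_(N + 1)) : {poly R} :=
  match fintype.split i with
  | inl l => (j.2 0 l) *: ('X - (j.1 0 l)%:P) + (B / 2) *: ('X - (j.1 0 l)%:P) ^+ 2
             + 2^-1 *: ('X - (x' 0 l)%:P) ^+ 2
  | inr _ => A%:P + bb *: 'X + (C / 2) *: 'X ^+ 2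
  end.

Definition test_fn A B C bb j x' : 'rV[R]_(N + 1) -> R := sep_poly (test_poly A B C bb j x').

Lemma test_fn_C2 A B C bb j x' : C2 (test_fn A B C bb j x').
Proof. exact: C2_sep_poly. Qed.

Lemma test_fnE A B C bb j x' z : test_fn A B C bb j x' z =
  A + qprof B j (xpart z) + ypart z * bb + dot (xpart z - x') (xpart z - x') / 2
  + C / 2 * ypart z ^+ 2.
Proof.
rewrite /test_fn /sep_poly big_split_ord /= big_ord1 /test_poly.
case: (split_ordP (rshift N 0)) => [l /eqP|l]; first by rewrite eq_rlshift.
move=> _; rewrite -ypartE.
under eq_bigr => l0 _.
  rewrite (_ : fintype.split (lshift 1 l0) = inl l0); last exact: (unsplitK (inl l0)).
  rewrite -xpartE; over.
have -> : \sum_(l < N) (j.2 0 l *: ('X - (j.1 0 l)%:P) + (B / 2) *: ('X - (j.1 0 l)%:P) ^+ 2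
     + 2^-1 *: ('X - (x' 0 l)%:P) ^+ 2).[xpart z 0 l]
  = dot j.2 (xpart z - j.1) + B / 2 * dot (xpart z - j.1) (xpart z - j.1)
    + dot (xpart z - x') (xpart z - x') / 2.
  have E3 (a b c : 'I_N -> R) : \sum_i a i + \sum_i b i + \sum_i c i = \sum_i (a i + b i + c i).
    by rewrite !big_split.
  rewrite /dot mulr_sumr mulr_suml E3; apply: eq_bigr => i _.
  have S (a b : 'rV[R]_N) : (a - b) 0 i = a 0 i - b 0 i by rewrite !mxE.
  by rewrite !hornerD !hornerZ !horner_exp !hornerXsubC !S; ring.
by rewrite /qprof !hornerD hornerC !hornerZ hornerX hornerXn; ring.
Qed.

Lemma test_fn_grad_x A B C bb j x' z :
  xpart (grad (test_fn A B C bb j x') z) = qprof_grad B j (xpart z) + (xpart z - x').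
Proof.
rewrite grad_sep_poly; apply/rowP => l; rewrite xpartE mxE /test_poly.
case: (split_ordP (lshift 1 l)) => [l' /lshift_inj <-|l' /eqP]; last by rewrite eq_lrshift.
rewrite !derivD !derivZ !deriv_exp !derivXsubC !hornerE /= -xpartE !mxE.
by field.
Qed.

Lemma test_fn_grad_y A B C bb j x' z :
  ypart (grad (test_fn A B C bb j x') z) = bb + C * ypart z.
Proof.
rewrite grad_sep_poly ypartE mxE /test_poly.
case: (split_ordP (rshift N 0)) => [l /eqP|l _]; first by rewrite eq_rlshift.
rewrite !derivD !derivZ derivC derivX derivXn !hornerE /= -ypartE.
by field.
Qed.

Definition test_hess_mx (B C : R) : 'M[R]_(N + 1) :=
  diag_mx (\row_(i < N + 1) match fintype.split i with inl _ => B + 1 | inr _ => C end).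

Lemma test_fn_hess A B C bb j x' z : hess (test_fn A B C bb j x') z = test_hess_mx B C.
Proof.
rewrite hess_sep_poly /test_hess_mx; congr diag_mx; apply/rowP => i; rewrite !mxE /test_poly.
case: (fintype.split i) => l.
  rewrite !derivD !derivZ !deriv_exp !derivXsubC /= !expr1 !mul1r !derivMn !derivXsubC.
  by rewrite -polyC1 derivC !hornerE; field.
rewrite !derivD !derivZ derivC derivX derivXn /= expr1 derivMn derivX -polyC1 !derivC.
by rewrite !hornerE; field.
Qed.

Lemma test_hess_sym B C : symmetric_mx (test_hess_mx B C).
Proof. exact: tr_diag_mx. Qed.

End Quadratic.

(** * The geometry of the lateral boundary *)

Section FamilyArith.
Context {R : realType}.

Lemma half_le (a b c : R) : a * (2 * b) <= c -> a * b <= c / 2.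
Proof. by lra. Qed.

Lemma near_value (a b d n m p : R) : 0 < d -> a <= n * d -> b <= p / 2 * (m * d) ->
  0 <= p * m * d -> a + b <= d * (n + p * m + 1).
Proof. by move=> *; lra. Qed.

Lemma far_value (a b b' u v w : R) : - u <= a -> b' <= b -> u + v <= b' -> w <= v ->
  w <= a + b.
Proof. by move=> *; lra. Qed.

Lemma half_gain (a b : R) : 1 <= a -> - 2^-1 <= b -> 1 <= 2 * (a + b).
Proof. by move=> *; lra. Qed.

End FamilyArith.

Section Lateral.
Context {R : realType} {N : nat} (Om : set 'rV[R]_N) (nu : 'rV[R]_N -> 'rV[R]_N).
Hypothesis oOm : open Om.
Hypothesis bOm : bounded_set Om.
Hypothesis hnu : outward_unit_normal Om nu.
Variable gamma : 'rV[R]_N * R -> 'rV[R]_(N + 1).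
Hypothesis cgamma : C0_on (cylinder (bdry Om)) gamma.
Hypothesis pgamma : forall x y, bdry Om x -> -1 <= y <= 1 ->
  0 < dot (xpart (gamma (x, y))) (nu x).

Lemma dot_eq0 {k : nat} (u : 'rV[R]_k) : dot u u = 0 -> u = 0.
Proof.
move=> u0; apply/eqP; rewrite -normr_eq0 -sqrf_eq0.
by rewrite eq_le exprn_even_ge0// andbT -u0 sqr_norm_le_dot.
Qed.

(** The gradient of a defining function is a positive multiple of the normal. *)
Lemma normal_near p : bdry Om p -> exists2 rho, C1_defining Om p rho &
  0 < dot (xpart (gamma (p, 0))) (grad rho p).
Proof.
move=> bp; have [rho Drho Enu] := hnu bp; exists rho => //.
have H0 : -1 <= (0 : R) <= 1 by rewrite lerN10 ler01.
have := pgamma bp H0; rewrite Enu dotZr pmulr_rgt0// invr_gt0 sqrtr_gt0.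
case: Drho => _ g0 _; rewrite lt_neqAle dot_ge0 andbT eq_sym.
by apply: contra_neq g0; exact: dot_eq0.
Qed.

(** Two nearby zeros of a [C1] defining function are joined by a chord nearly
    orthogonal to its gradient, by the mean value theorem. The vector [n] is that
    gradient, scaled so that the oblique field has a component at least 1 along it;
    compactness makes the radius uniform. *)
Lemma uniform_normals (kap : R) : 0 < kap -> exists2 r : R, 0 < r &
  forall x0, bdry Om x0 -> exists n : 'rV[R]_N, [/\ `|n| <= r^-1,
    forall x, bdry Om x -> `|x - x0| < r -> `|dot n (x - x0)| <= kap * `|x - x0| &
    forall x y, bdry Om x -> `|x - x0| < r -> `|y| < r -> 1 <= dot (xpart (gamma (x, y))) n].
Proof.
move=> kap0; have [G cG EG] := cgamma.
have /compact_near_coveringP/near_covering_withinP cov := (bdry_compact bOm).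
have H : \forall r \near (0 : R)^'+, forall x0, bdry Om x0 -> exists n : 'rV[R]_N,
   [/\ `|n| <= r^-1,
    forall x, bdry Om x -> `|x - x0| < r -> `|dot n (x - x0)| <= kap * `|x - x0| &
    forall x y, bdry Om x -> `|x - x0| < r -> `|y| < r -> 1 <= dot (xpart (gamma (x, y))) n].
  apply: cov => p bp; have [rho Drho] := normal_near bp.
  set c := dot _ _ => c0; have [Crho _ _] := Drho.
  pose n := (2 / c) *: grad rho p.
  have ncont : dot (xpart (G q)) n @[q --> (p, (0 : R))] --> dot (xpart (G (p, 0))) n.
    apply: cvg_dot; last exact: cvg_cst.
    exact: (cvg_comp _ _ (cG (p, 0)) (@xpart_cont R N _)).
  have n2 : dot (xpart (G (p, 0))) n = 2.
    rewrite -EG; last by split => //=; rewrite lerN10 ler01.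
    by rewrite dotZr -/c mulfVK// gt_eqF.
  have : 1 < dot (xpart (G (p, 0))) n by rewrite n2 ltr1n.
  move=> /(cvgr_gt _ ncont)/nbhs_ballP[d1 /= d10 Hd1].
  have k20 : 0 < kap * c / (2 * (N%:R + 1)).
    by rewrite divr_gt0// ?mulr_gt0// ltr_wpDl.
  have /cvgrPdist_lt/(_ _ k20)/nbhs_ballP[d2 /= d20 Hd2] := @grad_cont _ _ rho Crho p.
  have /nbhs_ballP[d3 /= d30 Hd3] := C1_defining_near Drho.
  pose d := Num.min d1 (Num.min d2 d3).
  have d0 : 0 < d by rewrite !lt_min d10 d20.
  have [dd1 dd2 dd3] : [/\ d <= d1, d <= d2 & d <= d3].
    by rewrite /d !ge_min !lexx !orbT.
  have nr : \forall r \near (0 : R)^'+, [/\ 0 < r, r < d / 2, r < 1 & `|n| <= r^-1].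
    have nn0 : 0 < (`|n| + 1)^-1 by rewrite invr_gt0 ltr_wpDl.
    have d20' : 0 < d / 2 by rewrite divr_gt0.
    apply: filterS2 (filterI (nbhs_right_gt (0 : R)) (nbhs_right_lt d20'))
      (filterI (nbhs_right_lt (@ltr01 R)) (nbhs_right_lt nn0)) => r [r0 rd] [r1 rn].
    split => //; move: rn; rewrite -ltf_pV2 ?posrE// invrK => /ltW; apply: le_trans.
    by rewrite lerDl.
  near=> x0 r => bx0 /=.
  have [r0 rd r1 nr1] : [/\ 0 < r, r < d / 2, r < 1 & `|n| <= r^-1] by apply: (near nr r).
  have x0p : `|p - x0| < d / 2.
    have : ball p (d / 2) x0 by near: x0; apply: nbhsx_ballx; rewrite divr_gt0.
    by rewrite -ball_normE.
  have close x : `|x - x0| < r -> `|p - x| < d.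
    move=> xx0; rewrite (splitr d); apply: (le_lt_trans (ler_distD x0 _ _)).
    by rewrite ltrD// distrC (lt_trans xx0).
  exists n; split => // [x bx xx0|x y bx xx0 yr].
    have px := close _ xx0.
    have D3 w : `|p - w| < d -> bdry Om w -> rho w = 0.
      move=> pw bw; apply: (defining_bdry0 oOm) => //; apply: Hd3 => //.
      by rewrite -ball_normE /=; exact: lt_le_trans dd3.
    have [t /andP[t0 t1]] := MVT_line x0 (x - x0) Crho.
    have rx : rho x = 0 := D3 _ px bx.
    have rx0 : rho x0 = 0.
      by apply: D3 => //; apply: (lt_trans x0p); rewrite ltr_pdivrMr// ltr_pMr// ltr1n.
    rewrite (addrC x0 (x - x0)) subrK rx rx0 subrr derive_dot_grad; last exact: C1_differentiable.
    set xi := x0 + _ => E.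
    have pxi : `|p - xi| < d2.
      apply: (lt_le_trans _ dd2); rewrite (splitr d); apply: (le_lt_trans (ler_distD x0 _ _)).
      rewrite ltrD// /xi opprD addNKr normrN normrZ gtr0_norm//.
      apply: (lt_trans _ rd); apply: (le_lt_trans _ xx0).
      by rewrite -[leRHS]mul1r ler_wpM2r// ltW.
    have gxi : `|grad rho p - grad rho xi| < kap * c / (2 * (N%:R + 1)).
      by apply: Hd2; rewrite -ball_normE.
    have -> : dot n (x - x0) = 2 / c * dot (x - x0) (grad rho p - grad rho xi).
      by rewrite (dotBr (x - x0) (grad rho p)) -E subr0 /n dotZl dotC.
    rewrite normrM ger0_norm; last by rewrite divr_ge0// ltW.
    have := dot_norm_le (x - x0) (grad rho p - grad rho xi) => H1.
    have N0 : 0 <= N%:R :> R by [].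
    have : `|dot (x - x0) (grad rho p - grad rho xi)| <=
        N%:R * `|x - x0| * (kap * c / (2 * (N%:R + 1))).
      by apply: (le_trans H1); rewrite ler_wpM2l ?mulr_ge0// ltW.
    move=> H2; apply: (@le_trans _ _ (2 / c * (N%:R * `|x - x0| * (kap * c / (2 * (N%:R + 1)))))).
      by rewrite ler_wpM2l// divr_ge0// ltW.
    have -> : 2 / c * (N%:R * `|x - x0| * (kap * c / (2 * (N%:R + 1)))) =
        (kap * `|x - x0|) * (N%:R / (N%:R + 1)).
      by field; rewrite !gt_eqF// ltr_wpDl.
    rewrite ler_piMr ?mulr_ge0// ?(ltW kap0)// ler_pdivrMr ?ltr_wpDl// mul1r lerDl.
    exact: ler01.
  have y1 : -1 <= y <= 1 by rewrite -ler_norml ltW// (lt_trans yr).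
  rewrite EG//; apply/ltW/Hd1; split; rewrite /= -ball_normE /=.
    exact: lt_le_trans (close _ xx0) dd1.
  rewrite sub0r normrN (lt_trans yr)// (lt_le_trans rd)//.
have [r [r0 Hr]] := filter_ex (filterI (nbhs_right_gt (0 : R)) H).
by exists r.
Unshelve. all: by end_near. Qed.

(** A boundary that is only [C1] carries no [C2] function with a prescribed oblique
    derivative; the minimum of a finite family of quadratics is a substitute. The
    slope at each centre is an outer normal, and the centres form a fine net of the
    boundary. At a boundary point [x] the profile of a nearby centre is almost 0,
    whereas a distant centre has a large one: the chord is almost tangential, so the
    quadratic term dominates the linear one. Hence the members within [eta] of the
    minimum at [x] have their centre near [x], and their gradient is close to a
    multiple of a normal at [x], so its oblique component is large. *)
Lemma oblique_family (M : R) : 0 < M -> exists (s : seq ('rV[R]_N * 'rV[R]_N)) (B eta : R),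
  [/\ s != [::], 0 <= B, 0 < eta &
   forall x j, bdry Om x -> j \in s ->
     (forall i, i \in s -> qprof B j x <= qprof B i x + eta) ->
     forall y, `|y| <= eta -> M <= dot (xpart (gamma (x, y))) (qprof_grad B j x)].
Proof.
move=> M0; have [G cG EG] := cgamma.
have [Ga Ga0 HGa] : exists2 Ga : R, 0 < Ga & forall x y, bdry Om x -> -1 <= y <= 1 ->
    `|xpart (gamma (x, y))| <= Ga.
  have cxG : continuous (fun q => xpart (G q)).
    by move=> q; exact: (cvg_comp _ _ (cG q) (@xpart_cont R N _)).
  have [Ga Ga0 HGa] := compact_norm_bounded (cyl_compact (bdry_compact bOm))
    (continuous_subspaceT cxG).
  exists Ga => // x y bx y1; rewrite EG//; exact: HGa.
pose N1 : R := N%:R + 1.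
have N10 : 0 < N1 by rewrite ltr_wpDl.
pose L := N1 * Ga.
have L0 : 0 < L by rewrite mulr_gt0.
have kap0 : 0 < (8 * L)^-1 by rewrite invr_gt0 mulr_gt0.
have [r r0 Hr] := uniform_normals kap0.
(* [B1] makes the profile at least 1 beyond the radius [r] of the uniform normals;
   [rho0] is a distance at which the quadratic term still changes the oblique
   derivative by at most 1/2; [th] separates the centres closer than [rho0] from
   the others; [del] is the mesh of the net. *)
pose B1 := 2 * (N1 + 1) / r ^+ 2.
have B10 : 0 < B1 by rewrite divr_gt0 ?mulr_gt0 ?exprn_gt0// addr_gt0.
have B20 : 0 <= B1 / 2 by rewrite divr_ge0// ltW.
pose rho0 := (2 * L * B1)^-1.
have rho00 : 0 < rho0 by rewrite invr_gt0 mulr_gt0// mulr_gt0.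
pose th := Num.min 1 (rho0 / (8 * L)) / 2.
have th0 : 0 < th by rewrite divr_gt0// lt_min ltr01 divr_gt0// mulr_gt0.
have th1 : 2 * th <= 1 by rewrite /th mulrC divfK ?pnatr_eq0// ge_min lexx.
have th2 : 2 * th <= rho0 / (8 * L).
  by rewrite /th mulrC divfK ?pnatr_eq0// ge_min lexx orbT.
pose Q := N1 / r + B1 * N1 + 1.
have q10 : 0 < N1 / r by rewrite divr_gt0.
have q20 : 0 < B1 * N1 by rewrite mulr_gt0.
have Q0 : 0 < Q by rewrite addr_gt0// addr_gt0.
pose del := Num.min 1 (th / (2 * Q)).
have del0 : 0 < del by rewrite lt_min ltr01 divr_gt0// mulr_gt0.
have [net [netb netc]] := compact_net (bdry_compact bOm) del0.
have [nn Hnn] : exists nn : 'rV[R]_N -> 'rV[R]_N, forall x0, bdry Om x0 ->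
   [/\ `|nn x0| <= r^-1,
    forall x, bdry Om x -> `|x - x0| < r -> `|dot (nn x0) (x - x0)| <= (8 * L)^-1 * `|x - x0| &
    forall x y, bdry Om x -> `|x - x0| < r -> `|y| < r -> 1 <= dot (xpart (gamma (x, y))) (nn x0)].
  have H x0 : exists n : 'rV[R]_N, bdry Om x0 -> [/\ `|n| <= r^-1,
    forall x, bdry Om x -> `|x - x0| < r -> `|dot n (x - x0)| <= (8 * L)^-1 * `|x - x0| &
    forall x y, bdry Om x -> `|x - x0| < r -> `|y| < r -> 1 <= dot (xpart (gamma (x, y))) n].
    by have [/Hr[n Hn]|nb] := pselect (bdry Om x0); [exists n|exists 0].
  by have [nn Hnn] := choice H; exists nn.
(* The net is empty only if the boundary is. *)
have [net0|netN0] := eqVneq net [::].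
  exists [:: (0, 0)], 0, 1; split => // x j bx; exfalso.
  by have [y] := netc _ bx; rewrite net0.
pose pr x0 x := dot (nn x0) (x - x0) + B1 / 2 * dot (x - x0) (x - x0).
pose f x0 : 'rV[R]_N * 'rV[R]_N := (x0, (2 * M) *: nn x0).
pose s0 := [seq f x0 | x0 <- net].
have qprofE x0 x : qprof (2 * M * B1) (f x0) x = 2 * M * pr x0 x.
  by rewrite /qprof /pr /= dotZl; ring.
pose eta := Num.min (2 * M * th) (Num.min (r / 2) 1).
have M20 : 0 < 2 * M by rewrite mulr_gt0.
exists s0, (2 * M * B1), eta; split.
- by rewrite /s0; case: (net) netN0.
- by rewrite ltW// mulr_gt0.
- by rewrite !lt_min mulr_gt0//= divr_gt0//= ltr01.
move=> x j bx /mapP[x0 x0net ->] act y.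
rewrite !le_min => /and3P[_ yr y1].
have bx0 := netb _ x0net; have [nx0 chord0 ob0] := Hnn _ bx0.
have [x1 x1net xx1] := netc _ bx; have bx1 := netb _ x1net.
have [nx1 _ _] := Hnn _ bx1.
have Nle : N%:R <= N1 by rewrite lerDl.
have N0 : 0 <= N%:R :> R by [].
have del1 : del <= 1 by rewrite ge_min lexx.
have delQ : del * Q <= th / 2.
  have : del <= th / (2 * Q) by rewrite ge_min lexx orbT.
  by rewrite ler_pdivlMr ?mulr_gt0//; exact: half_le.
have pr1 : pr x1 x <= th / 2.
  apply: (le_trans _ delQ).
  have t1 := normr_ge0 (x - x1).
  have d1 : dot (nn x1) (x - x1) <= N1 / r * del.
    apply: (le_trans (ler_norm _)); apply: (le_trans (dot_norm_le _ _)).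
    by rewrite ler_pM ?mulr_ge0// ?(ltW xx1)// ler_pM.
  have d2 : dot (x - x1) (x - x1) <= N1 * del.
    apply: (le_trans (ler_norm _)); apply: (le_trans (dot_norm_le _ _)).
    rewrite -mulrA ler_pM ?mulr_ge0//.
    apply: (@le_trans _ _ (1 * del)); last by rewrite mul1r.
    by rewrite ler_pM// ltW// (lt_le_trans xx1).
  have d3 : B1 / 2 * dot (x - x1) (x - x1) <= B1 / 2 * (N1 * del).
    by rewrite ler_wpM2l// divr_ge0// ltW.
  by apply: near_value => //; rewrite mulr_ge0 ?(ltW q20) ?(ltW del0).
have act1 : pr x0 x < 2 * th.
  have /act : f x1 \in s0 by apply: map_f.
  rewrite !qprofE => H.
  have : 2 * M * pr x0 x <= 2 * M * (pr x1 x + th).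
    by apply: (le_trans H); rewrite (mulrDr (2 * M) (pr x1 x)) lerD2l ge_min lexx.
  rewrite ler_pM2l// => /le_lt_trans; apply.
  have -> : 2 * th = th + th by ring.
  by rewrite ltrD2r (le_lt_trans pr1)// ltr_pdivrMr// ltr_pMr// ltr1n.
have q0 := sqr_norm_le_dot (x - x0).
have t0 := normr_ge0 (x - x0).
(* An active centre is first within [r], where chords are controlled, then within
   [rho0]. *)
have xr : `|x - x0| < r.
  rewrite ltNge; apply/negP => rx; move: act1; apply/negP; rewrite -leNgt.
  apply: (le_trans th1).
  have d1 : `|dot (nn x0) (x - x0)| <= N1 / r * `|x - x0|.
    by apply: (le_trans (dot_norm_le _ _)); rewrite ler_wpM2r// ler_pM.
  have d2 : - (N1 / r * `|x - x0|) <= dot (nn x0) (x - x0).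
    by move: d1; rewrite ler_norml => /andP[].
  have d3 : B1 / 2 * `|x - x0| ^+ 2 <= B1 / 2 * dot (x - x0) (x - x0).
    by rewrite ler_wpM2l// divr_ge0// ltW.
  have d4 : (N1 + 1) / r * `|x - x0| <= B1 / 2 * `|x - x0| ^+ 2.
    rewrite expr2 (mulrA (B1 / 2)) ler_wpM2r//.
    have -> : (N1 + 1) / r = B1 / 2 * r by rewrite /B1; field; rewrite gt_eqF.
    by rewrite ler_wpM2l// divr_ge0// ltW.
  have d5 : 1 <= r^-1 * `|x - x0| by rewrite mulrC ler_pdivlMr// mul1r.
  rewrite (mulrDl N1 1 r^-1) mul1r (mulrDl (N1 / r) r^-1) in d4.
  exact: far_value d2 d3 d4 d5.
have xrho : `|x - x0| <= rho0.
  rewrite leNgt; apply/negP => rx; move: act1; apply/negP; rewrite -leNgt.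
  apply: (le_trans th2).
  have d2 : - ((8 * L)^-1 * `|x - x0|) <= dot (nn x0) (x - x0).
    by have := chord0 _ bx xr; rewrite ler_norml => /andP[].
  have d3 : B1 / 2 * `|x - x0| ^+ 2 <= B1 / 2 * dot (x - x0) (x - x0).
    by rewrite ler_wpM2l// divr_ge0// ltW.
  have d4 : (8 * L)^-1 * `|x - x0| + (8 * L)^-1 * `|x - x0| <= B1 / 2 * `|x - x0| ^+ 2.
    rewrite -mulrDl expr2 (mulrA (B1 / 2)) ler_wpM2r//.
    have -> : (8 * L)^-1 + (8 * L)^-1 = B1 / 2 * rho0.
      by rewrite /rho0; field; rewrite !gt_eqF.
    by rewrite ler_wpM2l// ltW.
  have d5 : rho0 / (8 * L) <= (8 * L)^-1 * `|x - x0|.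
    by rewrite mulrC ler_wpM2l// ltW.
  exact: far_value d2 d3 d4 d5.
rewrite /qprof_grad /= dotDr dotZr dotZr.
have y1' : -1 <= y <= 1 by rewrite -ler_norml.
have yr' : `|y| < r by apply: (le_lt_trans yr); rewrite ltr_pdivrMr// ltr_pMr// ltr1n.
have o1 := ob0 _ _ bx xr yr'.
have o2 : - 2^-1 <= B1 * dot (xpart (gamma (x, y))) (x - x0).
  have : `|B1 * dot (xpart (gamma (x, y))) (x - x0)| <= 2^-1; last by rewrite ler_norml => /andP[].
  rewrite normrM (gtr0_norm B10).
  apply: (@le_trans _ _ (B1 * (L * rho0))); last first.
    by rewrite le_eqVlt; apply/orP; left; apply/eqP; rewrite /rho0; field; rewrite !gt_eqF.
  rewrite ler_wpM2l ?(ltW B10)//; apply: (le_trans (dot_norm_le _ _)).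
  by rewrite ler_pM ?mulr_ge0// ler_pM// HGa.
have -> : 2 * M * dot (xpart (gamma (x, y))) (nn x0) +
    2 * M * B1 * dot (xpart (gamma (x, y))) (x - x0) =
    2 * M * (dot (xpart (gamma (x, y))) (nn x0) + B1 * dot (xpart (gamma (x, y))) (x - x0)).
  by ring.
by rewrite (mulrC 2) -mulrA -[leLHS]mulr1 ler_pM2l// half_gain.
Qed.

End Lateral.

(** * Uniform constants *)

Section Uniform.
Context {R : realType}.

Lemma near0_radius (Q : R -> Prop) : (\forall e \near (0 : R)^'+, Q e) ->
  exists2 d : R, 0 < d & forall e, 0 < e < d -> Q e.
Proof.
move=> [d /= d0 Hd]; exists d => // e /andP[e0 ed]; apply: Hd => //=.
by rewrite sub0r normrN gtr0_norm.
Qed.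

Lemma near0_mul (a b : R) : 0 < b -> \forall e \near (0 : R)^'+, a * e <= b.
Proof.
move=> b0; have d0 : 0 < b / (`|a| + 1) by rewrite divr_gt0// ltr_wpDl.
apply: filterS2 (nbhs_right_gt (0 : R)) (nbhs_right_lt d0) => e e0.
rewrite ltr_pdivlMr ?ltr_wpDl// => /ltW; apply: le_trans; rewrite mulrC ler_wpM2l ?(ltW e0)//.
by rewrite (le_trans (ler_norm a))// lerDl.
Qed.

Lemma seq_uniform {I : eqType} (s : seq I) (Q : I -> R -> Prop) :
  (forall j a b, Q j a -> a <= b -> Q j b) -> (forall j, exists a, Q j a) ->
  exists2 a : R, 0 <= a & forall j, j \in s -> Q j a.
Proof.
move=> mono ex; elim: s => [|j s [a a0 IH]]; first by exists 0.
have [b Hb] := ex j; exists (Num.max a b) => [|i]; first by rewrite le_max a0.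
rewrite inE => /orP[/eqP->|/IH H]; [apply: (mono _ _ _ Hb)|apply: (mono _ _ _ H)].
  by rewrite le_max lexx orbT.
by rewrite le_max lexx.
Qed.

Lemma C0_on_bounded {T : topologicalType} {V : normedModType R} (K : set T) (f : T -> V) :
  compact K -> C0_on K f -> exists2 M : R, 0 < M & forall x, K x -> `|f x| <= M.
Proof.
move=> cK [G cG EG]; have [M M0 HM] := compact_norm_bounded cK (continuous_subspaceT cG).
by exists M => // x Kx; rewrite EG//; exact: HM.
Qed.

Lemma pos_lower_bound {T : topologicalType} (K : set T) (f : T -> R) :
  compact K -> continuous f -> (forall x, K x -> 0 < f x) ->
  exists2 d : R, 0 < d & forall x, K x -> d <= f x.
Proof.
move=> /compact_near_coveringP/near_covering_withinP cov cf f0.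
have H : \forall d \near (0 : R)^'+, forall x, K x -> d <= f x.
  apply: cov => p Kp; have fp := f0 _ Kp.
  have H1 : \forall x \near p, f p / 2 < f x.
    by apply: (cvgr_gt _ (cf p)); rewrite ltr_pdivrMr// ltr_pMr// ltr1n.
  have fp2 : 0 < f p / 2 by rewrite divr_gt0.
  near=> x d => Kx /=; apply/ltW/(@lt_trans _ _ (f p / 2)).
    by near: d; exact: nbhs_right_lt.
  by apply: (near H1 x).
have [d [d0 Hd]] := filter_ex (filterI (nbhs_right_gt (0 : R)) H).
by exists d.
Unshelve. all: by end_near. Qed.

Lemma C1_lipschitz_vec {k l : nat} (f : 'rV[R]_k -> 'rV[R]_l) (M : R) : C1 f ->
  exists2 L : R, 0 <= L &
    forall x y, `|x| <= M -> `|y| <= M -> `|f x - f y| <= L * `|x - y|.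
Proof.
move=> Cf.
have [j a b H ab x y xM yM|i|L L0 HL] := @seq_uniform 'I_l (index_enum 'I_l) (fun i L =>
   forall x y, `|x| <= M -> `|y| <= M -> `|f x 0 i - f y 0 i| <= L * `|x - y|).
- by apply: (le_trans (H _ _ xM yM)); rewrite ler_wpM2r.
- by have [L _ HL] := C1_lipschitz M (C1_coord i Cf); exists L.
exists L => // x y xM yM; apply: rV_norm_le => [|i]; first by rewrite mulr_ge0.
by rewrite !mxE; apply: HL => //; exact: mem_index_enum.
Qed.

(** The penalty t^2 / 2 on the distance t to the frozen point competes with a gain
    that is linear in t with a factor of size e, so an active member has t = O(e). *)
Lemma active_close (t e G L n : R) : 0 < e -> 0 <= G -> 0 <= L -> 0 <= n -> 0 <= t ->
  t ^+ 2 / 2 <= G * e * (L * (t + e)) + n * e ^+ 2 / 2 -> t <= (2 * (G * L) + n + 2) * e.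
Proof.
move=> e0 G0 L0 n0 t0 H; rewrite leNgt; apply/negP => tT.
have GL0 : 0 <= G * L by exact: mulr_ge0.
move: (G * L) GL0 (G * e * (L * (t + e))) (esym (mulrACA G e L (t + e))) H tT => g g0 _ <- H tT.
have h1 : (2 * g + n + 2) * e * t < t * t by rewrite ltr_pM2r//; nra.
have h2 : (2 * g + n + 2) * e * e <= t * e by rewrite ler_pM2r// ltW.
have h3 : 0 <= n * (e * t) by rewrite !mulr_ge0// ltW.
have h4 : 0 <= g * (e * e) by rewrite !mulr_ge0// ltW.
have h5 : 0 <= n * (e * e) by rewrite !mulr_ge0// ltW.
have h6 : n * (e * e) <= n * (e * t).
  by rewrite ler_wpM2l// ler_pM2l//; nra.
have h7 : 0 < e * e by rewrite mulr_gt0.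
nra.
Qed.

End Uniform.

Section Lateral2.
Context {R : realType} {N : nat} (Om : set 'rV[R]_N) (nu : 'rV[R]_N -> 'rV[R]_N).
Hypothesis bOm : bounded_set Om.
Hypothesis hnu : outward_unit_normal Om nu.
Variable gamma : 'rV[R]_N * R -> 'rV[R]_(N + 1).
Hypothesis cgamma : C0_on (cylinder (bdry Om)) gamma.
Hypothesis pgamma : forall x y, bdry Om x -> -1 <= y <= 1 ->
  0 < dot (xpart (gamma (x, y))) (nu x).

(** Since the lateral field is strictly oblique, a large multiple of it dominates any
    bounded vector; the same multiple serves along the whole compact boundary. *)
Lemma corner_uniform (Ga : R) : 0 < Ga -> exists2 r : R, 0 < r &
  forall x, bdry Om x -> exists2 rho, C1_defining Om x rho &
    forall y, `|y| < r -> `|y| <= 1 ->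
      0 < dot (xpart (gamma (x, y))) (grad rho x) /\
      forall v : 'rV[R]_N, `|v| <= Ga ->
        0 < r^-1 * dot (xpart (gamma (x, y))) (grad rho x) + dot v (grad rho x).
Proof.
move=> Ga0; have [G cG EG] := cgamma.
have /compact_near_coveringP/near_covering_withinP cov := bdry_compact bOm.
have H : \forall r \near (0 : R)^'+, forall x, bdry Om x ->
  exists2 rho, C1_defining Om x rho &
    forall y, `|y| < r -> `|y| <= 1 ->
      0 < dot (xpart (gamma (x, y))) (grad rho x) /\
      forall v : 'rV[R]_N, `|v| <= Ga ->
        0 < r^-1 * dot (xpart (gamma (x, y))) (grad rho x) + dot v (grad rho x).
  apply: cov => p bp; have [rho Drho] := normal_near hnu pgamma bp.
  set c := dot _ _ => c0; have [Crho _ _] := Drho.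
  have ccont : dot (xpart (G q)) (grad rho q.1) @[q --> (p, (0 : R))] -->
      dot (xpart (G (p, 0))) (grad rho p).
    apply: cvg_dot; first exact: (cvg_comp _ _ (cG (p, 0)) (@xpart_cont R N _)).
    have cfst : fst q @[q --> (p, (0 : R))] --> p by exact: cvg_fst.
    exact: (cvg_comp _ _ cfst (@grad_cont _ _ rho Crho p)).
  have : c / 2 < dot (xpart (G (p, 0))) (grad rho p).
    rewrite -EG; last by split => //=; rewrite lerN10 ler01.
    by rewrite -/c ltr_pdivrMr// ltr_pMr// ltr1n.
  move=> /(cvgr_gt _ ccont)/nbhs_ballP[d /= d0 Hd].
  have gb : \forall x \near p, `|grad rho x| < `|grad rho p| + 1.
    apply: (cvgr_lt _ (cvg_norm (@grad_cont _ _ rho Crho p))).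
    by rewrite ltrDl.
  have Dn := C1_defining_near Drho.
  pose q := N%:R * Ga * (`|grad rho p| + 1) + 1.
  have q0 : 0 < q by rewrite ltr_wpDl// !mulr_ge0// ?addr_ge0// ltW.
  have nr : \forall r \near (0 : R)^'+, [/\ 0 < r, r < d & q <= r^-1 * (c / 2)].
    apply: filterS2 (filterI (nbhs_right_gt (0 : R)) (nbhs_right_lt d0))
      (near0_mul q (divr_gt0 c0 (ltr0Sn R 1))) => r [r0 rd] qr; split => //.
    by rewrite mulrC ler_pdivlMr.
  near=> x r => bx /=.
  have [r0 rd qr] : [/\ 0 < r, r < d & q <= r^-1 * (c / 2)] by apply: (near nr r).
  have xd : ball p d x by near: x; exact: nbhsx_ballx.
  have gx : `|grad rho x| < `|grad rho p| + 1 by apply: (near gb x).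
  exists rho; first by apply: (near Dn x).
  move=> y yr y1.
  have c2 : c / 2 < dot (xpart (gamma (x, y))) (grad rho x).
    rewrite EG; last by split => //=; rewrite -ler_norml.
    apply: Hd; split => //=; rewrite -ball_normE /= sub0r normrN.
    exact: lt_trans rd.
  have c20 : 0 < c / 2 by rewrite divr_gt0.
  split => [|v vGa]; first exact: lt_trans c2.
  have h1 : q < r^-1 * dot (xpart (gamma (x, y))) (grad rho x).
    by apply: (le_lt_trans qr); rewrite ltr_pM2l ?invr_gt0.
  have h2 : `|dot v (grad rho x)| < q.
    apply: (le_lt_trans (dot_norm_le _ _)).
    apply: (@le_lt_trans _ _ (N%:R * Ga * (`|grad rho p| + 1))); last by rewrite ltrDl.
    by rewrite ler_pM ?mulr_ge0// ?ler_pM// ltW.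
  by move: h2; rewrite ltr_norml => /andP[h2 _]; rewrite -(subrr q) ltrD.
have [r [r0 Hr]] := filter_ex (filterI (nbhs_right_gt (0 : R)) H).
by exists r.
Unshelve. all: by end_near. Qed.

Lemma lateral_y_small (e : R) : (forall x, bdry Om x -> ypart (gamma (x, 0)) = 0) -> 0 < e ->
  exists2 r : R, 0 < r & forall x y, bdry Om x -> `|y| <= r -> `|y| <= 1 ->
    `|ypart (gamma (x, y))| <= e.
Proof.
move=> g20 e0; have [G cG EG] := cgamma.
have /compact_near_coveringP/near_covering_withinP cov := bdry_compact bOm.
have H : \forall r \near (0 : R)^'+, forall x, bdry Om x ->
    forall y, `|y| <= r -> `|y| <= 1 -> `|ypart (gamma (x, y))| <= e.
  apply: cov => p bp.
  have cG2 : `|ypart (G q)| @[q --> (p, (0 : R))] --> `|ypart (G (p, 0))|.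
    exact: (cvg_norm (cvg_comp _ _ (cG (p, 0)) (@ypart_cont R N _))).
  have : `|ypart (G (p, 0))| < e.
    rewrite -EG ?g20 ?normr0//.
    by split => //=; rewrite lerN10 ler01.
  move=> /(cvgr_lt _ cG2)/nbhs_ballP[d /= d0 Hd].
  near=> x r => bx y yr y1 /=.
  rewrite EG; last by split => //=; rewrite -ler_norml.
  have xd : ball p d x by near: x; exact: nbhsx_ballx.
  have rd : r < d by near: r; exact: nbhs_right_lt.
  apply/ltW/Hd; split => //=; rewrite -ball_normE /= sub0r normrN.
  exact: le_lt_trans rd.
have [r [r0 Hr]] := filter_ex (filterI (nbhs_right_gt (0 : R)) H).
by exists r => // x y bx; exact: Hr.
Unshelve. all: by end_near. Qed.

End Lateral2.

(** * The barrier *)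

Section BarrierArith.
Context {R : realType}.

(** The balance on a horizontal face: the terms of order 0 cancel by the choice of
    the coefficient of y, the errors add up to [Q * e], and the quadratic term in y
    contributes at least [(Q + 1) * e]. *)
Lemma face_balance (g0 e1 e2 bj bo bb Cm Cy bt q1 q2 q3 q4 Q e : R) :
  0 < e -> g0 + bj = bo -> `|e1| <= q1 -> `|e2| <= q2 -> `|bb - (bj - Cm)| <= q3 ->
  `|bt - bo| <= q4 -> q1 + q2 + q3 + q4 = Q * e -> (Q + 1) * e <= Cy - Cm ->
  0 < (g0 + e1 + e2) + (bb + Cy) - bt.
Proof.
move=> e0 E1; rewrite !ler_norml => /andP[a1 _] /andP[a2 _] /andP[a3 _] /andP[_ a4] E2 H.
by lra.
Qed.

Lemma slab_abs (e a a' A A' y : R) : 0 < e -> `|a| <= A -> `|a'| <= A' ->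
  e * a <= y -> y <= e * a' -> `|y| <= (A + A') * e.
Proof.
move=> e0 ha ha' yl yu; have A0 := le_trans (normr_ge0 _) ha.
have A'0 := le_trans (normr_ge0 _) ha'.
move: ha ha'; rewrite !ler_norml => /andP[h1 _] /andP[_ h2].
have h3 : e * (- A) <= e * a by rewrite ler_pM2l.
have h4 : e * a' <= e * A' by rewrite ler_pM2l.
have h5 : 0 <= e * A by rewrite mulr_ge0// ltW.
have h6 : 0 <= e * A' by rewrite mulr_ge0// ltW.
by apply/andP; split; lra.
Qed.

Lemma value_lower (A Lam g h p yb d c : R) : `|p| <= Lam -> `|yb| <= h -> h <= g ->
  0 <= d -> 0 <= c -> A - (Lam + g) <= A + p + yb + d / 2 + c.
Proof.
by rewrite !ler_norml => /andP[h1 _] /andP[h2 _] ? ? ?; lra.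
Qed.

Lemma value_upper (A Lam g h p yb d c d' c' : R) : `|p| <= Lam -> `|yb| <= h -> h <= g ->
  d <= d' -> c <= c' -> A + p + yb + d / 2 + c <= A + (Lam + g) + (d' / 2 + c').
Proof.
by rewrite !ler_norml => /andP[_ h1] /andP[_ h2] ? ? ?; lra.
Qed.

Lemma active_gap (A p y b1 b2 d1 d2 c X t n : R) :
  A + p + y * b1 + d1 / 2 + c <= A + p + y * b2 + d2 / 2 + c ->
  t <= d1 -> d2 <= n -> y * (b2 - b1) <= X -> t / 2 <= X + n / 2.
Proof. by move=> *; lra. Qed.

Lemma active_profile (A p p' yb yb' d d' c h n eta : R) :
  A + p + yb + d / 2 + c <= A + p' + yb' + d' / 2 + c ->
  `|yb| <= h -> `|yb'| <= h -> 0 <= d -> d' <= n -> 0 <= n -> 2 * h + n <= eta ->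
  p <= p' + eta.
Proof.
by move=> H; rewrite !ler_norml => /andP[h1 _] /andP[_ h2] ? ? ?; lra.
Qed.

Lemma lateral_balance (M g d t : R) : M + 1 <= g -> `|d| <= 4^-1 -> `|t| <= 4^-1 ->
  M < g + d + t.
Proof. by move=> ?; rewrite !ler_norml => /andP[? _] /andP[? _]; lra. Qed.

Lemma half_sum (p q L1 L2 t : R) : `|p| <= L1 * t -> `|q| <= L2 * t -> 0 <= (L1 + L2) * t ->
  `|(p + q) / 2| <= (L1 + L2) * t.
Proof.
move=> hp hq h; have i2 : 0 <= (2^-1 : R) by rewrite invr_ge0.
rewrite normrM (ger0_norm i2) ler_pdivrMr//; apply: (le_trans (ler_normD _ _)).
apply: (le_trans (lerD hp hq)); rewrite -mulrDl; lra.
Qed.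

Lemma gain_pos (a t : R) : a + 1 <= t -> 0 < - a + t.
Proof. by move=> ?; lra. Qed.

End BarrierArith.

(** Strictness is asked for every [r] above the value of [W], because it is applied
    at points where the envelope [r] of a subsolution exceeds [W]. Touching majorants
    rather than smoothness of [W] let minima of smooth functions be barriers. *)
Definition barrier {R : realType} {N : nat} (P : thin_bvp R N) (eps C0 : R)
    (W : 'rV[R]_(N + 1) -> R) :=
  [/\ continuous W, forall z, bvp_closure P eps z -> `|W z| <= C0 &
      forall zh, bvp_closure P eps zh -> exists phi, [/\ C2 phi,
        forall z, bvp_closure P eps z -> W z <= phi z, W zh = phi zh &
        forall r, W zh <= r -> strict 1 P eps r (hess phi zh) (grad phi zh) zh]].

Section Barrier.
Context {R : realType} {N : nat}.
Variables (Om : set 'rV[R]_N) (gm gp : 'rV[R]_N -> R).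
Variable (F : 'M[R]_(N + 1) * 'rV[R]_(N + 1) * R * ('rV[R]_N * R) -> R).
Variables (gamma1m gamma1p : 'rV[R]_N * R -> 'rV[R]_N).
Variables (betam betap beta : 'rV[R]_N * R -> R) (c : lateral_condition R N).
Variables (gammao : 'rV[R]_N -> 'rV[R]_N) (betao : 'rV[R]_N -> R).
Hypothesis Om0 : Om !=set0.
Hypothesis bOm : bounded_set Om.
Hypothesis Cgm : C1 gm.
Hypothesis Cgp : C1 gp.
Hypothesis hg : forall x, closure Om x -> gm x < gp x.
Hypothesis hF : {within [set t | symmetric_mx t.1.1.1 /\ cylinder (closure Om) t.2], continuous F}.
Variable alpha : R.
Hypothesis halpha : 0 < alpha.
Hypothesis hmono : proper_op Om alpha F.
Hypothesis hgamma1m : C0_on (cylinder (closure Om)) gamma1m.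
Hypothesis hgamma1p : C0_on (cylinder (closure Om)) gamma1p.
Hypothesis hbeta : C0_on (cylinder (bdry Om)) beta.
Hypothesis hgammao : C1_on (closure Om) gammao.
Hypothesis hbetao : C1_on (closure Om) betao.

(** First-order closeness to the limit data, as given by the expansions at y = 0. *)
Definition face_expansion (A1 eta1 : R) := forall x y, closure Om x -> `|y| <= eta1 ->
  [/\ `|gamma1p (x, y) - gammao x| <= A1 * `|y|, `|gamma1m (x, y) + gammao x| <= A1 * `|y|,
      `|betap (x, y) - betao x| <= A1 * `|y| & `|betam (x, y) + betao x| <= A1 * `|y|].

Variables (A1 eta1 : R).
Hypothesis A10 : 0 <= A1.
Hypothesis eta10 : 0 < eta1.
Hypothesis hexp : face_expansion A1 eta1.

(** The conclusion of [oblique_family]; a Dirichlet condition is met by the height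
    of the barrier. *)
Definition lateral_family (s : seq ('rV[R]_N * 'rV[R]_N)) (B eta M : R) : Prop :=
  match c with
  | Dirichlet => True
  | Oblique gamma => forall x j, bdry Om x -> j \in s ->
     (forall i, i \in s -> qprof B j x <= qprof B i x + eta) ->
     forall y, `|y| <= eta -> M <= dot (xpart (gamma (x, y))) (qprof_grad B j x)
  end.

Hypothesis hfam : forall M : R, 0 < M -> exists (s : seq ('rV[R]_N * 'rV[R]_N)) (B eta : R),
  [/\ s != [::], 0 <= B, 0 < eta & lateral_family s B eta M].

Variable nu : 'rV[R]_N -> 'rV[R]_N.
Hypothesis hlat : lateral_admissible Om nu c.

Variable eps0 : R.
Hypothesis heps0 : 0 < eps0.
Hypothesis hcyl : forall eps, 0 < eps < eps0 -> forall z,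
  closure (Omega_eps Om gm gp eps) z -> -1 <= ypart z <= 1.

Let P := ThinBVP Om gm gp F gamma1m gamma1p betam betap c beta.
Let cO := closure_compact bOm.

(** By compactness the operator is bounded at r = 0, and properness adds the growth
    [alpha * r]; so a large value of u makes the equation strict. *)
Lemma F_lower (X0 : 'M[R]_(N + 1)) (Lam : R) : symmetric_mx X0 -> exists2 MF : R, 0 < MF &
  forall p x y r, `|p| <= Lam -> closure Om x -> -1 <= y <= 1 -> 0 <= r ->
    - MF + alpha * r <= F (X0, p, r, (x, y)).
Proof.
move=> sX; pose io (q : 'rV[R]_(N + 1) * ('rV[R]_N * R)) := (X0, q.1, 0 : R, q.2).
have cK : compact ([set p : 'rV[R]_(N + 1) | `|p| <= Lam] `*` cylinder (closure Om)).
  by apply: compact_setX; [exact: compact_rV_ball|exact: cyl_compact].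
have cFi : {within [set p : 'rV[R]_(N + 1) | `|p| <= Lam] `*` cylinder (closure Om),
    continuous (fun q => F (io q))}.
  apply/subspace_continuousP => q [_ qc].
  have Sq : symmetric_mx (io q).1.1.1 /\ cylinder (closure Om) (io q).2 by split.
  have /subspace_continuousP/(_ (io q) Sq) cF := hF.
  have cio : io t @[t --> q] --> io q.
    have c1 : t.1 @[t --> q] --> q.1 by exact: cvg_fst.
    have c2 : t.2 @[t --> q] --> q.2 by exact: cvg_snd.
    exact: (cvg_quad (cvg_cst X0) c1 (cvg_cst (0 : R)) c2).
  move=> V /cF HV.
  have nq : \forall t \near q, symmetric_mx (io t).1.1.1 /\ cylinder (closure Om) (io t).2 ->
     V (F (io t)) := cio _ HV.
  by apply: filterS nq => t Ht [_ tc]; apply: Ht; split.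
have [MF MF0 HMF] := compact_norm_bounded cK cFi.
exists MF => // p x y r pL cx y1 r0.
have := HMF (p, (x, y)) (conj pL (conj cx y1)); rewrite ler_norml => /andP[H _].
have ge0 : semidef_ge X0 X0 by move=> xi; rewrite subrr mulmx0 mul0mx mxE.
have := hmono p cx y1 sX sX ge0 r0; rewrite mulr0 subr0 lerBrDr.
by apply: le_trans; rewrite lerD2r.
Qed.

(* The mid-surface, and the coefficient of y that makes the horizontal conditions
   hold to leading order for the profile [j]. *)
Let m x := (gm x + gp x) / 2.
Let b B (j : 'rV[R]_N * 'rV[R]_N) x := betao x - dot (gammao x) (qprof_grad B j x).

Lemma family_bounds (s : seq ('rV[R]_N * 'rV[R]_N)) (B D : R) : 0 <= B -> 0 < D ->
  (forall x, closure Om x -> `|x| <= D) ->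
  exists2 Lam : R, 0 <= Lam & forall j, j \in s -> forall x, closure Om x ->
    [/\ `|qprof B j x| <= Lam, `|qprof_grad B j x| <= Lam, `|b B j x| <= Lam &
        forall x', closure Om x' -> `|b B j x - b B j x'| <= Lam * `|x - x'|].
Proof.
move=> B0 D0 HD; apply: seq_uniform => [j a a' H aa' x cx|j].
  have [h1 h2 h3 h4] := H x cx; split; [exact: le_trans aa'..|].
  by move=> x' cx'; apply: (le_trans (h4 _ cx')); rewrite ler_wpM2r.
have N0 : 0 <= N%:R :> R by [].
pose D2 := D + `|j.1|.
have D20 : 0 <= D2 by rewrite addr_ge0// ltW.
have xj x : closure Om x -> `|x - j.1| <= D2.
  by move=> cx; apply: (le_trans (ler_normB _ _)); rewrite lerD2r HD.
pose L1 := `|j.2| + B * D2.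
have L10 : 0 <= L1 by rewrite addr_ge0// mulr_ge0.
have h2 x : closure Om x -> `|qprof_grad B j x| <= L1.
  move=> cx; apply: (le_trans (ler_normD _ _)); rewrite lerD2l normrZ ger0_norm//.
  by rewrite ler_wpM2l// xj.
pose L0 := N%:R * `|j.2| * D2 + B / 2 * (N%:R * D2 * D2).
have h1 x : closure Om x -> `|qprof B j x| <= L0.
  move=> cx; apply: (le_trans (ler_normD _ _)); apply: lerD.
    by apply: (le_trans (dot_norm_le _ _)); rewrite ler_wpM2l ?mulr_ge0// xj.
  rewrite normrM ger0_norm ?divr_ge0// ler_wpM2l ?divr_ge0//.
  by apply: (le_trans (dot_norm_le _ _)); rewrite !ler_pM ?mulr_ge0// xj.
have [Go [Cgo Ego]] : exists Go : 'rV[R]_N -> 'rV[R]_N, C1 Go /\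
    forall x, closure Om x -> gammao x = Go x by have [Go] := hgammao; exists Go.
have [Bo [Cbo Ebo]] : exists Bo : 'rV[R]_N -> R, C1 Bo /\
    forall x, closure Om x -> betao x = Bo x by have [Bo] := hbetao; exists Bo.
have [Lg Lg0 HLg] := C1_lipschitz_vec D Cgo.
have [Lb Lb0 HLb] := C1_lipschitz D Cbo.
have [Mg Mg0 HMg] := compact_norm_bounded cO (continuous_subspaceT (C1_continuous Cgo)).
have [Mb Mb0 HMb] := compact_norm_bounded cO (continuous_subspaceT (C1_continuous Cbo)).
pose L3 := Mb + N%:R * Mg * L1.
have h3 x : closure Om x -> `|b B j x| <= L3.
  move=> cx; rewrite /b Ebo// Ego//; apply: (le_trans (ler_normB _ _)); apply: lerD.
    exact: HMb.
  by apply: (le_trans (dot_norm_le _ _)); rewrite !ler_pM ?mulr_ge0// ?HMg// h2.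
pose L4 := Lb + N%:R * Lg * L1 + N%:R * Mg * B.
have h4 x x' : closure Om x -> closure Om x' -> `|b B j x - b B j x'| <= L4 * `|x - x'|.
  move=> cx cx'; rewrite /b !Ebo// !Ego//.
  have -> : Bo x - dot (Go x) (qprof_grad B j x) - (Bo x' - dot (Go x') (qprof_grad B j x')) =
     (Bo x - Bo x') - dot (Go x - Go x') (qprof_grad B j x)
     - dot (Go x') (qprof_grad B j x - qprof_grad B j x').
    by rewrite dotBl dotBr; ring.
  rewrite /L4 !mulrDl; apply: (le_trans (ler_normB _ _)); apply: lerD.
    apply: (le_trans (ler_normB _ _)); apply: lerD; first by apply: HLb; exact: HD.
    apply: (le_trans (dot_norm_le _ _)); rewrite -!mulrA ler_wpM2l// mulrA mulrAC.
    by rewrite ler_pM ?mulr_ge0// ?h2// HLg ?HD.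
  have -> : qprof_grad B j x - qprof_grad B j x' = B *: (x - x').
    by rewrite /qprof_grad opprD addrACA subrr add0r -scalerBr opprB addrA subrK.
  apply: (le_trans (dot_norm_le _ _)); rewrite normrZ (ger0_norm B0) -(mulrA _ B).
  by rewrite ler_wpM2r ?mulr_ge0// ler_wpM2l// HMg.
exists (Num.max (Num.max L0 L1) (Num.max L3 L4)) => x cx; split.
- by apply: (le_trans (h1 _ cx)); rewrite !le_max lexx.
- by apply: (le_trans (h2 _ cx)); rewrite !le_max lexx !orbT.
- by apply: (le_trans (h3 _ cx)); rewrite !le_max lexx !orbT.
- move=> x' cx'; apply: (le_trans (h4 _ _ cx cx')); rewrite ler_wpM2r//.
  by rewrite !le_max lexx !orbT.
Qed.

Lemma oblique_bound : exists2 Ga : R, 0 < Ga &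
  [/\ forall x y, closure Om x -> -1 <= y <= 1 -> `|gamma1p (x, y)| <= Ga,
      forall x y, closure Om x -> -1 <= y <= 1 -> `|gamma1m (x, y)| <= Ga &
      match c with Dirichlet => True | Oblique gamma =>
        forall x y, bdry Om x -> -1 <= y <= 1 -> `|xpart (gamma (x, y))| <= Ga end].
Proof.
have [G1 G10 H1] := C0_on_bounded (cyl_compact cO) hgamma1p.
have [G2 G20 H2] := C0_on_bounded (cyl_compact cO) hgamma1m.
have [G3 G30 H3] : exists2 G3 : R, 0 < G3 & match c with Dirichlet => True
    | Oblique gamma => forall x y, bdry Om x -> -1 <= y <= 1 -> `|xpart (gamma (x, y))| <= G3 end.
  case: c hlat => [gamma [[G cG EG] _ _]|_]; last by exists 1.
  have cxG : C0_on (cylinder (bdry Om)) (fun q => xpart (gamma q)).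
    exists (fun q => xpart (G q)); last by move=> q /EG ->.
    by move=> q; exact: (cvg_comp _ _ (cG q) (@xpart_cont R N _)).
  have [G3 G30 H3] := C0_on_bounded (cyl_compact (bdry_compact bOm)) cxG.
  by exists G3 => // x y bx y1; exact: (H3 (x, y)).
exists (Num.max G1 (Num.max G2 G3)); first by rewrite lt_max G10.
split; [move=> x y cx y1; apply: (le_trans (H1 (x, y) (conj cx y1)))|
  move=> x y cx y1; apply: (le_trans (H2 (x, y) (conj cx y1)))|].
- by rewrite le_max lexx.
- by rewrite !le_max lexx !orbT.
- by case: c H3 => // gamma H x y bx y1; rewrite (le_trans (H _ _ bx y1))// !le_max lexx !orbT.
Qed.

Lemma gamma2_bound (e : R) : 0 < e -> exists2 r : R, 0 < r &
  match c with Dirichlet => True | Oblique gamma =>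
    forall x y, bdry Om x -> `|y| <= r -> `|y| <= 1 -> `|ypart (gamma (x, y))| <= e end.
Proof.
move=> e0; case: c hlat => [gamma [cg _ g20]|_]; last by exists 1.
exact: (lateral_y_small bOm cg g20 e0).
Qed.

(** One would like to take A + psi(x) + y b(x) + C y^2 / 2, where psi has a large
    oblique derivative on the lateral boundary and b = betao - gammao . D psi cancels
    the horizontal conditions to leading order. But psi and b cannot be taken [C2].
    Both are replaced by minima over finite families: psi by the profiles of
    [oblique_family], and b by its values at the points x' of an [eps]-net, with the
    penalty |x - x'|^2 / 2. The penalty makes every active member have
    |x - x'| = O(eps), so freezing b costs O(eps) on the horizontal faces. This is
    won back by the quadratic term: with the coefficient of y shifted by
    - C eps m(x'), its vertical derivative is about C (y - eps m(x)), which has the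
    right sign and size C eps (gp - gm) / 2 on either face. The gradients of active
    members are bounded independently of eps, so a large constant A makes the
    equation and a Dirichlet condition strict. *)
Lemma barrier_exists : exists2 C0 : R, 0 < C0 &
  \forall eps \near (0 : R)^'+, exists W, barrier P eps C0 W.
Proof.
have N0 : 0 <= N%:R :> R by [].
have [bmax bmax0 Hbmax] := C0_on_bounded (cyl_compact (bdry_compact bOm)) hbeta.
have M0 : 0 < bmax + 1 by rewrite addr_gt0.
have [s [B [eta [sN0 B0 eta0 fam]]]] := hfam M0.
have [Gm Gm0 HGm] := compact_norm_bounded cO (continuous_subspaceT (C1_continuous Cgm)).
have [Gp Gp0 HGp] := compact_norm_bounded cO (continuous_subspaceT (C1_continuous Cgp)).
pose G := Gm + Gp.
have G0 : 0 < G by rewrite addr_gt0.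
have [D D0 HD] := compact_norm_bounded cO (@continuous_subspaceT _ _ (closure Om) _
   (fun x : 'rV[R]_N => @cvg_id _ (nbhs x))).
have [Lam Lam0 HLam] := @family_bounds s B D B0 D0 HD.
have [Lm1 Lm10 HLm1] := C1_lipschitz D Cgm.
have [Lm2 Lm20 HLm2] := C1_lipschitz D Cgp.
have mlip x x' : closure Om x -> closure Om x' -> `|m x - m x'| <= (Lm1 + Lm2) * `|x - x'|.
  move=> cx cx'.
  have -> : m x - m x' = ((gm x - gm x') + (gp x - gp x')) / 2 by rewrite /m; field.
  apply: half_sum; [by apply: HLm1; exact: HD|by apply: HLm2; exact: HD|].
  by rewrite mulr_ge0// addr_ge0// ltW.
have mG x : closure Om x -> `|m x| <= G.
  move=> cx; rewrite -[G]mulr1; apply: half_sum; rewrite ?mulr1 ?HGm ?HGp//.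
  by rewrite addr_ge0// ltW.
pose L := Lam + (Lm1 + Lm2).
have L0 : 0 <= L by rewrite !addr_ge0// ltW.
have [Ga Ga0 [Hg1p Hg1m Hg1]] := oblique_bound.
have cgd : continuous (fun x => gp x - gm x).
  by move=> x; exact: (cvgB (C1_cvg Cgp x) (C1_cvg Cgm x)).
have [del del0 Hdel] := pos_lower_bound cO cgd (fun x cx => etrans (subr_gt0 _ _) (hg cx)).
(* [T * e] bounds the distance to the frozen point of an active member. *)
pose T := 2 * (G * L) + N%:R + 2.
have T0 : 0 <= T by rewrite !addr_ge0// !mulr_ge0// ltW.
(* The errors on the faces, in units of [e]: replacing gamma by gammao, the gradient
   of the penalty, freezing the coefficient of y, and replacing beta by betao. *)
pose Q1 := N%:R * (A1 * G) * Lam.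
pose Q2 := N%:R * Ga * T.
pose Q3 := L * T.
pose Q4 := A1 * G.
pose Q := Q1 + Q2 + Q3 + Q4.
have Q0 : 0 <= Q by rewrite /Q /Q1 /Q2 /Q3 /Q4 !addr_ge0// !mulr_ge0// ?ltW// mulr_ge0// ltW.
(* The quadratic term beats the errors by one unit, as [del] bounds gp - gm below. *)
pose C := 2 * (Q + 1) / del.
have C0 : 0 < C by rewrite divr_gt0// mulr_gt0// ltr_wpDl.
(* Bounds on the vertical derivative, on the whole gradient, and on the part of the
   test functions without the constant [A]. *)
pose Yb := Lam + G + G.
have Yb0 : 0 < Yb by rewrite addr_gt0// ltr_wpDl.
have e20 : 0 < (4 * (Yb + 1))^-1 by rewrite invr_gt0 mulr_gt0// addr_gt0.
have [r2 r20 Hr2] := gamma2_bound e20.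
pose Lp := Lam + T + Yb.
have [MF MF0 HMF] := F_lower Lp (@test_hess_sym R N B C).
pose V := Lam + G * (Lam + G).
have V0 : 0 <= V by rewrite addr_ge0// mulr_ge0 ?addr_ge0// ltW.
pose A := V + (bmax + 1 + (MF + 1) / alpha).
have A0 : 0 < A by rewrite ltr_wpDl// !addr_gt0// divr_gt0// addr_gt0.
pose CC := A + V + (N%:R * (D + D) * (D + D) / 2 + C / 2 * G ^+ 2).
have CC0 : 0 < CC.
  have DD : 0 <= D + D by rewrite addr_ge0// ltW.
  have k1 : 0 <= N%:R * (D + D) * (D + D) / 2 by rewrite divr_ge0// !mulr_ge0.
  have k2 : 0 <= C / 2 * G ^+ 2 by rewrite mulr_ge0 ?sqr_ge0// divr_ge0// ltW.
  by rewrite ltr_wpDr ?(addr_ge0 k1 k2)// ltr_wpDr.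
exists CC => //.
have GE : G = Gm + Gp by [].
have LE : L = Lam + (Lm1 + Lm2) by [].
have TE : T = 2 * (G * L) + N%:R + 2 by [].
have Q1E : Q1 = N%:R * (A1 * G) * Lam by [].
have Q2E : Q2 = N%:R * Ga * T by [].
have Q3E : Q3 = L * T by [].
have Q4E : Q4 = A1 * G by [].
have QE : Q = Q1 + Q2 + Q3 + Q4 by [].
have CE : C * del = 2 * (Q + 1) by rewrite /C mulfVK// gt_eqF.
have YbE : Yb = Lam + G + G by [].
have LpE : Lp = Lam + T + Yb by [].
have VE : V = Lam + G * (Lam + G) by [].
have AE : A = V + (bmax + 1 + (MF + 1) / alpha) by [].
have CCE : CC = A + V + (N%:R * (D + D) * (D + D) / 2 + C / 2 * G ^+ 2) by [].
clearbody CC A V Lp; clearbody Yb C; clearbody Q; clearbody Q1 Q2 Q3 Q4.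
clearbody T; clearbody L; clearbody G.
have q4 : 0 < (4^-1 : R) by rewrite invr_gt0.
near=> e.
have e0 : 0 < e by near: e; exact: nbhs_right_gt.
have ee0 : e < eps0 by near: e; exact: nbhs_right_lt.
have e1 : e < 1 by near: e; exact: nbhs_right_lt ltr01.
have Ce : C * e <= 1 by near: e; exact: near0_mul ltr01.
have Ge1 : G * e <= eta1 by near: e; exact: near0_mul.
have Ge2 : G * e <= eta by near: e; exact: near0_mul.
have Gr2 : G * e <= r2 by near: e; exact: near0_mul.
have Q2e : Q2 * e <= 4^-1 by near: e; exact: near0_mul.
have He : (2 * (G * (Lam + G)) + N%:R) * e <= eta by near: e; exact: near0_mul.
pose be j x := b B j x - C * e * m x.
have beE j x : be j x = b B j x - C * e * m x by [].
clearbody be.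
have Ce0 : 0 <= C * e by rewrite mulr_ge0// ltW.
have LG0 : 0 <= Lam + G by rewrite addr_ge0// ltW.
have beb j x : j \in s -> closure Om x -> `|be j x| <= Lam + G.
  move=> js cx; have [_ _ h3 _] := HLam j js x cx.
  rewrite beE; apply: (le_trans (ler_normB _ _)); apply: lerD => //.
  by rewrite normrM (ger0_norm Ce0) -[leRHS]mul1r ler_pM// mG.
have bel j x x' : j \in s -> closure Om x -> closure Om x' ->
    `|be j x - be j x'| <= L * `|x - x'|.
  move=> js cx cx'; have [_ _ _ h4] := HLam j js x cx.
  have -> : be j x - be j x' = (b B j x - b B j x') - C * e * (m x - m x') by rewrite !beE; ring.
  apply: (le_trans (ler_normB _ _)); rewrite LE [leRHS]mulrDl; apply: lerD; first exact: h4.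
  rewrite normrM (ger0_norm Ce0) -[leRHS]mul1r ler_pM//; exact: mlip.
have [xs [xsK xsc]] := compact_net cO e0.
pose idx := [seq (j, x') | j <- s, x' <- xs].
have idxN0 : idx != [::].
  have [x Ox] := Om0; have [y yxs _] := xsc x (@subset_closure _ Om x Ox).
  case: s sN0 @idx {fam HLam beb bel} => // j s' _ idx.
  have : (j, y) \in idx by apply/allpairsP; exists (j, y); rewrite inE eqxx.
  by case: idx.
have idxP j x' : (j, x') \in idx -> j \in s /\ x' \in xs.
  by move=> /allpairsP[[j1 x1] /= [js xx [-> ->]]].
pose Phi i := test_fn A B C (be i.1 i.2) i.1 i.2.
have cPhi i : continuous (Phi i).
  by apply: C1_continuous; apply: C2_C1; exact: test_fn_C2.
have PhiE i z : Phi i z = A + qprof B i.1 (xpart z) + ypart z * be i.1 i.2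
    + dot (xpart z - i.2) (xpart z - i.2) / 2 + C / 2 * ypart z ^+ 2 by exact: test_fnE.
have Phi2 i : C2 (Phi i) by exact: test_fn_C2.
have Phix i z : xpart (grad (Phi i) z) = qprof_grad B i.1 (xpart z) + (xpart z - i.2).
  exact: test_fn_grad_x.
have Phiy i z : ypart (grad (Phi i) z) = be i.1 i.2 + C * ypart z by exact: test_fn_grad_y.
have Phih i z : hess (Phi i) z = test_hess_mx B C by exact: test_fn_hess.
clearbody Phi.
have [W [cW Wle Wex]] := min_family idxN0 cPhi.
have KP z : bvp_closure P e z -> [/\ closure Om (xpart z), `|ypart z| <= G * e,
    `|ypart z| <= 1 & e * gm (xpart z) <= ypart z <= e * gp (xpart z)].
  move=> Kz; have [cx /andP[yl yu]] := slab_closure Cgm Cgp Kz.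
  have y1 : -1 <= ypart z <= 1 by apply: (hcyl _ Kz); rewrite e0.
  split => //; [|by rewrite ler_norml|by rewrite yl].
  by rewrite GE; apply: (slab_abs e0 (HGm _ cx) (HGp _ cx)).
have GeG : G * e <= G by rewrite ler_piMr ?ltW.
have ybe j x z : j \in s -> closure Om x -> bvp_closure P e z ->
    `|ypart z * be j x| <= G * e * (Lam + G).
  by move=> js cx Kz; have [_ yG _ _] := KP z Kz; rewrite normrM ler_pM// beb.
have Philow i z : i \in idx -> bvp_closure P e z -> A - V <= Phi i z.
  case: i => j x' /idxP[js /xsK cx'] Kz; have [cx yG _ _] := KP z Kz.
  have [h1 _ _ _] := HLam j js _ cx.
  have h2 := ybe j x' z js cx' Kz.
  have h3 : G * e * (Lam + G) <= G * (Lam + G) by rewrite ler_wpM2r.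
  have h4 : 0 <= C / 2 * ypart z ^+ 2 by rewrite mulr_ge0 ?sqr_ge0// divr_ge0// ltW.
  have h5 := dot_ge0 (xpart z - x').
  rewrite PhiE VE /=; exact: value_lower h1 h2 h3 h5 h4.
have Phiup i z : i \in idx -> bvp_closure P e z -> Phi i z <= CC.
  case: i => j x' /idxP[js /xsK cx'] Kz; have [cx yG _ _] := KP z Kz.
  have [h1 _ _ _] := HLam j js _ cx.
  have h2 := ybe j x' z js cx' Kz.
  have h3 : G * e * (Lam + G) <= G * (Lam + G) by rewrite ler_wpM2r.
  have h4 : C / 2 * ypart z ^+ 2 <= C / 2 * G ^+ 2.
    have y2 : ypart z ^+ 2 <= G ^+ 2.
      rewrite -[leLHS]real_normK ?num_real//.
      by apply: lerXn2r; rewrite ?nnegrE ?(ltW G0)// (le_trans yG).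
    by rewrite ler_wpM2l// divr_ge0// ltW.
  have h5 : dot (xpart z - x') (xpart z - x') <= N%:R * (D + D) * (D + D).
    apply: (le_trans (ler_norm _)); apply: (le_trans (dot_norm_le _ _)).
    have : `|xpart z - x'| <= D + D.
      by apply: (le_trans (ler_normB _ _)); apply: lerD; exact: HD.
    by move=> ?; rewrite !ler_pM ?mulr_ge0.
  rewrite PhiE CCE VE /=; exact: value_upper h1 h2 h3 h5 h4.
exists W; split => // [z Kz|zh Kzh].
  have [i ii ->] := Wex z; rewrite ler_norml (Phiup _ _ ii Kz) andbT.
  apply: (le_trans _ (Philow _ _ ii Kz)).
  have AV : 0 <= A - V by rewrite AE addrC addKr !addr_ge0 ?divr_ge0 ?addr_ge0 ?ltW.
  by rewrite (le_trans _ AV)// oppr_le0 ltW.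
have [[j x'] ji WE] := Wex zh; have [js x'xs] := idxP _ _ ji; have cx' := xsK _ x'xs.
exists (Phi (j, x')); split => //; [by move=> z _; exact: Wle|].
have [cx yG y1 /andP[yl yu]] := KP zh Kzh.
move: WE cx yG y1 yl yu; rewrite {1}PhiE /=.
set x := xpart zh; set y := ypart zh => WE cx yG y1 yl yu.
have y11 : -1 <= y <= 1 by rewrite -ler_norml.
have [x'' x''s xx''] := xsc x cx; have cx'' := xsK _ x''s.
have idxI i : i \in s -> (i, x'') \in idx by move=> iss; apply/allpairsP; exists (i, x'').
have d'' : dot (x - x'') (x - x'') <= N%:R * e ^+ 2.
  apply: (le_trans (ler_norm _)); apply: (le_trans (dot_norm_le _ _)).
  by rewrite -mulrA ler_wpM2l// expr2 ler_pM// ltW.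
have WPhi i : i \in s -> W zh <= A + qprof B i x + y * be i x'' + dot (x - x'') (x - x'') / 2
    + C / 2 * y ^+ 2.
  by move=> iss; have := Wle _ zh (idxI i iss); rewrite PhiE.
have t0 := normr_ge0 (x - x').
(* Comparing the active member with the one frozen at the nearest point of the net. *)
have closeT : `|x - x'| <= T * e.
  rewrite TE; apply: active_close => //; [exact: ltW|].
  have d' := sqr_norm_le_dot (x - x').
  have hy : y * (be j x'' - be j x') <= G * e * (L * (`|x - x'| + e)).
    apply: (le_trans (ler_norm _)); rewrite normrM ler_pM//.
    apply: (le_trans (bel j _ _ js cx'' cx')); rewrite ler_wpM2l//.
    apply: (le_trans (ler_distD x _ _)); rewrite addrC lerD2l distrC ltW//.
  by have := WPhi j js; rewrite WE => H; exact: active_gap H d' d'' hy.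
(* Since y = O(e), an active member has an almost minimal profile. *)
have actj i : i \in s -> qprof B j x <= qprof B i x + eta.
  move=> iss; have := WPhi i iss; rewrite WE => H.
  have h1 := ybe j x' zh js cx' Kzh; have h2 := ybe i x'' zh iss cx'' Kzh.
  have h3 : N%:R * e ^+ 2 <= N%:R * e by rewrite ler_wpM2l// expr2 ler_piMl ?ltW.
  have h5 : 0 <= N%:R * e by rewrite mulr_ge0// ltW.
  apply: (active_profile H h1 h2 (dot_ge0 _) (le_trans d'' h3) h5).
  have -> // : 2 * (G * e * (Lam + G)) + N%:R * e = (2 * (G * (Lam + G)) + N%:R) * e by ring.
have [p1 p2 _ _] := HLam j js x cx.
pose p := grad (Phi (j, x')) zh.
have px : xpart p = qprof_grad B j x + (x - x') by exact: Phix.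
have py : ypart p = be j x' + C * y by exact: Phiy.
have Cy : `|C * y| <= G.
  rewrite normrM (ger0_norm (ltW C0)); apply: (@le_trans _ _ (C * (G * e))).
    by rewrite ler_pM2l.
  by rewrite mulrCA ler_piMr ?(ltW G0).
have pyb : `|ypart p| <= Yb.
  by rewrite py YbE; apply: (le_trans (ler_normD _ _)); apply: lerD => //; exact: beb.
have Te : T * e <= T by rewrite ler_piMr// ltW.
have pL : `|p| <= Lp.
  rewrite LpE; apply: (le_trans (norm_split p)); apply: lerD => //.
  by rewrite px; apply: (le_trans (ler_normD _ _)); apply: lerD => //; exact: le_trans Te.
move=> r Wr.
have rA : bmax + 1 + (MF + 1) / alpha <= r.
  have -> : bmax + 1 + (MF + 1) / alpha = A - V by rewrite AE [V + _]addrC addrK.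
  apply: (le_trans (Philow _ _ ji Kzh)); apply: (le_trans _ Wr).
  by rewrite PhiE /= -WE.
have MFa : 0 < (MF + 1) / alpha by rewrite divr_gt0// addr_gt0.
have rMF : (MF + 1) / alpha <= r by apply: (le_trans _ rA); rewrite lerDr ltW.
have r0 : 0 <= r by rewrite (le_trans _ rMF)// ltW.
have Gae1 : 0 <= A1 * (G * e) by rewrite !mulr_ge0// ltW.
have face := hexp cx (le_trans yG Ge1).
have [f1 f2 f3 f4] := face.
have A1y : A1 * `|y| <= Q4 * e by rewrite Q4E -mulrA ler_wpM2l.
have errA (v w : 'rV[R]_N) : `|v| <= A1 * `|y| -> `|w| <= Lam -> `|dot v w| <= Q1 * e.
  move=> hv hw; apply: (le_trans (dot_norm_le _ _)).
  rewrite Q1E [leRHS]mulrAC; apply: ler_pM => //.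
  by rewrite -[leRHS]mulrA ler_wpM2l// -Q4E (le_trans hv).
have errT (v : 'rV[R]_N) : `|v| <= Ga -> `|dot v (x - x')| <= Q2 * e.
  move=> hv; apply: (le_trans (dot_norm_le _ _)).
  by rewrite Q2E -[leRHS]mulrA ler_pM ?mulr_ge0// ler_wpM2l.
have errb : `|be j x' - (b B j x - C * e * m x)| <= Q3 * e.
  rewrite -beE; apply: (le_trans (bel j _ _ js cx' cx)).
  by rewrite distrC Q3E -mulrA ler_wpM2l.
have Qe : Q1 * e + Q2 * e + Q3 * e + Q4 * e = Q * e by rewrite QE !mulrDl.
have Cdel : 2 * (Q + 1) <= C * (gp x - gm x).
  apply: (@le_trans _ _ (C * del)); last by rewrite ler_pM2l// Hdel.
  by rewrite CE.
have Cdele : (Q + 1) * e <= C * e * ((gp x - gm x) / 2).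
  have -> : C * e * ((gp x - gm x) / 2) = C * (gp x - gm x) / 2 * e by ring.
  by rewrite ler_wpM2r ?(ltW e0)// ler_pdivlMr// mulrC.
rewrite /strict -/p; split; rewrite mul1r.
- rewrite Phih; apply: (lt_le_trans _ (HMF _ _ _ _ pL cx y11 r0)).
  have : alpha * ((MF + 1) / alpha) <= alpha * r by rewrite ler_pM2l.
  by rewrite mulrCA mulfV ?gt_eqF// mulr1; exact: gain_pos.
- move=> [bx _]; have := Hbmax (x, y) (conj bx y11).
  rewrite ler_norml => /andP[_ hb]; rewrite subr_gt0; apply: (le_lt_trans hb).
  have := fam; have := Hr2; have := Hg1; rewrite /lateral_family /=.
  case: (c) => [gamma|] /= gb g2; last first.
    by move=> _; rewrite (lt_le_trans _ rA)// -addrA ltrDl addr_gt0.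
  move=> /(_ x j bx js actj y (le_trans yG Ge2)) g1.
  rewrite dot_split px dotDr; rewrite -[xy zh]/(x, y).
  have t1 := errT _ (gb _ _ bx y11).
  have t2 : `|ypart (gamma (x, y)) * ypart p| <= 4^-1.
    rewrite normrM; apply: (@le_trans _ _ ((4 * (Yb + 1))^-1 * Yb)).
      by rewrite ler_pM// g2// (le_trans yG).
    rewrite invfM -mulrA ler_piMr ?invr_ge0// mulrC ler_pdivrMr ?addr_gt0//.
    by rewrite mul1r lerDl.
  exact: lateral_balance g1 (le_trans t1 Q2e) t2.
- rewrite /top_bdry /= -/x -/y => -[_ yE].
  rewrite dot_split xpart_mkvec ypart_mkvec mul1r px py -[xy zh]/(x, y) /=.
  have -> : dot (gamma1p (x, y)) (qprof_grad B j x + (x - x')) =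
     dot (gammao x) (qprof_grad B j x) + dot (gamma1p (x, y) - gammao x) (qprof_grad B j x)
     + dot (gamma1p (x, y)) (x - x') by rewrite dotDr dotBl; ring.
  apply: (@face_balance _ _ _ _ (b B j x) (betao x) _ (C * e * m x) _ _
    (Q1 * e) (Q2 * e) (Q3 * e) (Q4 * e) Q e) => //.
  + by rewrite /b; ring.
  + exact: errA.
  + by apply: errT; exact: Hg1p.
  + exact: le_trans A1y.
  + rewrite yE (le_trans Cdele)// le_eqVlt; apply/orP; left.
    by apply/eqP; rewrite /m; field.
- rewrite /bot_bdry /= -/x -/y => -[_ yE].
  rewrite dot_split xpart_mkvec ypart_mkvec px py -[xy zh]/(x, y) /=.
  have -> : dot (gamma1m (x, y)) (qprof_grad B j x + (x - x')) =
     - dot (gammao x) (qprof_grad B j x) + dot (gamma1m (x, y) + gammao x) (qprof_grad B j x)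
     + dot (gamma1m (x, y)) (x - x') by rewrite dotDr dotDl; ring.
  have -> : -1 * (be j x' + C * y) = (- be j x') + (- (C * y)) by ring.
  apply: (@face_balance _ _ _ _ (- b B j x) (- betao x) _ (- (C * e * m x)) _ _
    (Q1 * e) (Q2 * e) (Q3 * e) (Q4 * e) Q e) => //.
  + by rewrite /b; ring.
  + exact: errA.
  + by apply: errT; exact: Hg1m.
  + by rewrite -!opprD normrN.
  + by rewrite opprK; exact: le_trans A1y.
  + rewrite yE (le_trans Cdele)// le_eqVlt; apply/orP; left.
    by apply/eqP; rewrite /m; field.
Unshelve. all: by end_near. Qed.

End Barrier.

(** * From barriers to bounds *)

Section EnvelopeArith.
Context {R : realType}.

Lemma env_gap (v a w c x : R) : v < a + (c - (a - w)) / 2 -> w - (c - (a - w)) / 2 < x ->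
  v - x < c.
Proof. by move=> *; lra. Qed.

Lemma le_sum4 (a b c d : R) : 0 <= a -> 0 <= b -> 0 <= c -> 0 <= d ->
  [/\ a <= a + b + c + d, b <= a + b + c + d, c <= a + b + c + d & d <= a + b + c + d].
Proof. by move=> ? ? ? ?; split; lra. Qed.

End EnvelopeArith.

Section Comparison.
Context {R : realType} {N : nat} (P : thin_bvp R N) (eps : R).
Let K := bvp_closure P eps.

(** At a maximum of the envelope minus [W], the majorant of [W] is a test function; if
    the envelope exceeded [W] there, the strict inequalities of the majorant would
    contradict the definition of a subsolution. *)
Lemma barrier_above C0 W w z : compact K -> barrier P eps C0 W ->
  visc_subsol P eps w -> K z -> w z <= C0.
Proof.
move=> cK [cW bW tW] /visc_subsolP[bw Hw] Kz.
have [Bw HBw] := bw.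
have [zh Kzh mx] : exists2 zh, K zh & forall y, K y ->
    usc_env K w y - W y <= usc_env K w zh - W zh.
  apply: (@usc_max _ _ K (fun y => usc_env K w y - W y) (Bw + C0) cK).
  - by exists z.
  - move=> y Ky; apply: lerD.
      exact: (le_trans (ler_norm _) (usc_env_bound HBw Ky)).
    by have := bW y Ky; rewrite ler_norml -lerNl => /andP[].
  - move=> y c Ky fc.
    have d0 : 0 < (c - (usc_env K w y - W y)) / 2 by rewrite divr_gt0// subr_gt0.
    have h1 := usc_env_usc bw Ky (etrans (ltrDl _ _) d0 : usc_env K w y < usc_env K w y + _).
    have h2 : \forall t \near y, W y - (c - (usc_env K w y - W y)) / 2 < W t.
      by apply: (cvgr_gt _ (cW y)); rewrite ltrBlDr ltrDl.
    by apply: filterS2 h1 h2 => t h1 h2 Kt; exact: env_gap (h1 Kt) h2.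
have le0 : usc_env K w zh <= W zh.
  rewrite leNgt; apply/negP => lt.
  have [phi [Cphi Wphi WE st]] := tW _ Kzh.
  apply: (Hw phi zh Cphi Kzh) (st _ (ltW lt)) => y Ky.
  rewrite -WE; apply: le_trans (mx y Ky).
  by rewrite lerD2l lerN2 Wphi.
apply: (le_trans (usc_env_ge bw Kz)); apply: (@le_trans _ _ (W z)).
  by rewrite -subr_le0; apply: (le_trans (mx z Kz)); rewrite subr_le0.
exact: (le_trans (ler_norm _) (bW z Kz)).
Qed.

(** The majorants of the reflected barrier become strict [C2] minorants of [- W], so
    [strict_touch] excludes any test function that violates the subsolution
    property. This gives Perron's method a subsolution to start from. *)
Lemma refl_barrier_subsol C0 W : bvp_ok P eps -> barrier (reflect_bvp P) eps C0 W ->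
  visc_subsol P eps (fun z => - W z).
Proof.
move=> ok [cW bW tW].
have bdN : bdd_on K (fun z => - W z) by exists C0 => z Kz; rewrite normrN; exact: bW.
have cN : continuous (fun z => - W z) by move=> z; exact: cvgN (cW z).
apply/visc_subsolP; split=> // psi zh Cpsi Kzh.
rewrite (usc_env_cont bdN cN Kzh) => mx.
have [phi [Cphi Wphi WE stphi]] := tW _ Kzh.
have := strict_refl (stphi (W zh) (lexx _)).
rewrite -(hess_opp _ Cphi) -(grad_opp _ (C2_C1 Cphi)) => st.
apply: (strict_touch ok (C2_opp Cphi) Cpsi Kzh _ st).
apply: filterE => w Kw; apply: (@le_trans _ _ (- W w - psi w)).
  by rewrite lerD2r lerN2 Wphi.
by rewrite -WE; have := mx w Kw; rewrite (usc_env_cont bdN cN Kw).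
Qed.

End Comparison.

(** * Smallness of the thickness *)

Section Expansion.
Context {R : realType} {N : nat} (Om : set 'rV[R]_N).
Hypothesis bOm : bounded_set Om.

Lemma expansion0_le {V : normedModType R} (f : 'rV[R]_N * R -> V) a b :
  C0_on (closure Om) b -> uniform_expansion0 (closure Om) f a b ->
  exists2 A : R, 0 <= A & \forall eta \near (0 : R)^'+,
    forall x y, closure Om x -> `|y| <= eta -> `|f (x, y) - a x| <= A * `|y|.
Proof.
move=> cb /(_ 1 ltr01) /nbhs_ballP[d /= d0 Hd].
have [M M0 HM] := C0_on_bounded (closure_compact bOm) cb.
exists (1 + M); first by rewrite addr_ge0// ltW.
near=> eta => x y cx ye.
have yd : ball 0 d y.
  by rewrite /ball /= sub0r normrN (le_lt_trans ye)//; near: eta; exact: nbhs_right_lt.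
have -> : f (x, y) - a x = (f (x, y) - (a x + y *: b x)) + y *: b x.
  by rewrite opprD addrA subrK.
apply: (le_trans (ler_normD _ _)); rewrite mulrDl; apply: lerD; first exact: Hd.
by rewrite normrZ mulrC ler_wpM2r// HM.
Unshelve. all: by end_near. Qed.

Lemma face_expansion_exists gamma1m gamma1p betam betap gammao betao km kp lm lp :
  C0_on (closure Om) km -> C0_on (closure Om) kp ->
  C0_on (closure Om) lm -> C0_on (closure Om) lp ->
  uniform_expansion0 (closure Om) gamma1p gammao kp ->
  uniform_expansion0 (closure Om) gamma1m (fun x => - gammao x) km ->
  uniform_expansion0 (closure Om) betap betao lp ->
  uniform_expansion0 (closure Om) betam (fun x => - betao x) lm ->
  exists A eta : R, [/\ 0 <= A, 0 < eta &
    face_expansion Om gamma1m gamma1p betam betap gammao betao A eta].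
Proof.
move=> ckm ckp clm clp e1 e2 e3 e4.
have [A1 A10 H1] := expansion0_le ckp e1; have [A2 A20 H2] := expansion0_le ckm e2.
have [A3 A30 H3] := expansion0_le clp e3; have [A4 A40 H4] := expansion0_le clm e4.
have [d d0 Hd] := near0_radius (filterI (filterI H1 H2) (filterI H3 H4)).
have d2 : 0 < d / 2 < d by rewrite divr_gt0//= ltr_pdivrMr// ltr_pMr// ltr1n.
have [h1 h2 h3 h4] := le_sum4 A10 A20 A30 A40.
exists (A1 + A2 + A3 + A4), (d / 2); split; [by rewrite !addr_ge0|by case/andP: d2|].
move=> x y cx yd; have [[f1 f2] [f3 f4]] := Hd _ d2.
have wk a t : t <= a * `|y| -> a <= A1 + A2 + A3 + A4 -> t <= (A1 + A2 + A3 + A4) * `|y|.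
  by move=> ta aA; apply: (le_trans ta); rewrite ler_wpM2r.
have := f4 x y cx yd; have := f2 x y cx yd; rewrite !opprK => g2 g4.
by split; [exact: wk (f1 x y cx yd) h1|exact: wk g2 h2|exact: wk (f3 x y cx yd) h3|exact: wk g4 h4].
Qed.

End Expansion.

Section Corner.
Context {R : realType}.

Lemma corner_slope (S e g d k : R) : 0 <= S -> 0 <= e -> S * `|g| <= 4^-1 -> `|d| <= k ->
  S * k * e <= 4^-1 -> `|S * (g - e * d)| <= 2^-1.
Proof.
move=> S0 e0 h1 h2 h3; rewrite normrM (ger0_norm S0).
apply: (@le_trans _ _ (S * `|g| + S * k * e)); last by lra.
rewrite -mulrA -mulrDr ler_wpM2l//; apply: (le_trans (ler_normB _ _)).
by rewrite lerD2l normrM (ger0_norm e0) mulrC ler_wpM2r.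
Qed.

Lemma corner_signs (p q : R) : `|p| <= 2^-1 -> `|q| <= 4^-1 ->
  [/\ 0 < p + (1 - q), 0 < - p + (1 + q) & 0 < - p + (1 - q)].
Proof.
by rewrite !ler_norml => /andP[? ?] /andP[? ?]; split; lra.
Qed.

End Corner.

Section Solvability.
Context {R : realType} {N : nat}.
Variables (Om : set 'rV[R]_N) (nu : 'rV[R]_N -> 'rV[R]_N).
Hypothesis hOm : bounded_domain Om.
Hypothesis hnu : outward_unit_normal Om nu.
Variables (gm gp : 'rV[R]_N -> R).
Hypothesis hgm : C1 gm.
Hypothesis hgp : C1 gp.
Hypothesis hg : forall x, closure Om x -> gm x < gp x.
Variables (gamma1m gamma1p : 'rV[R]_N * R -> 'rV[R]_N).
Hypothesis hgamma1m : C0_on (cylinder (closure Om)) gamma1m.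
Hypothesis hgamma1p : C0_on (cylinder (closure Om)) gamma1p.
Variable eps0 : R.
Hypothesis heps0 : 0 < eps0.
Hypothesis hadm : eps0_admissible Om gm gp gamma1m gamma1p eps0.
Variable (c : lateral_condition R N).
Hypothesis hc : lateral_admissible Om nu c.

Let oOm : open Om. Proof. by case: hOm. Qed.
Let bOm : bounded_set Om. Proof. by case: hOm. Qed.
Let cO := closure_compact bOm.

(** Let [S] be the large multiple of [corner_uniform]. The vertical part of the
    combined direction is 1 up to [S] times the vertical component of the lateral
    field, small near y = 0 because it vanishes there, and up to terms of size
    [eps]. *)
Lemma corner_near F betam betap beta (gamma : 'rV[R]_N * R -> 'rV[R]_(N + 1)) :
  lateral_admissible Om nu (Oblique gamma) ->
  \forall eps \near (0 : R)^'+,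
    forall x, bdry Om x ->
      corner_cone (ThinBVP Om gm gp F gamma1m gamma1p betam betap c beta) eps gamma x.
Proof.
move=> [cg pg g20].
have N0 : 0 <= N%:R :> R by [].
have [G1 G10 H1] := C0_on_bounded (cyl_compact cO) hgamma1p.
have [G2 G20 H2] := C0_on_bounded (cyl_compact cO) hgamma1m.
have [G3 G30 H3] := C0_on_bounded (cyl_compact (bdry_compact bOm)) cg.
have [Gm Gm0 HGm] := compact_norm_bounded cO (continuous_subspaceT (C1_continuous hgm)).
have [Gp Gp0 HGp] := compact_norm_bounded cO (continuous_subspaceT (C1_continuous hgp)).
have [Dm Dm0 HDm] := compact_norm_bounded cO (continuous_subspaceT (grad_cont hgm)).
have [Dp Dp0 HDp] := compact_norm_bounded cO (continuous_subspaceT (grad_cont hgp)).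
have Ga0 : 0 < G1 + G2 by exact: addr_gt0.
have [r r0 Hr] := corner_uniform bOm hnu cg pg Ga0.
have [r2 r20 Hr2] := lateral_y_small bOm cg g20 (divr_gt0 r0 (ltr0Sn R 3)).
have q4 : 0 < (4^-1 : R) by rewrite invr_gt0.
have i0 : 0 <= r^-1 by rewrite invr_ge0 ltW.
near=> e.
have e0 : 0 < e by near: e; exact: nbhs_right_gt.
have Ge1 : (Gm + Gp) * e <= 1 by near: e; exact: near0_mul.
have Gr : (Gm + Gp) * e <= r / 2 by near: e; apply: near0_mul; exact: divr_gt0.
have Gr2 : (Gm + Gp) * e <= r2 by near: e; exact: near0_mul.
have Sp : r^-1 * (N%:R * Dp * G3) * e <= 4^-1 by near: e; exact: near0_mul.
have Sm : r^-1 * (N%:R * Dm * G3) * e <= 4^-1 by near: e; exact: near0_mul.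
have Tp : (N%:R * Dp * G1) * e <= 4^-1 by near: e; exact: near0_mul.
have Tm : (N%:R * Dm * G2) * e <= 4^-1 by near: e; exact: near0_mul.
move=> x bx; have cx : closure Om x by case: bx.
have [rho Drho Hrho] := Hr x bx; exists rho, r^-1; split => // y /andP[yl yu].
have yG := slab_abs e0 (HGm _ cx) (HGp _ cx) yl yu.
have y1 : `|y| <= 1 by exact: le_trans Ge1.
have y11 : -1 <= y <= 1 by rewrite -ler_norml.
have yr : `|y| < r by apply: (le_lt_trans (le_trans yG Gr)); rewrite ltr_pdivrMr// ltr_pMr// ltr1n.
have [a1 a2] := Hrho y yr y1.
have b1 := H1 (x, y) (conj cx y11); have b2 := H2 (x, y) (conj cx y11).
have b3 : `|xpart (gamma (x, y))| <= G3.
  apply: rV_norm_le => [|i]; first exact: ltW.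
  by rewrite xpartE (le_trans (normr_coord _ _))// H3.
have b4 : r^-1 * `|ypart (gamma (x, y))| <= 4^-1.
  have := Hr2 x y bx (le_trans yG Gr2) y1 => h.
  by rewrite mulrC ler_pdivrMr// mulrC.
have dle (u v : 'rV[R]_N) a b : `|u| <= a -> `|v| <= b -> `|dot u v| <= N%:R * a * b.
  by move=> ua vb; apply: (le_trans (dot_norm_le _ _)); rewrite !ler_pM ?mulr_ge0.
have ed (d k : R) : `|d| <= k -> k * e <= 4^-1 -> `|e * d| <= 4^-1.
  by move=> dk; apply: le_trans; rewrite normrM (gtr0_norm e0) mulrC ler_wpM2r// ltW.
have s1 := corner_slope i0 (ltW e0) b4 (dle _ _ _ _ (HDp _ cx) b3) Sp.
have s2 := corner_slope i0 (ltW e0) b4 (dle _ _ _ _ (HDm _ cx) b3) Sm.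
have t1 := ed _ _ (dle _ _ _ _ (HDp _ cx) b1) Tp.
have t2 := ed _ _ (dle _ _ _ _ (HDm _ cx) b2) Tm.
have [c1 _ _] := corner_signs s1 t1; have [_ c2 _] := corner_signs s2 t2.
split => //; apply: a2; [apply: (le_trans b1)|apply: (le_trans b2)].
  by rewrite lerDl ltW.
by rewrite lerDr ltW.
Unshelve. all: by end_near. Qed.

Lemma bvp_ok_near F alpha betam betap beta :
  {within [set t | symmetric_mx t.1.1.1 /\ cylinder (closure Om) t.2], continuous F} ->
  proper_op Om alpha F ->
  C0_on (cylinder (closure Om)) betam -> C0_on (cylinder (closure Om)) betap ->
  C0_on (cylinder (bdry Om)) beta ->
  \forall eps \near (0 : R)^'+,
    bvp_ok (ThinBVP Om gm gp F gamma1m gamma1p betam betap c beta) eps.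
Proof.
move=> hF hmono hbm hbp hb.
set P := ThinBVP _ _ _ _ _ _ _ _ _ _.
pose lat_ok eps : Prop := if c is Oblique gamma then
  forall x, bdry Om x -> corner_cone P eps gamma x else True.
have hlat : \forall eps \near (0 : R)^'+, lat_ok eps.
  by rewrite /lat_ok; case: (c) hc => [gamma /corner_near|_]; [exact|exact: nearW].
near=> e.
have e0 : 0 < e by near: e; exact: nbhs_right_gt.
have ee0 : e < eps0 by near: e; exact: nbhs_right_lt.
have [k1 k2 k3] : [/\ _, _ & _] := hadm (introT andP (conj e0 ee0)).
split => //=.
- move=> p x y cx y1 X Y r sX sY XY.
  by have := hmono p x y cx y1 X Y r r sX sY XY (lexx r); rewrite lerD2r.
- have : lat_ok e by near: e; exact: hlat.
  by rewrite /lat_ok; case: (c) hc => [gamma [cg _ _] h|//]; split.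
Unshelve. all: by end_near. Qed.

Lemma lateral_family_exists (M : R) : 0 < M ->
  exists (s : seq ('rV[R]_N * 'rV[R]_N)) (B eta : R),
  [/\ s != [::], 0 <= B, 0 < eta & lateral_family Om c s B eta M].
Proof.
rewrite /lateral_family; case: (c) hc => [gamma [cg pg _]|_] M0.
  exact: (oblique_family oOm bOm hnu cg pg M0).
by exists [:: (0, 0)], 0, 1.
Qed.

End Solvability.

(** * The reflected data *)

Section Reflection.
Context {R : realType} {N : nat}.

Lemma refl_operator_continuous (Om : set 'rV[R]_N)
    (F : 'M[R]_(N + 1) * 'rV[R]_(N + 1) * R * ('rV[R]_N * R) -> R) :
  {within [set t | symmetric_mx t.1.1.1 /\ cylinder (closure Om) t.2], continuous F} ->
  {within [set t | symmetric_mx t.1.1.1 /\ cylinder (closure Om) t.2],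
    continuous (fun t => - F (- t.1.1.1, - t.1.1.2, - t.1.2, t.2))}.
Proof.
pose D := [set t : 'M[R]_(N + 1) * 'rV[R]_(N + 1) * R * ('rV[R]_N * R) |
  symmetric_mx t.1.1.1 /\ cylinder (closure Om) t.2].
pose io (t : 'M[R]_(N + 1) * 'rV[R]_(N + 1) * R * ('rV[R]_N * R)) :=
  (- t.1.1.1, - t.1.1.2, - t.1.2, t.2).
have ioD t : D t -> D (io t).
  by move=> [st ct]; split => //=; rewrite /symmetric_mx linearN /= st.
move=> hF; apply/subspace_continuousP => t Dt; apply: cvgN.
have /subspace_continuousP/(_ (io t) (ioD t Dt)) cF := hF.
have cio : io s @[s --> t] --> io t.
  have f1 : s.1 @[s --> t] --> t.1 by exact: cvg_fst.
  have f2 : s.2 @[s --> t] --> t.2 by exact: cvg_snd.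
  have f11 : s.1.1 @[s --> t] --> t.1.1 by apply: (cvg_comp _ _ f1); exact: cvg_fst.
  have f12 : s.1.2 @[s --> t] --> t.1.2 by apply: (cvg_comp _ _ f1); exact: cvg_snd.
  have f111 : s.1.1.1 @[s --> t] --> t.1.1.1 by apply: (cvg_comp _ _ f11); exact: cvg_fst.
  have f112 : s.1.1.2 @[s --> t] --> t.1.1.2 by apply: (cvg_comp _ _ f11); exact: cvg_snd.
  have n111 : - s.1.1.1 @[s --> t] --> - t.1.1.1 by exact: cvgN.
  have n112 : - s.1.1.2 @[s --> t] --> - t.1.1.2 by exact: cvgN.
  have n12 : - s.1.2 @[s --> t] --> - t.1.2 by exact: cvgN.
  exact: (cvg_quad n111 n112 n12 f2).
move=> V /cF HV; have nt : \forall s \near t, D (io s) -> V (F (io s)) := cio _ HV.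
by apply: filterS nt => s Hs Ds; apply: Hs; exact: ioD.
Qed.

Lemma refl_operator_mono (Om : set 'rV[R]_N)
    (F : 'M[R]_(N + 1) * 'rV[R]_(N + 1) * R * ('rV[R]_N * R) -> R) (alpha : R) :
  proper_op Om alpha F ->
  proper_op Om alpha (fun t => - F (- t.1.1.1, - t.1.1.2, - t.1.2, t.2)).
Proof.
move=> H p x y cx y1 X Y r s sX sY XY rs /=.
have sN (Z : 'M[R]_(N + 1)) : symmetric_mx Z -> symmetric_mx (- Z).
  by move=> sZ; rewrite /symmetric_mx linearN /= sZ.
have NXY : semidef_ge (- Y) (- X) by move=> xi; rewrite opprK addrC; exact: XY.
have := H (- p) x y cx y1 (- Y) (- X) (- s) (- r) (sN _ sY) (sN _ sX) NXY.
by rewrite lerN2 => /(_ rs); rewrite !mulrN !opprK -lerN2 !opprD.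
Qed.

Lemma C0_on_opp {T : topologicalType} (K : set T) (f : T -> R) :
  C0_on K f -> C0_on K (fun t => - f t).
Proof.
by move=> [G cG E]; exists (fun t => - G t) => [t|t /E -> //]; exact: cvgN (cG t).
Qed.

Lemma refl_face_expansion (Om : set 'rV[R]_N) gamma1m gamma1p betam betap gammao betao A1 eta1 :
  face_expansion Om gamma1m gamma1p betam betap gammao betao A1 eta1 ->
  face_expansion Om gamma1m gamma1p (fun t => - betam t) (fun t => - betap t) gammao
    (fun x => - betao x) A1 eta1.
Proof.
by move=> H x y cx /(H x y cx)[h1 h2 h3 h4]; split; rewrite // -opprD normrN.
Qed.

End Reflection.

Theorem proposition2 (R : realType) (N : nat) (hN : (1 <= N)%N)
  (Om : set 'rV[R]_N) (nu : 'rV[R]_N -> 'rV[R]_N)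
  (hOm : bounded_domain Om) (hbd : C1_boundary Om)
  (hnu : outward_unit_normal Om nu)
  (gm gp : 'rV[R]_N -> R) (hgm : C1 gm) (hgp : C1 gp)
  (hg : forall x, closure Om x -> gm x < gp x)
  (F : 'M[R]_(N + 1) * 'rV[R]_(N + 1) * R * ('rV[R]_N * R) -> R)
  (hF : {within [set t | symmetric_mx t.1.1.1 /\ cylinder (closure Om) t.2], continuous F})
  (alpha : R) (halpha : 0 < alpha)
  (hmono : forall (p : 'rV[R]_(N + 1)) (x : 'rV[R]_N) (y : R),
     closure Om x -> -1 <= y <= 1 ->
     forall (X Y : 'M[R]_(N + 1)) (r s : R),
       symmetric_mx X -> symmetric_mx Y -> semidef_ge X Y -> r <= s ->
       F (X, p, r, (x, y)) - alpha * r <= F (Y, p, s, (x, y)) - alpha * s)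
  (gamma1m gamma1p : 'rV[R]_N * R -> 'rV[R]_N)
  (hgamma1m : C0_on (cylinder (closure Om)) gamma1m)
  (hgamma1p : C0_on (cylinder (closure Om)) gamma1p)
  (betam betap : 'rV[R]_N * R -> R)
  (hbetam : C0_on (cylinder (closure Om)) betam)
  (hbetap : C0_on (cylinder (closure Om)) betap)
  (gammao : 'rV[R]_N -> 'rV[R]_N) (hgammao : C1_on (closure Om) gammao)
  (betao : 'rV[R]_N -> R) (hbetao : C1_on (closure Om) betao)
  (hgamma0 : forall x, closure Om x ->
     gamma1p (x, 0) = gammao x /\ - gamma1m (x, 0) = gammao x)
  (hbeta0 : forall x, closure Om x ->
     betap (x, 0) = betao x /\ - betam (x, 0) = betao x)
  (km kp : 'rV[R]_N -> 'rV[R]_N)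
  (hkm : C0_on (closure Om) km) (hkp : C0_on (closure Om) kp)
  (lm lp : 'rV[R]_N -> R)
  (hlm : C0_on (closure Om) lm) (hlp : C0_on (closure Om) lp)
  (hexp_gammap : uniform_expansion0 (closure Om) gamma1p gammao kp)
  (hexp_gammam :
     uniform_expansion0 (closure Om) gamma1m (fun x => - gammao x) km)
  (hexp_betap : uniform_expansion0 (closure Om) betap betao lp)
  (hexp_betam :
     uniform_expansion0 (closure Om) betam (fun x => - betao x) lm)
  (eps0 : R) (heps0 : 0 < eps0)
  (hadm : eps0_admissible Om gm gp gamma1m gamma1p eps0)
  (beta : 'rV[R]_N * R -> R) (hbeta : C0_on (cylinder (bdry Om)) beta)
  (c : lateral_condition R N) (hc : lateral_admissible Om nu c) :
  let P := ThinBVP Om gm gp F gamma1m gamma1p betam betap c beta in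
  exists eps1 C0 : R,
    [/\ 0 < eps1 < eps0, 0 < C0 &
        forall eps : R, 0 < eps < eps1 ->
          (exists u : 'rV[R]_(N + 1) -> R, visc_sol P eps u) /\
          (forall u : 'rV[R]_(N + 1) -> R, visc_sol P eps u ->
             (ereal_sup [set `|u z|%:E | z in bvp_closure P eps]
                <= C0%:E)%E)].
Proof.
move=> P.
have [Om0 _ _ bOm] := hOm.
have [A [eta [A0 eta0 face]]] := face_expansion_exists bOm hkm hkp hlm hlp
  hexp_gammap hexp_gammam hexp_betap hexp_betam.
have fam := lateral_family_exists hOm hnu hc.
have hcyl e : 0 < e < eps0 -> forall z,
    closure (Omega_eps Om gm gp e) z -> -1 <= ypart z <= 1.
  by move=> /hadm[h _ _] z /h[].
have [C1 C10 near1] := barrier_exists Om0 bOm hgm hgp hg hF halpha hmono hgamma1m hgamma1p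
  hbeta hgammao hbetao A0 eta0 face fam hc heps0 hcyl.
have hbetaoN : C1_on (closure Om) (fun x => - betao x).
  by have [G cG E] := hbetao; exists (fun x => - G x) => [|x /E -> //]; exact: C1_opp.
have [C2 C20 near2] := barrier_exists Om0 bOm hgm hgp hg (refl_operator_continuous hF) halpha
  (refl_operator_mono hmono) hgamma1m hgamma1p (C0_on_opp hbeta) hgammao hbetaoN A0 eta0
  (refl_face_expansion face) fam hc heps0 hcyl.
have near3 := bvp_ok_near hOm hnu hgm hgp hg hgamma1m hgamma1p heps0 hadm hc hF hmono
  hbetam hbetap hbeta.
have [d d0 Hd] := near0_radius (filterI near3 (filterI near1 near2)).
exists (Num.min d (eps0 / 2)), (Num.max C1 C2); split.
- by rewrite lt_min d0 divr_gt0//= gt_min ltr_pdivrMr// ltr_pMr// ltr1n orbT.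
- by rewrite lt_max C10.
move=> e /andP[e0]; rewrite lt_min => /andP[ed _].
have [ok [[W1 bar1] [W2 bar2]]] := Hd e (introT andP (conj e0 ed)).
have cK := bvp_closure_compact ok.
have up w : visc_subsol P e w -> forall z, bvp_closure P e z -> w z <= C1.
  by move=> sw z; exact: (barrier_above cK bar1).
split; first by exists (perron P e); exact: (perron_sol ok up (refl_barrier_subsol ok bar2)).
move=> u [sub super]; apply: ge_ereal_sup => _ [z Kz <-].
rewrite lee_fin ler_norml lerNl !le_max (up _ sub _ Kz) andbT.
by rewrite (barrier_above (P := reflect_bvp P) cK bar2 (supersol_refl super) Kz) orbT.
Qed.
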